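(* Let $p$ be a prime, $H>0$, and take $\alpha=2$. Then the following three constructions give Gaussian-integral representations of a constant multiple of the $p$-adic fractional Brownian motion of index $H$ (i.e. each of the processes below is equal in finite-dimensional distributions to $cB_H$ for some constant $c>0$, on its index set): (a) $X(t)=\int_{\mathbb Q_p}\big(|t-x|_p^{H-1/2}-|x|_p^{H-1/2}\big)M_2(dx)$ if $H\neq 1/2$, and $X(t)=\int_{\mathbb Q_p}\big(\log|t-x|_p-\log|x|_p\big)M_2(dx)$ if $H=1/2$, for $t\in\mathbb Q_p$; (b) $X(t)=\mathrm{Re}\int_{\mathbb Q_p}(\chi(t\xi)-1)|\xi|_p^{-H-1/2}\,\widetilde M_2(d\xi)$, for $t\in\mathbb Q_p$; (c) $X_n=\int_E p^{-kH}\big(\mathbf 1_{\{r\equiv n\ (\mathrm{mod}\ p^{k+1})\}}-\mathbf 1_{\{r\equiv0\ (\mathrm{mod}\ p^{k+1})\}}\big)\,M_2(dk,dr)$, for $n\in\mathbb N_0$ (representing $B_H$ restricted to $\mathbb N_0$).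
   Context: $\mathbb N_0=\{0,1,2,\dots\}$; $|x|_p=p^{-v_p(x)}$; $m$ is Haar measure on $\mathbb Q_p$ with $m(\mathbb Z_p)=1$. The $p$-adic fractional Brownian motion $B_H=\{B_H(t)\}_{t\in\mathbb Q_p}$ of index $H>0$ is the centered real Gaussian process with $B_H(0)=0$ and $\mathbb E[(B_H(t)-B_H(s))^2]=|t-s|_p^{2H}$. A real symmetric $2$-stable (Gaussian) random measure $M_2$ with control measure $\mu$ is independently scattered with $\mathbb E[e^{i\theta M_2(A)}]=\exp(-\theta^2\mu(A))$ when $\mu(A)<\infty$; the integral satisfies $\mathbb E[\exp(i\theta\int f\,dM_2)]=\exp(-\theta^2\int f^2d\mu)$ for real $f\in L^2(\mu)$. A complex isotropic one, $\widetilde M_2$, satisfies $\mathbb E[\exp(i\,\mathrm{Re}(\bar\theta\int f\,d\widetilde M_2))]=\exp(-|\theta|^2\int|f|^2d\mu)$ for $\theta\in\mathbb C$ and complex $f\in L^2(\mu)$. In (a) and (b) the control measure is $m$ on $\mathbb Q_p$; in (c), $E=\bigsqcup_{k=0}^\infty\mathbb Z/p^{k+1}\mathbb Z$ with counting measure on each level $k$. Kernels at singular points are assigned arbitrary values (Haar-null). The additive character $\chi:\mathbb Q_p\to\{z\in\mathbb C:|z|=1\}$ is given by $\chi(x)=1$ for $x\in\mathbb Z_p$ and $\chi(p^{-k}u)=\exp(2\pi i\,(u\bmod p^k)/p^k)$ for $k\ge1$, $u\in\mathbb Z_p\setminus p\mathbb Z_p$. *)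

(* Defs.v *)
From HB Require Import structures.
From mathcomp Require Import all_boot all_order all_algebra.
From mathcomp Require Import all_classical all_reals all_analysis.
From mathcomp Require Import complex.
Set Implicit Arguments.
Unset Strict Implicit.
Unset Printing Implicit Defensive.
Import Order.TTheory GRing.Theory Num.Theory.
Import numFieldNormedType.Exports.
Import ComplexField.Normc.
Local Open Scope classical_set_scope.
Local Open Scope ring_scope.
Local Open Scope complex_scope.

Definition rat_padic_abs (p : nat) (R : realType) (q : rat) : R :=
  if q == 0 then 0
  else p%:R ^ ((logn p `|denq q|%N)%:Z - (logn p `|numq q|%N)%:Z).

(* As realType does for the reals, padicFieldType characterizes Q_p up to
   isometric isomorphism: it is a completion of Q for the p-adic absolute
   value. *)
HB.mixin Record Field_isPadic (p : nat) (R : realType) K of GRing.Field K := {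
  padic_abs : K -> R ;
  padic_abs_ge0 : forall x, 0 <= padic_abs x ;
  padic_abs_eq0 : forall x, padic_abs x = 0 -> x = 0 ;
  padic_absM : forall x y, padic_abs (x * y) = padic_abs x * padic_abs y ;
  padic_absD : forall x y,
    padic_abs (x + y) <= Num.max (padic_abs x) (padic_abs y) ;
  padic_abs_rat : forall q : rat, padic_abs (ratr q) = rat_padic_abs p R q ;
  padic_rat_dense : forall x (e : R), 0 < e ->
    exists q : rat, padic_abs (x - ratr q) < e ;
  padic_complete : forall u : nat -> K,
    (forall e : R, 0 < e -> exists N, forall m n, (N <= m)%N -> (N <= n)%N ->
       padic_abs (u m - u n) < e) ->
    exists l, forall e : R, 0 < e -> exists N, forall n, (N <= n)%N ->
      padic_abs (u n - l) < e
}.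

#[short(type="padicFieldType")]
HB.structure Definition PadicField (p : nat) (R : realType) :=
  {K of GRing.Field K & Field_isPadic p R K}.

Arguments padic_abs {p R K} x : rename.

Section padic.
Context {p : nat} {R : realType} (K : padicFieldType p R).

Definition padic_open : set (set K) :=
  [set U | forall x, U x -> exists2 e : R, 0 < e &
           forall y, padic_abs (y - x) < e -> U y].

Definition padic_borel : Type := K.

HB.instance Definition _ := Choice.on padic_borel.
HB.instance Definition _ := isPointed.Build padic_borel (0 : K).
HB.instance Definition _ :=
  @isMeasurable.Build (sigma_display padic_open) padic_borel
  <<s padic_open >> (@sigma_algebra0 _ setT padic_open)
  (@sigma_algebraC padic_borel padic_open)
  (@sigma_algebra_bigcup _ setT padic_open).

Definition padic_int : set K := [set x | padic_abs x <= 1].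

Record is_haar (m : set padic_borel -> \bar R) : Prop := IsHaar {
  haar_padic_int : m padic_int = 1%E ;
  haar_translation : forall (A : set padic_borel) (t : K),
    measurable A -> m [set x + t | x in (A : set K)] = m A }.

(* the residue in {0, ..., p^k - 1} of a p-adic integer u modulo p^k *)
Definition padic_mod (k : nat) (u : K) : nat :=
  xget 0%N [set a : nat | (a < p ^ k)%N /\ padic_abs (u - a%:R) <= p%:R ^- k].

Definition expi (a : R) : R[i] := cos a +i* sin a.

(* A non-integral x is p^-k u with |u| = 1, where p^k = |x|. *)
Definition padic_char (x : K) : R[i] :=
  if padic_abs x <= 1 then 1
  else let k := xget 0%N [set k : nat | padic_abs x = p%:R ^+ k] in
       expi (2 * pi * (padic_mod k (p%:R ^+ k * x))%:R / p%:R ^+ k).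

End padic.

Section processes.
Context {R : realType}.

Definition fdd_eq (I : Type) (d1 : measure_display) (T1 : measurableType d1)
    (P1 : probability T1 R) (X1 : I -> T1 -> R)
    (d2 : measure_display) (T2 : measurableType d2)
    (P2 : probability T2 R) (X2 : I -> T2 -> R) : Prop :=
  forall (n : nat) (t : 'I_n -> I) (A : set (n.-tuple R)), measurable A ->
    P1 [set w | A [tuple X1 (t i) w | i < n]] =
    P2 [set w | A [tuple X2 (t i) w | i < n]].

Context {d : measure_display} {T : measurableType d} (P : probability T R).

(* normal_prob 0 s is the normal law only for s != 0. *)
Definition centered_normal (Y : T -> R) : Prop :=
  exists s : R, forall A : set R, measurable A ->
    P (Y @^-1` A) = if s == 0 then \d_(0 : R) A else normal_prob 0 s A.

Definition centered_gaussian_process (I : Type) (B : I -> T -> R) : Prop :=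
  (forall t, measurable_fun setT (B t)) /\
  (forall (n : nat) (t : 'I_n -> I) (a : 'I_n -> R),
     centered_normal (fun w => \sum_(i < n) a i * B (t i) w)).

Record is_padic_fBm (p : nat) (K : padicFieldType p R) (H : R)
    (B : K -> T -> R) : Prop := IsPadicFBm {
  fBm_gaussian : centered_gaussian_process B ;
  fBm0 : {ae P, forall w, B 0 w = 0} ;
  fBm_increments : forall t s,
    'E_P[(fun w => (B t w - B s w) ^+ 2)%R]%E =
    (padic_abs (t - s) `^ (2 * H))%:E }.

Definition mutually_independent (d' : measure_display) (V : measurableType d')
    (n : nat) (Y : 'I_n -> T -> V) : Prop :=
  forall B : 'I_n -> set V, (forall i, measurable (B i)) ->
    P (\bigcap_i (Y i @^-1` B i)) = (\prod_(i < n) P (Y i @^-1` B i))%E.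

Definition complex_expectation (Z : T -> R[i]) : R[i] :=
  fine 'E_P[(fun w => complex.Re (Z w))]%E +i*
  fine 'E_P[(fun w => complex.Im (Z w))]%E.

Definition complex_pair (z : R[i]) : R * R := (complex.Re z, complex.Im z).

Context {d' : measure_display} {S : measurableType d'}
  (mu : {measure set S -> \bar R}).

Definition has_finite_measure (A : set S) : Prop := measurable A /\ (mu A < +oo)%E.

(* M A is only relevant when mu A < +oo. *)
Record gaussian_random_measure (M : set S -> T -> R) : Prop :=
  GaussianRandomMeasure {
  grm_measurable : forall A, has_finite_measure A -> measurable_fun setT (M A) ;
  grm_char : forall A, has_finite_measure A -> forall theta : R,
    complex_expectation (fun w => expi (theta * M A w)) =
    (expR (- (theta ^+ 2 * fine (mu A))))%:C ;
  grm_independent : forall (n : nat) (A : 'I_n -> set S),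
    (forall i, has_finite_measure (A i)) -> trivIset setT A ->
    mutually_independent (fun i => M (A i)) ;
  grm_sigma_additive : forall A : nat -> set S,
    (forall i, measurable (A i)) -> trivIset setT A ->
    (mu (\bigcup_i A i) < +oo)%E ->
    {ae P, forall w, (fun n => \sum_(i < n) M (A i) w) @ \oo -->
                     M (\bigcup_i A i) w} }.

Record complex_gaussian_random_measure (M : set S -> T -> R[i]) : Prop :=
  ComplexGaussianRandomMeasure {
  cgrm_measurable : forall A, has_finite_measure A ->
    measurable_fun setT (fun w => complex_pair (M A w)) ;
  cgrm_char : forall A, has_finite_measure A -> forall theta : R[i],
    complex_expectation (fun w => expi (complex.Re (theta^* * M A w))) =
    (expR (- (normc theta ^+ 2 * fine (mu A))))%:C ;
  cgrm_independent : forall (n : nat) (A : 'I_n -> set S),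
    (forall i, has_finite_measure (A i)) -> trivIset setT A ->
    mutually_independent (fun i w => complex_pair (M (A i) w)) ;
  cgrm_sigma_additive : forall A : nat -> set S,
    (forall i, measurable (A i)) -> trivIset setT A ->
    (mu (\bigcup_i A i) < +oo)%E ->
    {ae P, forall w,
      (fun n => normc (\sum_(i < n) M (A i) w - M (\bigcup_i A i) w)) @ \oo
      --> (0 : R)} }.

(* The list s of pairs (c, A) stands for the simple function
   \sum c 1_A; the sets A need not be disjoint. *)
Definition simple_integrand (V : nzRingType) (s : seq (V * set S)) : Prop :=
  forall a, a \in s -> has_finite_measure a.2.

Definition simple_fct (V : nzRingType) (s : seq (V * set S)) (x : S) : V :=
  \sum_(a <- s) a.1 * \1_(a.2) x.

Definition simple_integral (V : nzRingType) (M : set S -> T -> V)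
    (s : seq (V * set S)) (w : T) : V :=
  \sum_(a <- s) a.1 * M a.2 w.

(* Y is a version of the integral of f in L^2(mu) with respect to M: the limit
   in probability of the integrals of simple functions converging to f in
   L^2(mu). *)
Definition is_integral (M : set S -> T -> R) (f : S -> R) (Y : T -> R) : Prop :=
  [/\ measurable_fun setT f,
      (\int[mu]_x ((f x) ^+ 2)%:E < +oo)%E,
      measurable_fun setT Y &
      exists s : nat -> seq (R * set S),
      [/\ forall n, simple_integrand (s n),
          (fun n => \int[mu]_x ((simple_fct (s n) x - f x) ^+ 2)%:E)%E @ \oo
            --> 0%E &
          forall e : R, 0 < e ->
            (fun n => P [set w | e <= `|simple_integral M (s n) w - Y w|])
              @ \oo --> 0%E]].

Definition is_complex_integral (M : set S -> T -> R[i]) (f : S -> R[i])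
    (Y : T -> R[i]) : Prop :=
  [/\ measurable_fun setT (fun x => complex_pair (f x)),
      (\int[mu]_x (normc (f x) ^+ 2)%:E < +oo)%E,
      measurable_fun setT (fun w => complex_pair (Y w)) &
      exists s : nat -> seq (R[i] * set S),
      [/\ forall n, simple_integrand (s n),
          (fun n => \int[mu]_x (normc (simple_fct (s n) x - f x) ^+ 2)%:E)%E
            @ \oo --> 0%E &
          forall e : R, 0 < e ->
            (fun n => P [set w | e <= normc (simple_integral M (s n) w - Y w)])
              @ \oo --> 0%E]].

End processes.

Section kernels.
Context {p : nat} {R : realType} (K : padicFieldType p R) (H : R).

(* [sing] gives the arbitrary values at the singular points. *)
Definition harmonizable_kernel (sing : K -> K -> R[i]) (t xi : K) : R[i] :=
  if xi == 0 then sing t xi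
  else (padic_char (t * xi) - 1) * (padic_abs xi `^ (- H - 2^-1))%:C.

Definition moving_average_kernel (sing : K -> K -> R) (t x : K) : R :=
  if (x == 0) || (x == t) then sing t x
  else if H == 2^-1 then ln (padic_abs (t - x)) - ln (padic_abs x)
  else padic_abs (t - x) `^ (H - 2^-1) - padic_abs x `^ (H - 2^-1).

End kernels.

Section tree.
Variable p : nat.

(* 'Z_q is Z/qZ for q > 1, which holds here when p is prime. *)
Definition residue_levels : Type := {k : nat & 'Z_(p ^ k.+1)}.

HB.instance Definition _ := Choice.on residue_levels.
HB.instance Definition _ :=
  isPointed.Build residue_levels (existT _ 0%N (0 : 'Z_(p ^ 1))).
HB.instance Definition _ := @isMeasurable.Build default_measure_display
  residue_levels (@discrete_measurable residue_levels)
  (@discrete_measurable0 _) (@discrete_measurableC _)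
  (@discrete_measurableU _).

Definition residue_kernel (R : realType) (H : R) (n : nat)
    (e : residue_levels) : R :=
  let: existT k r := e in
  p%:R `^ (- (k%:R * H)) * ((r == n%:R)%:R - (r == 0)%:R).

End tree.

(* Main.v *)
Require Import Defs.
From HB Require Import structures.
From mathcomp Require Import all_boot all_order all_algebra.
From mathcomp Require Import all_classical all_reals all_analysis.
From mathcomp Require Import complex.
From mathcomp Require Import measurable_realfun ring lra.
Set Implicit Arguments.
Unset Strict Implicit.
Unset Printing Implicit Defensive.
Import Order.TTheory GRing.Theory Num.Theory.
Import numFieldNormedType.Exports.
Local Open Scope classical_set_scope.
Local Open Scope ring_scope.

(** The three processes are Gaussian integrals X_t of kernels f_t against a
    random measure, and a centered Gaussian process is determined by the
    variances of its values and increments.  So it suffices that the squared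
    L^2 distance of f_t and f_s be C |t - s|_p^(2 H), and the squared norm of
    f_t be C |t|_p^(2 H), with one constant 0 < C < +oo.  The normalization
    E exp (i th M A) = exp (- th^2 mu A) makes the variance of the integral
    twice the squared norm of the integrand, hence X is equal in law to
    sqrt (2 C) B_H.

    The probabilistic half works with the integrals of cos (Y + c), the phase c
    giving cosines and sines at once instead of complex exponentials.
    - [fdd_eq_of_cos]: these integrals, over all linear combinations of the
      process, determine the finite-dimensional distributions.  The functions
      that may be inserted as a factor under the equality of the integrals form
      an algebra closed under bounded pointwise limits; it contains the sign of
      sin ((l - a) / n) for every linear form l, hence the indicator of l > a.
    - [normal_charfun], [second_moment_eq]: the transform of a centered normal
      variable, and the identification of its parameter with the variance.
    - [simple_charfun]: the integral of a simple function is, on the atoms of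
      the sets involved, a sum of independent variables, whose transforms
      multiply by [sum_charfun].
    - [gaussian_integral_charfun]: the transform passes to limits in
      probability.  [simple_integrals_converge] provides these limits: second
      moments of simple integrals are at most twice the squared norms.
    - [fdd_eq_fBm]: polarization on both sides.
    A complex random measure enters through the real functionals Re (u c M A)
    for a fixed u of modulus 1, so that both cases share one argument, with R
    or R[i] as space of scalars.

    The p-adic half computes the three distances.
    - [moving_average_distance]: the difference of the kernels at t and s
      vanishes outside the balls of radius |t - s| around t and s, because the
      triangle with vertices t, s and x is isosceles.  On each of them it is
      radial, and the spheres of radius |t - s| / p^n scale.
    - [harmonizable_distance]: the character being additive, the squared
      difference is |chi ((t - s) x) - 1|^2 |x|^(- 2 H - 1), which is constant
      on cosets of the ball of radius 1 / |t - s|; on each sphere it is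
      integrated by counting residues.
    - [residue_kernel_distance]: the residues of n and m at level k differ iff
      the valuation of n - m is at most k, which leaves the tail of a geometric
      series. *)

(** * Bounded measurable functions *)

Section bounded_measurable.
Context {R : realType} {d : measure_display} {S : measurableType d}.
Implicit Types f g : S -> R.

Definition bounded_measurable f :=
  measurable_fun setT f /\ exists C : R, forall x, `|f x| <= C.

Lemma bounded_measurable_cst (c : R) : bounded_measurable (cst c).
Proof. by split; [exact: measurable_cst | exists `|c|]. Qed.

Lemma bounded_measurableD f g :
  bounded_measurable f -> bounded_measurable g -> bounded_measurable (f \+ g).
Proof.
move=> [mf [C fC]] [mg [D gD]]; split; first exact: measurable_funD.
by exists (C + D) => x; rewrite (le_trans (ler_normD _ _))// lerD.
Qed.

Lemma bounded_measurableM f g :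
  bounded_measurable f -> bounded_measurable g -> bounded_measurable (f \* g).
Proof.
move=> [mf [C fC]] [mg [D gD]]; split; first exact: measurable_funM.
by exists (C * D) => x; rewrite normrM ler_pM.
Qed.

Lemma bounded_measurableZ c f :
  bounded_measurable f -> bounded_measurable (fun x => c * f x).
Proof.
by move=> bf; apply: (@bounded_measurableM (cst c)) => //; exact: bounded_measurable_cst.
Qed.

Lemma measurable_cos f :
  measurable_fun setT f -> measurable_fun setT (fun x => cos (f x)).
Proof.
by move=> mf; apply: measurableT_comp => //; apply: continuous_measurable_fun;
  exact: continuous_cos.
Qed.

Lemma measurable_sin f :
  measurable_fun setT f -> measurable_fun setT (fun x => sin (f x)).
Proof.
by move=> mf; apply: measurableT_comp => //; apply: continuous_measurable_fun;
  exact: continuous_sin.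
Qed.

Lemma bounded_measurable_cos f :
  measurable_fun setT f -> bounded_measurable (fun x => cos (f x)).
Proof.
move=> mf; split; first exact: measurable_cos.
by exists 1 => x; rewrite ler_norml cos_geN1 cos_le1.
Qed.

Lemma bounded_measurable_sin f :
  measurable_fun setT f -> bounded_measurable (fun x => sin (f x)).
Proof.
move=> mf; split; first exact: measurable_sin.
by exists 1 => x; rewrite ler_norml sin_geN1 sin_le1.
Qed.

Lemma bounded_measurable_indic (A : set S) :
  measurable A -> bounded_measurable (\1_A : S -> R).
Proof.
move=> mA; split; first exact: measurable_indic.
by exists 1 => x; rewrite indicE; case: (_ \in _); rewrite ?normr1 ?normr0.
Qed.

Lemma measurable_superlevel f (e : R) :
  measurable_fun setT f -> measurable [set x | e <= f x].
Proof.
move=> mf; rewrite -[X in measurable X]setTI.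
rewrite (_ : [set x | _] = f @^-1` `[e, +oo[%classic); last first.
  by apply/seteqP; split => x /=; rewrite in_itv/= andbT.
by apply: mf => //; exact: measurable_itv.
Qed.

Lemma bounded_measurable_comp d' (T : measurableType d') (X : T -> S) f :
  measurable_fun setT X -> bounded_measurable f ->
  measurable_fun setT (f \o X) /\ exists C, forall x, `|(f \o X) x| <= C.
Proof.
move=> mX [mf [C fC]]; split; first exact: measurableT_comp.
by exists C => x; exact: fC.
Qed.

Lemma integrable_bounded_measurable (P : {finite_measure set S -> \bar R}) f :
  bounded_measurable f -> P.-integrable setT (EFin \o f).
Proof.
move=> [mf [C fC]]; apply: measurable_bounded_integrable => //.
  exact: fin_num_fun_lty.
by exists C; split; rewrite ?num_real// => M CM x _; apply: (le_trans (fC x)); exact: ltW.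
Qed.

Lemma Rintegral_bounded_cvg (P : probability S R) (F : nat -> S -> R) f (C : R) :
  (forall n, measurable_fun setT (F n)) -> (forall n x, `|F n x| <= C) ->
  measurable_fun setT f ->
  {ae P, forall x, F n x @[n --> \oo] --> f x} ->
  \int[P]_x F n x @[n --> \oo] --> \int[P]_x f x.
Proof.
move=> mF FC mf Ff.
have [intf _ cvf] : [/\ P.-integrable setT (EFin \o f),
  (\int[P]_x `|(F n x)%:E - (f x)%:E|)%E @[n --> \oo] --> 0%E &
  (\int[P]_x (F n x)%:E)%E @[n --> \oo] --> (\int[P]_x (f x)%:E)%E].
  apply: (@dominated_convergence _ _ _ P setT measurableT
    (fun n x => (F n x)%:E) (EFin \o f) (cst C%:E)).
  - by move=> n; exact/measurable_EFinP.
  - exact/measurable_EFinP.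
  - by apply: filterS Ff => x Fx _; apply: cvg_EFin => //; exact: nearW.
  - exact: finite_measure_integrable_cst.
  - by apply: aeW => x n _; rewrite /= lee_fin.
apply: fine_cvg; rewrite fineK//; exact: integrable_fin_num.
Qed.

Import HBNNSimple.

Lemma nnsfun_approximation f : measurable_fun setT f -> (forall x, 0 <= f x) ->
  exists g : nat -> {nnsfun S >-> R}, (forall n x, g n x <= f x) /\
    forall x, g n x @[n --> \oo] --> f x.
Proof.
move=> mf f0; have mfE : measurable_fun setT (EFin \o f) by exact/measurable_EFinP.
have fE0 x : setT x -> (0 <= (EFin \o f) x)%E by rewrite lee_fin.
exists (nnsfun_approx measurableT mfE); split=> [n x|x].
  by rewrite -lee_fin nnsfun_approxE; exact: le_approx.
by have /fine_cvg := cvg_nnsfun_approx measurableT mfE fE0 (Logic.I : setT x).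
Qed.

Lemma nnsfun_sum (h : {nnsfun S >-> R}) x : h x =
  \sum_(y <- finmap.enum_fset (fset_set (range h))) y * \1_(h @^-1` [set y]) x.
Proof. by rewrite [LHS]fimfunE fsbig_finite. Qed.

End bounded_measurable.

(** * Laws determined by trigonometric integrals *)

Section smoothstep.
Context {R : realType}.
Implicit Types y : R.

(** Polynomial whose fixed points are -1, 0 and 1, the outer ones attracting:
    its iterates turn a function with values in [-1, 1] into its sign. *)
Definition smoothstep y : R := (3 * y - y ^+ 3) / 2.

Lemma smoothstepN y : smoothstep (- y) = - smoothstep y.
Proof. by rewrite /smoothstep; field. Qed.

Lemma iter_smoothstepN n y :
  iter n smoothstep (- y) = - iter n smoothstep y.
Proof. by elim: n => [//|n IH]; rewrite !iterS IH smoothstepN. Qed.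

Lemma iter_smoothstep_le1 n y : `|y| <= 1 -> `|iter n smoothstep y| <= 1.
Proof.
move=> y1; elim: n => [//|n]; rewrite iterS; set z := iter _ _ _.
rewrite !ler_norml /smoothstep => /andP[z0 z1].
have h1 : 0 <= (1 + z) ^+ 2 * (2 - z) by rewrite mulr_ge0 ?sqr_ge0//; lra.
have h2 : 0 <= (1 - z) ^+ 2 * (2 + z) by rewrite mulr_ge0 ?sqr_ge0//; lra.
by apply/andP; split; nra.
Qed.

Lemma iter_smoothstep_cvg y : `|y| <= 1 ->
  iter n smoothstep y @[n --> \oo] --> Num.sg y.
Proof.
wlog y0 : y / 0 <= y => [hw|].
  have [y0|y0 y1] := leP 0 y; first exact: hw.
  have := hw (- y); rewrite oppr_ge0 normrN ltW// => /(_ isT y1) h.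
  rewrite -[y]opprK sgrN; under eq_fun do rewrite iter_smoothstepN.
  exact: cvgN.
rewrite ger0_norm// => y1; have [->|yn0] := eqVneq y 0.
  rewrite sgr0; under eq_fun => n.
    rewrite (_ : iter n smoothstep 0 = 0); last first.
      by elim: n => [//|n IH]; rewrite iterS IH /smoothstep mulr0 expr0n subr0 mul0r.
    over.
  exact: cvg_cst.
have yp : 0 < y by rewrite lt_neqAle eq_sym yn0.
rewrite gtr0_sg//.
have bnd n : y <= iter n smoothstep y <= 1 /\
    1 - iter n smoothstep y <= (1 - y / 2) ^+ n.
  (* 1 - smoothstep z = (1 - z) (1 - z (1 + z) / 2), and the last factor is at
     most 1 - y / 2 as long as y <= z *)
  elim: n => [|n]; first by rewrite expr0 /= lexx y1; split => //; lra.
  rewrite iterS; set z := iter _ _ _ => -[/andP[yz z1] hz].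
  have h1 : 0 <= z * (1 - z) * (1 + z) by rewrite !mulr_ge0//; lra.
  have h2 : 0 <= (1 - z) ^+ 2 * (2 + z) by rewrite mulr_ge0 ?sqr_ge0//; lra.
  have h3 : 0 <= (1 - z) * (z - y + z * z) 
    by apply: mulr_ge0; [lra|apply: addr_ge0; [lra|apply: mulr_ge0; lra]].
  split; first by rewrite /smoothstep; apply/andP; split; nra.
  rewrite exprS; have : 1 - smoothstep z <= (1 - y / 2) * (1 - z).
    rewrite /smoothstep; nra.
  move/le_trans; apply; apply: ler_wpM2l => //; lra.
have cv : 1 - (1 - y / 2) ^+ n @[n --> \oo] --> (1 : R).
  rewrite -[X in _ --> X]subr0; apply: cvgB; first exact: cvg_cst.
  by apply: cvg_expr; rewrite ger0_norm; lra.
apply: (squeeze_cvgr _ cv (cvg_cst (1 : R))).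
by apply: nearW => n; have [/andP[_ ->] h] := bnd n; rewrite andbT lerBlDr addrC -lerBlDr.
Qed.

Lemma sg_sin_div_cvg (z : R) :
  Num.sg (sin (z / n.+1%:R)) @[n --> \oo] --> Num.sg z.
Proof.
wlog z0 : z / 0 <= z => [hw|].
  have [z0|z0] := leP 0 z; first exact: hw.
  have := hw (- z); rewrite oppr_ge0 ltW// => /(_ isT) h.
  rewrite -[z]opprK sgrN; under eq_fun do rewrite mulNr sinN sgrN.
  exact: cvgN.
have [->|zn0] := eqVneq z 0.
  by under eq_fun do rewrite mul0r sin0; exact: cvg_cst.
have zp : 0 < z by rewrite lt_neqAle eq_sym zn0.
apply: cvg_near_cst.
have [N _ hN] : \forall n \near \oo, z / pi < n%:R by exact: nbhs_infty_gtr.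
exists N => // n /= Nn; rewrite [RHS]gtr0_sg// gtr0_sg// sin_gt0_pi//.
apply/andP; split; first by rewrite divr_gt0.
rewrite ltr_pdivrMr// mulrC -ltr_pdivrMr ?pi_gt0//.
by apply: (lt_le_trans (hN _ Nn)); rewrite ler_nat.
Qed.

End smoothstep.

Section uniqueness.
Context {R : realType} {d d1 d2 : measure_display} {S : measurableType d}
  {T1 : measurableType d1} {T2 : measurableType d2}
  (P1 : probability T1 R) (P2 : probability T2 R)
  (X1 : T1 -> S) (X2 : T2 -> S) (L : set (S -> R)).
Hypothesis mX1 : measurable_fun setT X1.
Hypothesis mX2 : measurable_fun setT X2.
Hypothesis mL : forall l, L l -> measurable_fun setT l.
Hypothesis LD : forall l l', L l -> L l' -> L (l \+ l').
Hypothesis LZ : forall c l, L l -> L (fun x => c * l x).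

Let same (F : S -> R) := \int[P1]_w F (X1 w) = \int[P2]_w F (X2 w).

Hypothesis same_cos : forall l c, L l -> same (fun x => cos (l x + c)).

(* F is good when it may be inserted as a factor in same_cos, and a multiplier
   when it preserves goodness: unlike goodness, this is stable under products. *)
Let good (F : S -> R) := bounded_measurable F /\
  forall l c, L l -> same (fun x => F x * cos (l x + c)).

Let int1 F : bounded_measurable F ->
  P1.-integrable setT (EFin \o (fun w => F (X1 w))).
Proof.
move=> bF; apply: integrable_bounded_measurable.
by have [? ?] := bounded_measurable_comp mX1 bF.
Qed.

Let int2 F : bounded_measurable F ->
  P2.-integrable setT (EFin \o (fun w => F (X2 w))).
Proof.
move=> bF; apply: integrable_bounded_measurable.
by have [? ?] := bounded_measurable_comp mX2 bF.
Qed.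

Let sameD F G : bounded_measurable F -> bounded_measurable G ->
  same F -> same G -> same (F \+ G).
Proof.
move=> bF bG sF sG; rewrite /same /= RintegralD//; [|exact: int1..].
by rewrite RintegralD//; [rewrite sF sG|exact: int2..].
Qed.

Let sameZ c F : bounded_measurable F -> same F -> same (fun x => c * F x).
Proof.
move=> bF sF; rewrite /same /= RintegralZl//; last exact: int1.
by rewrite RintegralZl// ?sF//; exact: int2.
Qed.

Let same_cvg (F : nat -> S -> R) f (C : R) : (forall n, same (F n)) ->
  (forall n, measurable_fun setT (F n)) -> (forall n x, `|F n x| <= C) ->
  (forall x, F n x @[n --> \oo] --> f x) -> same f.
Proof.
move=> sF mF FC Ff.
have mf : measurable_fun setT f by apply: measurable_fun_cvg => // x _; exact: Ff.
have cv (d' : measure_display) (T : measurableType d') (P : probability T R)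
    (X : T -> S) : measurable_fun setT X ->
    \int[P]_w F n (X w) @[n --> \oo] --> \int[P]_w f (X w).
  move=> mX; apply: (@Rintegral_bounded_cvg _ _ _ P (fun n w => F n (X w)) _ C) => //.
  - by move=> n; exact: measurableT_comp.
  - exact: measurableT_comp.
  - by apply: aeW => w; exact: Ff.
rewrite /same -(cvg_lim _ (cv _ _ P1 _ mX1))// -(cvg_lim _ (cv _ _ P2 _ mX2))//.
by congr (limn _); apply/funext => n; exact: sF.
Qed.

Let good1 : good (cst 1).
Proof.
split; first exact: bounded_measurable_cst.
move=> l c Ll; have := same_cos c Ll.
by congr same; apply/funext => x; rewrite mul1r.
Qed.

Let bcos l c : L l -> bounded_measurable (fun x => cos (l x + c)).
Proof.
move=> Ll; apply: bounded_measurable_cos; apply: measurable_funD => //.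
exact: mL.
Qed.

Let goodD F G : good F -> good G -> good (F \+ G).
Proof.
move=> [bF cF] [bG cG]; split; first exact: bounded_measurableD.
move=> l c Ll; rewrite (_ : (fun x => _) =
  (fun x => F x * cos (l x + c)) \+ (fun x => G x * cos (l x + c))).
  by apply: sameD; [apply: bounded_measurableM => //; exact: bcos..|exact: cF|exact: cG].
by apply/funext => x /=; rewrite mulrDl.
Qed.

Let goodZ a F : good F -> good (fun x => a * F x).
Proof.
move=> [bF cF]; split; first exact: bounded_measurableZ.
move=> l c Ll; rewrite (_ : (fun x => _) = (fun x => a * (F x * cos (l x + c)))).
  by apply: sameZ; [apply: bounded_measurableM => //; exact: bcos|exact: cF].
by apply/funext => x /=; rewrite mulrA.
Qed.

Let bounded_measurable_cvg (F : nat -> S -> R) f (C : R) :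
  (forall n, measurable_fun setT (F n)) -> (forall n x, `|F n x| <= C) ->
  (forall x, F n x @[n --> \oo] --> f x) -> bounded_measurable f.
Proof.
move=> mF FC Ff; split; first by apply: (measurable_fun_cvg mF) => x _; exact: Ff.
exists C => x; have nF : `|F n x| @[n --> \oo] --> `|f x| by exact: cvg_norm.
by rewrite -(cvg_lim _ nF)//; apply: limr_le; [exact: cvgP nF|exact: nearW].
Qed.

Let good_cvg (F : nat -> S -> R) f (C : R) : (forall n, good (F n)) ->
  (forall n x, `|F n x| <= C) ->
  (forall x, F n x @[n --> \oo] --> f x) -> good f.
Proof.
move=> gF FC Ff.
have mF n : measurable_fun setT (F n) by have [[]] := gF n.
split; first exact: bounded_measurable_cvg mF FC Ff.
move=> l c Ll; apply: (same_cvg (F := fun n x => F n x * cos (l x + c)) (C := C)).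
- by move=> n; have [_ +] := gF n; exact.
- by move=> n; apply: measurable_funM => //; case: (bcos c Ll).
- move=> n x; rewrite normrM (le_trans (ler_piMr _ _))//.
  by rewrite ler_norml cos_geN1 cos_le1.
- by move=> x; apply: cvgMl; exact: Ff.
Qed.

Let mult (H : S -> R) :=
  bounded_measurable H /\ forall F, good F -> good (F \* H).

Let mult_cst c : mult (cst c).
Proof.
split; first exact: bounded_measurable_cst.
move=> F gF; rewrite (_ : F \* cst c = fun x => c * F x); first exact: goodZ.
by apply/funext => x /=; rewrite mulrC.
Qed.

Let multD G H : mult G -> mult H -> mult (G \+ H).
Proof.
move=> [bG gG] [bH gH]; split; first exact: bounded_measurableD.
move=> F gF; rewrite (_ : F \* _ = (F \* G) \+ (F \* H)).
  by apply: goodD; [exact: gG|exact: gH].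
by apply/funext => x /=; rewrite mulrDr.
Qed.

Let multM G H : mult G -> mult H -> mult (G \* H).
Proof.
move=> [bG gG] [bH gH]; split; first exact: bounded_measurableM.
move=> F gF; rewrite (_ : F \* _ = (F \* G) \* H).
  by apply: gH; exact: gG.
by apply/funext => x /=; rewrite mulrA.
Qed.

Let multZ c G : mult G -> mult (fun x => c * G x).
Proof. by move=> mG; apply: (@multM (cst c) G) => //; exact: mult_cst. Qed.

Let mult_cvg (F : nat -> S -> R) f (C : R) : (forall n, mult (F n)) ->
  (forall n x, `|F n x| <= C) ->
  (forall x, F n x @[n --> \oo] --> f x) -> mult f.
Proof.
move=> mF FC Ff; split.
  by apply: bounded_measurable_cvg FC Ff => n; case: (mF n) => -[].
move=> G gG; have [[_ [D GD]] _] := gG.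
apply: (good_cvg (F := fun n => G \* F n) (C := D * C)).
- by move=> n; have [_] := mF n; exact.
- by move=> n x; rewrite normrM ler_pM.
- by move=> x; apply: cvgMr; exact: Ff.
Qed.

Let LB l l' : L l -> L l' -> L (fun x => l x - l' x).
Proof.
move=> Ll Ll'; have := LD Ll (LZ (-1) Ll'); congr L.
by apply/funext => x /=; rewrite mulN1r.
Qed.

(* product-to-sum formula *)
Let mult_cos l c : L l -> mult (fun x => cos (l x + c)).
Proof.
move=> Ll; split; first exact: bcos.
move=> F [bF cF]; split; first by apply: bounded_measurableM => //; exact: bcos.
move=> l' c' Ll'; have Lm := LB Ll Ll'; have Lp := LD Ll Ll'.
have bm := bounded_measurableM bF (bcos (c - c') Lm).
have bp := bounded_measurableM bF (bcos (c + c') Lp).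
have := sameZ (2^-1) (bounded_measurableD bm bp) (sameD bm bp (cF _ _ Lm) (cF _ _ Lp)).
congr same; apply/funext => x /=.
have -> : l x - l' x + (c - c') = (l x + c) - (l' x + c') by ring.
have -> : l x + l' x + (c + c') = (l x + c) + (l' x + c') by ring.
by set u := l x + c; set v := l' x + c'; rewrite cosB cosD; field.
Qed.

Let mult_sum n (F : nat -> S -> R) : (forall i, mult (F i)) ->
  mult (fun x => \prod_(i < n) F i x).
Proof.
move=> mF; elim: n => [|n IH].
  rewrite (_ : (fun x => _) = cst 1); first exact: mult_cst.
  by apply/funext => x; rewrite big_ord0.
rewrite (_ : (fun x => _) = (fun x => \prod_(i < n) F i x) \* F n).
  exact: multM.
by apply/funext => x; rewrite big_ord_recr.
Qed.

Let mult_smoothstep n l : mult l -> mult (fun x => iter n smoothstep (l x)).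
Proof.
move=> ml; elim: n => [//|n IH].
have := multD (multZ (3 / 2) IH) (multZ (- 2^-1) (multM IH (multM IH IH))).
congr mult; apply/funext => x /=; rewrite /smoothstep; ring.
Qed.

Let mult_sg_sin l : mult (fun x => sin (l x)) ->
  mult (fun x => Num.sg (sin (l x))).
Proof.
move=> ml; apply: (mult_cvg (fun n => mult_smoothstep n ml) (C := 1)).
- move=> n x; apply: iter_smoothstep_le1.
  by rewrite ler_norml sin_geN1 sin_le1.
- move=> x; apply: iter_smoothstep_cvg.
  by rewrite ler_norml sin_geN1 sin_le1.
Qed.

Let mult_sg l a : L l -> mult (fun x => Num.sg (l x - a)).
Proof.
move=> Ll.
have ml n : mult (fun x => Num.sg (sin ((l x - a) / n.+1%:R))).
  apply: (@mult_sg_sin (fun x => (l x - a) / n.+1%:R)).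
  have := mult_cos (- (a / n.+1%:R) - pi / 2) (LZ n.+1%:R^-1 Ll).
  congr mult; apply/funext => x; rewrite addrA cosBpihalf; congr sin.
  by rewrite mulrBl mulrC.
apply: (mult_cvg ml (C := 1)).
- move=> n x; rewrite normr_sg; by case: eqP; rewrite ?ler01.
- move=> x; apply: sg_sin_div_cvg.
Qed.

Let mult_gt l a : L l -> mult (\1_[set x | a < l x]).
Proof.
move=> Ll; have ms := mult_sg a Ll.
have := multZ 2^-1 (multD ms (multM ms ms)).
congr mult; apply/funext => x /=; rewrite indicE.
rewrite (_ : x \in _ = (a < l x)); last by apply/idP/idP; rewrite inE.
rewrite -subr_gt0; case: sgrP => _ /=; rewrite ?mulr1n ?mulr0n; lra.
Qed.

Let mset : set (set S) := [set A | measurable A /\ mult (\1_A)].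

Let mset_sigma_algebra : sigma_algebra setT mset.
Proof.
split.
- split; first exact: measurable0.
  by have := mult_cst 0; congr mult; apply/funext => x; rewrite indic0.
- move=> A [mA hA]; split; first exact: measurableD.
  have := multD (mult_cst 1) (multZ (-1) hA); congr mult.
  apply/funext => x /=; rewrite !indicE in_setD in_setT /=.
  by case: (x \in A) => /=; rewrite ?mulr1 ?mulr0 ?subrr ?addr0.
- move=> A hA; split.
    by apply: bigcup_measurable => k _; case: (hA k).
  have mn n : mult (fun x => 1 - \prod_(i < n) (1 - \1_(A i) x)).
    have hC i : mult (fun x => 1 - \1_(A i) x).
      have := multD (mult_cst 1) (multZ (-1) (hA i).2); congr mult.
      by apply/funext => x /=; rewrite mulN1r.
    have := multD (mult_cst 1) (multZ (-1) (mult_sum n hC)); congr mult.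
    by apply/funext => x /=; rewrite mulN1r.
  have ind01 i x : (0 : R) <= (1 - \1_(A i) x : R) <= (1 : R).
    by rewrite indicE; case: (_ \in _); rewrite ?subrr ?subr0 ?ler01 ?lexx.
  apply: (mult_cvg mn (C := 1)).
  + move=> n x.
    have h0 : (0 : R) <= \prod_(i < n) (1 - \1_(A i) x).
      by apply: prodr_ge0 => i _; case/andP: (ind01 i x).
    have h1 : \prod_(i < n) (1 - \1_(A i) x) <= (1 : R).
      by apply: prodr_ile1 => i _; exact: ind01.
    by rewrite ger0_norm ?subr_ge0// lerBlDr lerDl.
  + move=> x; rewrite indicE; case: (boolP (x \in _)) => [|xA].
      rewrite inE => -[k _ Ak].
      apply: cvg_near_cst; exists k.+1 => // n /= kn.
      have -> : \prod_(i < n) (1 - \1_(A i) x) = (0 : R).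
        apply/eqP/prodf_eq0; exists (Ordinal kn) => //=.
        by rewrite indicE mem_set//= subrr.
      by rewrite subr0.
    apply: cvg_near_cst; apply: nearW => n.
    rewrite big1 ?subrr// => i _; rewrite indicE memNset ?subr0// => Ax.
    by move/negP: xA; apply; rewrite inE; exists i.
Qed.

(** The sets whose indicator is a multiplier form a sigma-algebra, which contains
    the half-spaces l > a, their indicators being polynomials in the sign of
    l - a; a multiplier integrates to the same value on both sides, as 1 is
    good and cos 0 = 1. *)
Lemma eq_law_of_cos (G : set (set S)) (A : set S) :
  L (cst 0) ->
  (forall B, G B -> exists l a, L l /\ B = [set x | a < l x]) ->
  <<s G >> A -> P1 (X1 @^-1` A) = P2 (X2 @^-1` A).
Proof.
move=> L0 GL sA.
have [mA [_ /(_ _ good1)[_ hA]]] : mset A.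
  apply: sA; split; first exact: mset_sigma_algebra.
  move=> B /GL[l [a [Ll ->]]]; split; last exact: mult_gt.
  rewrite -[X in measurable X]setTI (_ : [set x | _] = l @^-1` `]a, +oo[%classic).
    by apply: mL => //; exact: measurable_itv.
  by apply/seteqP; split => x /=; rewrite in_itv/= andbT.
have := hA _ 0 L0; rewrite /same /Rintegral /=.
under eq_integral do rewrite addr0 cos0 mul1r mulr1.
under [in X in _ = X -> _]eq_integral do rewrite addr0 cos0 mul1r mulr1.
have mA1 : measurable (X1 @^-1` A) by rewrite -[X in measurable X]setTI; exact: mX1.
have mA2 : measurable (X2 @^-1` A) by rewrite -[X in measurable X]setTI; exact: mX2.
rewrite -[fun w => _]/(fun w => (\1_(X1 @^-1` A) w)%:E).
rewrite -[fun w => (\1_A (X2 w))%:E]/(fun w => (\1_(X2 @^-1` A) w)%:E).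
rewrite !integral_indic// !setIT => e.
rewrite -[LHS]fineK ?fin_num_measure// -[RHS]fineK ?fin_num_measure//.
by congr EFin.
Qed.

End uniqueness.

Lemma sigma_algebra_tuple (R : realType) (n : nat) (A : set (n.-tuple R)) :
  measurable A ->
  <<s [set B | exists i a, B = [set x : n.-tuple R | a < tnth x i]] >> A.
Proof.
move=> mA; apply: mA; split; first exact: smallest_sigma_algebra.
move=> B; rewrite -bigcup_seq => -[i _ [Y mY <-]].
rewrite setTI; have {}mY : (@RGenOInfty.G R).-sigma.-measurable Y.
  by rewrite -RGenOInfty.measurableE.
pose C := [set Z : set R | <<s [set B | exists i a,
  B = [set x : n.-tuple R | a < tnth x i]] >> ((fun x => tnth x i) @^-1` Z)].
suff : C Y by [].
have [s0 sC sU] := smallest_sigma_algebra setT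
  [set B | exists i a, B = [set x : n.-tuple R | a < tnth x i]].
apply: mY; split; first split.
- by rewrite /C /= preimage_set0.
- by move=> Z CZ; exact: (sC _ CZ).
- by move=> F CF; rewrite /C /= preimage_bigcup; exact: sU.
- move=> Z [a ->]; apply: sub_sigma_algebra; exists i, a.
  by apply/seteqP; split => x /=; rewrite in_itv/= andbT.
Qed.

(** Cramer and Wold: linear forms are closed under sums and multiples, and the
    half-spaces of the coordinates generate the sigma-algebra of tuples. *)
Lemma fdd_eq_of_cos (R : realType) (I : Type)
    (d1 d2 : measure_display) (T1 : measurableType d1) (T2 : measurableType d2)
    (P1 : probability T1 R) (P2 : probability T2 R)
    (X1 : I -> T1 -> R) (X2 : I -> T2 -> R) :
  (forall t, measurable_fun setT (X1 t)) ->
  (forall t, measurable_fun setT (X2 t)) ->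
  (forall (n : nat) (t : 'I_n -> I) (a : 'I_n -> R) (c : R),
    \int[P1]_w cos (\sum_i a i * X1 (t i) w + c) =
    \int[P2]_w cos (\sum_i a i * X2 (t i) w + c)) ->
  fdd_eq P1 X1 P2 X2.
Proof.
move=> mX1 mX2 h n t A mA.
pose L : set (n.-tuple R -> R) :=
  [set l | exists a : 'I_n -> R, l = fun x => \sum_i a i * tnth x i].
have Y1 : measurable_fun setT (fun w => [tuple X1 (t i) w | i < n]).
  apply/measurable_fun_tnthP => i; rewrite [X in measurable_fun _ X](_ : _ = X1 (t i))//.
  by apply/funext => w /=; rewrite tnth_mktuple.
have Y2 : measurable_fun setT (fun w => [tuple X2 (t i) w | i < n]).
  apply/measurable_fun_tnthP => i; rewrite [X in measurable_fun _ X](_ : _ = X2 (t i))//.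
  by apply/funext => w /=; rewrite tnth_mktuple.
apply: (eq_law_of_cos Y1 Y2 (L := L) _ _ _ _ _ _ (sigma_algebra_tuple mA)).
- move=> _ [a ->]; apply: measurable_sum => i.
  by apply: measurable_funM => //; exact: measurable_tnth.
- move=> _ _ [a ->] [b ->]; exists (fun i => a i + b i); apply/funext => x /=.
  by rewrite -big_split; apply: eq_bigr => i _; rewrite mulrDl.
- move=> c _ [a ->]; exists (fun i => c * a i); apply/funext => x /=.
  by rewrite mulr_sumr; apply: eq_bigr => i _; rewrite mulrA.
- move=> _ c [a ->]; have := h n t a c.
  by under eq_Rintegral do under eq_bigr do rewrite -(tnth_mktuple (fun i => X1 (t i) _));
     under [in X in _ = X -> _]eq_Rintegral do under eq_bigr do
      rewrite -(tnth_mktuple (fun i => X2 (t i) _)).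
- by exists (fun=> 0); apply/funext => x; rewrite big1// => i _; rewrite mul0r.
- move=> B [i [a ->]]; exists (fun x => tnth x i), a; split => //.
  exists (fun j => (j == i)%:R); apply/funext => x.
  rewrite (bigD1 i)//= eqxx mul1r big1 ?addr0// => j /negPf ->.
  by rewrite mul0r.
Qed.

(** * The transform of the normal law *)

Section whole_line.
Context {R : realType}.
Let mu := @lebesgue_measure R.

(** The fundamental theorem of calculus on [-n, n], the boundary terms tending
    to 0. *)
Lemma integral_derivative_eq0 (F f : R -> R) :
  (forall x, is_derive x (1 : R) F (f x)) -> continuous f ->
  mu.-integrable setT (EFin \o f) ->
  F n%:R @[n --> \oo] --> 0 -> F (- n%:R) @[n --> \oo] --> 0 ->
  \int[mu]_x f x = 0.
Proof.
move=> dF cf intf Fy FNy.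
have mf : measurable_fun setT f by exact: continuous_measurable_fun.
have cF : continuous F.
  by move=> x; apply/differentiable_continuous/derivable1_diffP; case: (dF x).
pose fn (n : nat) x := (f \_ (`[- n%:R, n%:R] : set R)) x.
have cvf : \int[mu]_x fn n x @[n --> \oo] --> \int[mu]_x f x.
  have [_ _ h] : [/\ mu.-integrable setT (EFin \o f),
    (\int[mu]_x `|(fn n x)%:E - (f x)%:E|)%E @[n --> \oo] --> 0%E &
    (\int[mu]_x (fn n x)%:E)%E @[n --> \oo] --> (\int[mu]_x (f x)%:E)%E].
    apply: (@dominated_convergence _ _ _ mu setT measurableT
      (fun n x => (fn n x)%:E) (EFin \o f) (fun x => `|f x|%:E)).
    - move=> n; apply/measurable_EFinP; rewrite /fn.
      by apply/measurable_restrict => //; exact: measurable_funS mf.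
    - exact/measurable_EFinP.
    - apply: aeW => x _; apply: cvg_near_cst.
      have [N _ hN] : \forall n \near \oo, `|x| < n%:R by exact: nbhs_infty_gtr.
      exists N => // n /= /hN; rewrite ltr_norml => /andP[h1 h2].
      by rewrite /fn patchE mem_set//= in_itv/= !ltW.
    - by have := integrable_abse intf.
    - apply: aeW => x n _; rewrite lee_fin /fn patchE.
      by case: ifP => // _; rewrite normr0.
  by apply: fine_cvg; rewrite fineK//; exact: integrable_fin_num.
have cv0 : \int[mu]_x fn n x @[n --> \oo] --> (0 : R).
  have h : F n%:R - F (- n%:R) @[n --> \oo] --> (0 : R).
    by rewrite -[0]subr0; exact: cvgB.
  apply: cvg_trans h; apply: near_eq_cvg.
  exists 1%N => // n /= n0; rewrite /Rintegral /fn.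
  have -> : (fun x => ((f \_ (`[- n%:R, n%:R] : set R)) x)%:E) =
      (EFin \o f) \_ (`[- n%:R, n%:R] : set R).
    by rewrite restrict_EFin.
  rewrite -integral_mkcond (@continuous_FTC2 _ f F) //.
  - by rewrite -subr_gt0 opprK addr_gt0// ltr0n.
  - exact: continuous_subspaceT.
  - split.
    + by move=> x _; case: (dF x).
    + by apply: cvg_at_right_filter; exact: cF.
    + by apply: cvg_at_left_filter; exact: cF.
  - by move=> x _; rewrite derive1E; case: (dF x).
by rewrite -(cvg_lim _ cvf)// (cvg_lim _ cv0).
Qed.

End whole_line.

(** One power of x is absorbed by dividing the rate of the exponential by four:
    the remaining factor is exp (- 3 x^2 / (8 v)), and exp y >= 1 + y. *)
Lemma norm_mul_gauss_le (R : realType) (v x : R) : 0 < v ->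
  `|x| * expR (- (x ^+ 2 / (v *+ 2))) <=
  (1 + 8 * v) * expR (- (x ^+ 2 / (v *+ 8))).
Proof.
move=> v0; have vn : v != 0 by rewrite gt_eqF.
have -> : - (x ^+ 2 / (v *+ 2)) =
    - (3 * x ^+ 2 / (8 * v)) + - (x ^+ 2 / (v *+ 8)).
  by rewrite -(mulr_natr v 2) -(mulr_natr v 8); field.
rewrite expRD mulrA ler_wpM2r ?expR_ge0//.
rewrite expRN ler_pdivrMr ?expR_gt0//.
have h := expR_ge1Dx (3 * x ^+ 2 / (8 * v)).
have h8 : 0 < 8 * v by rewrite mulr_gt0.
have h1 : `|x| <= (1 + 8 * v) * (1 + 3 * x ^+ 2 / (8 * v)).
  have -> : (1 + 8 * v) * (1 + 3 * x ^+ 2 / (8 * v)) =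
    1 + 3 * x ^+ 2 / (8 * v) + 8 * v + 3 * x ^+ 2 by field.
  have h2 : 0 <= 3 * x ^+ 2 / (8 * v) 
    by apply: divr_ge0; [rewrite mulr_ge0 ?sqr_ge0|exact: ltW].
  have h3 : 0 <= (`|x| - 1) ^+ 2 by exact: sqr_ge0.
  rewrite sqrrB expr1n mulr1 real_normK ?num_real// in h3.
  have := sqr_ge0 x; lra.
apply: (le_trans h1); apply: ler_wpM2l => //.
by rewrite addr_ge0// ltW.
Qed.

Section normal_charfun.
Context {R : realType} (s : R).
Hypothesis s0 : s != 0.
Let mu := @lebesgue_measure R.
Let v := s ^+ 2.
Let g := normal_pdf 0 s.

Let v_gt0 : 0 < v. Proof. by rewrite exprn_even_gt0. Qed.

Let gE x : g x = normal_peak s * expR (- (x ^+ 2 / (v *+ 2))).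
Proof. by rewrite /g normal_pdfE// /normal_fun subr0 mulNr. Qed.

Let g_ge0 x : 0 <= g x. Proof. exact: normal_pdf_ge0. Qed.

Let mg : measurable_fun setT g. Proof. exact: measurable_normal_pdf. Qed.

Let intg : mu.-integrable setT (EFin \o g).
Proof. exact: integrable_normal_pdf. Qed.

Let cg : continuous g. Proof. exact: continuous_normal_pdf. Qed.

Let derg (x : R) : is_derive x (1 : R) g (- (x / v) * g x).
Proof.
have -> : g = (fun x => normal_peak s * expR (- (x ^+ 2 / (v *+ 2)))).
  by apply/funext => y; rewrite gE.
have -> : (fun x => normal_peak s * expR (- (x ^+ 2 / (v *+ 2)))) =
   normal_peak s \*: (expR \o ((- (v *+ 2)^-1) \*: ((id : R -> R) ^+ 2))).
  apply/funext => y /=; congr (_ * expR _).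
  rewrite /GRing.scale /= -[(id ^+ 2) y]/(y ^+ 2); ring.
apply: is_derive_eq; rewrite /GRing.scale /= -[(id ^+ 2) x]/(x ^+ 2).
have vn : v != 0 by rewrite gt_eqF.
rewrite -[_ *: x ^+ 2]/(_ * x ^+ 2) (_ : - (v *+ 2)^-1 * x ^+ 2 = - (x ^+ 2 / (v *+ 2))); last ring.
by rewrite -(mulr_natr v 2); field.
Qed.

Let C := normal_peak s * (1 + 8 * v) / normal_peak (2 * s).

Let s20 : 2 * s != 0. Proof. by rewrite mulf_neq0. Qed.

Let tail_g x : `|x| * g x <= C * normal_pdf 0 (2 * s) x.
Proof.
rewrite gE normal_pdfE// /normal_fun subr0 mulNr.
have p2 := normal_peak_gt0 s20; have p1 := normal_peak_gt0 s0.
rewrite /C mulrA divfK ?gt_eqF// mulrCA -mulrA.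
apply: ler_wpM2l; first exact: ltW.
by have := norm_mul_gauss_le x v_gt0; rewrite (_ : v *+ 8 = (2 * s) ^+ 2 *+ 2)// exprMn -/v -[v *+ 8]mulr_natr -[_ *+ 2]mulr_natr; ring.
Qed.

Let C_ge0 : 0 <= C.
Proof.
rewrite /C divr_ge0 ?mulr_ge0 ?normal_peak_ge0//.
by rewrite addr_ge0// mulr_ge0// ltW.
Qed.

Let int_xg : mu.-integrable setT (EFin \o (fun x => `|x| * g x)).
Proof.
apply: (@le_integrable _ _ _ mu setT measurableT _
  (fun x => (C * normal_pdf 0 (2 * s) x)%:E)).
- apply/measurable_EFinP/measurable_funM => //.
- move=> x _ /=; rewrite lee_fin ger0_norm; last by rewrite mulr_ge0.
  by rewrite [leRHS]ger0_norm ?tail_g// mulr_ge0// normal_pdf_ge0.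
- under eq_fun do rewrite EFinM.
  by apply: integrableZl => //; exact: integrable_normal_pdf.
Qed.

Let g_lim (u : nat -> R) (h : R -> R) : (forall n, `|u n| = n%:R) ->
  (forall x, `|h x| <= 1) -> h (u n) * g (u n) @[n --> \oo] --> 0.
Proof.
move=> un h1; pose D := C * normal_peak (2 * s).
apply/cvgr0Pnorm_lt => e e0.
have [N _ hN] : \forall n \near \oo, D / e < n%:R by exact: nbhs_infty_gtr.
exists N.+1 => // n /= Nn; have n0 : 0 < n%:R :> R by rewrite ltr0n (leq_trans _ Nn).
have := hN _ (ltnW Nn); rewrite /= ltr_pdivrMr// -ltr_pdivrMl// mulrC; apply: le_lt_trans.
rewrite normrM (@le_trans _ _ (g (u n)))//.
  by rewrite (ger0_norm (g_ge0 _)) ler_piMl.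
rewrite ler_pdivlMr// -un mulrC (le_trans (tail_g _))//.
by apply: ler_wpM2l => //; exact: normal_pdf_ub.
Qed.

Let phi c th := \int[mu]_x (cos (th * x + c) * g x).

Let der_th (c x th : R) : is_derive th (1 : R) (fun t => cos (t * x + c) * g x)
  (- (sin (th * x + c) * x) * g x).
Proof.
have -> : (fun t => cos (t * x + c) * g x) =
    g x \*: (cos \o (x \*: (id : R -> R) + cst c)).
  by apply/funext => t /=; rewrite /GRing.scale /= mulrC -[(_ + _) t]/(x * t + c) (mulrC t).
apply: is_derive_eq; rewrite /GRing.scale /= -[(_ + _) th]/(x * th + c) addr0 mulr1.
by rewrite (mulrC x th); ring.
Qed.

Let der_x (c th x : R) : is_derive x (1 : R) (fun y => sin (th * y + c) * g y)
  (th * (cos (th * x + c) * g x) + - v^-1 * (sin (th * x + c) * x * g x)).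
Proof.
have -> : (fun y => sin (th * y + c) * g y) =
    (sin \o (th \*: (id : R -> R) + cst c)) * g by [].
have D1 : is_derive x (1 : R) (sin \o (th \*: (id : R -> R) + cst c))
    (cos (th * x + c) * th).
  apply: is_derive_eq; rewrite /GRing.scale /= -[(_ + _) x]/(th * x + c).
  by rewrite addr0 mulr1.
apply: (is_derive_eq (is_deriveM D1 (derg x))).
rewrite /GRing.scale /= -[(_ + _) x]/(th * x + c); ring.
Qed.

Let cont_lin th c : continuous (fun x : R => th * x + c).
Proof.
by move=> x; apply: cvgD; [apply: cvgM; [exact: cvg_cst|exact: cvg_id]|exact: cvg_cst].
Qed.

Let int_cos c th : mu.-integrable setT (EFin \o (fun x => cos (th * x + c) * g x)).
Proof.
apply: (@le_integrable _ _ _ mu setT measurableT _ (EFin \o g)) => //.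
- apply/measurable_EFinP/measurable_funM => //; apply: measurable_cos.
  by apply: continuous_measurable_fun; exact: cont_lin.
- move=> x _ /=; rewrite lee_fin normrM ler_piMl// ler_norml.
  by rewrite cos_geN1 cos_le1.
Qed.

Let int_xsin c th :
  mu.-integrable setT (EFin \o (fun x => sin (th * x + c) * x * g x)).
Proof.
apply: (@le_integrable _ _ _ mu setT measurableT _
  (EFin \o (fun x => `|x| * g x))) => //.
- apply/measurable_EFinP/measurable_funM => //; apply: measurable_funM => //.
  apply: measurable_sin.
  by apply: continuous_measurable_fun; exact: cont_lin.
- move=> x _ /=; rewrite lee_fin !normrM normr_id -mulrA ler_piMl ?mulr_ge0// ler_norml.
  by rewrite sin_geN1 sin_le1.
Qed.

Let by_parts c th : th * phi c th = v^-1 * \int[mu]_x (sin (th * x + c) * x * g x).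
Proof.
apply/eqP; rewrite -subr_eq0 -mulNr; apply/eqP.
have i1 : mu.-integrable setT (EFin \o (fun x => th * (cos (th * x + c) * g x))).
  exact: (integrableZl measurableT th (int_cos c th)).
have i2 : mu.-integrable setT (EFin \o (fun x => - v^-1 * (sin (th * x + c) * x * g x))).
  exact: (integrableZl measurableT (- v^-1) (int_xsin c th)).
rewrite /phi -(RintegralZl th measurableT (int_cos c th)).
rewrite -(RintegralZl (- v^-1) measurableT (int_xsin c th)) -RintegralD//.
apply: (integral_derivative_eq0 (F := fun y => sin (th * y + c) * g y)).
- exact: der_x.
- move=> x; apply: cvgD; apply: cvgM; try exact: cvg_cst; apply: cvgM; try exact: cg.
    by apply: continuous_comp; [exact: cont_lin|exact: continuous_cos].
  apply: cvgM; last exact: cvg_id.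
  by apply: continuous_comp; [exact: cont_lin|exact: continuous_sin].
- exact: (integrableD measurableT i1 i2).
- apply: (g_lim (u := fun n => n%:R) (h := fun y => sin (th * y + c))).
    by move=> n; rewrite normr_nat.
  by move=> x; rewrite ler_norml sin_geN1 sin_le1.
- apply: (g_lim (u := fun n => - n%:R) (h := fun y => sin (th * y + c))).
    by move=> n; rewrite normrN normr_nat.
  by move=> x; rewrite ler_norml sin_geN1 sin_le1.
Qed.

Let der_phi (c th : R) : is_derive th (1 : R) (phi c) (- (v * th * phi c th)).
Proof.
have Ia : `]th - 1, th + 1[%classic th by rewrite /= in_itv/=; apply/andP; split; lra.
have d1 x t : partial1of2 (fun t x => cos (t * x + c) * g x) t x =
    - (sin (t * x + c) * x) * g x.
  by rewrite partial1of2E; case: (der_th c x t).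
have hyp1 (t : R) : `]th - 1, th + 1[%classic t -> mu.-integrable setT
  (EFin \o (fun x => cos (t * x + c) * g x)) by move=> _; exact: int_cos.
have hyp2 (t x : R) : `]th - 1, th + 1[%classic t -> setT x ->
    derivable ((fun t x => cos (t * x + c) * g x) ^~ x) t 1.
  by move=> _ _; case: (der_th c x t).
have hyp3 (t x : R) : `]th - 1, th + 1[%classic t -> setT x ->
    `|partial1of2 (fun t x => cos (t * x + c) * g x) t x| <= `|x| * g x.
  move=> _ _; rewrite d1 !normrM normrN normrM (ger0_norm (g_ge0 x)) -mulrA.
  by rewrite ler_piMl ?mulr_ge0// ler_norml sin_geN1 sin_le1.
have xg0 x : 0 <= `|x| * g x by rewrite mulr_ge0.
have dphi := derivable_under_integral measurableT Ia hyp1 hyp2 xg0 int_xg hyp3.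
have ephi := differentiation_under_integral measurableT Ia hyp1 hyp2 xg0 int_xg hyp3.
apply: DeriveDef => //; rewrite -derive1E [LHS]ephi.
under eq_Rintegral do rewrite d1 mulNr -mulN1r.
rewrite (RintegralZl (- 1) measurableT (int_xsin c th)).
rewrite -mulrA by_parts mulrA mulfV ?gt_eqF// mul1r mulN1r.
by congr (- _); apply: eq_Rintegral => x _; rewrite mulrA.
Qed.

(** By an integration by parts, the derivative of the integral in th is
    - s^2 th times the integral, so that its product with exp (th^2 s^2 / 2)
    is constant. *)
Lemma normal_charfun c th :
  \int[mu]_x (cos (th * x + c) * normal_pdf 0 s x) =
  cos c * expR (- (th ^+ 2 * s ^+ 2 / 2)).
Proof.
rewrite -/(phi c th).
pose E t := expR (t ^+ 2 * v / 2).
have dE (t : R) : is_derive t (1 : R) E (v * t * E t).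
  have -> : E = expR \o ((v / 2) \*: ((id : R -> R) ^+ 2)).
    by apply/funext => y; rewrite /E /= /GRing.scale /= -[(id ^+ 2) y]/(y ^+ 2); congr expR; ring.
  apply: is_derive_eq; rewrite /GRing.scale /= -[(id ^+ 2) t]/(t ^+ 2) /E.
  rewrite -[_ *: t ^+ 2]/(_ * t ^+ 2) (_ : v / 2 * t ^+ 2 = t ^+ 2 * v / 2); last ring.
  by field.
have h : (phi c * E) th = (phi c * E) 0.
  apply: is_derive_0_is_cst => t.
  apply: (is_derive_eq (is_deriveM (der_phi c t) (dE t))).
  rewrite /GRing.scale /=; ring.
have phi0 : phi c 0 = cos c.
  rewrite /phi; under eq_Rintegral do rewrite mul0r add0r.
  by rewrite RintegralZl// /Rintegral integral_normal_pdf mulr1.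
have : phi c th * E th = cos c.
  by rewrite -[LHS]/((phi c * E) th) h -[LHS]/(phi c 0 * E 0) /E expr0n/= !mul0r expR0 mulr1.
by move=> <-; rewrite /E expRN mulfK ?gt_eqF ?expR_gt0.
Qed.

(** The normal law has normal_pdf as Radon-Nikodym derivative. *)
Lemma integral_normal_prob (f : R -> R) : measurable_fun setT f ->
  (exists C, forall x, `|f x| <= C) ->
  \int[normal_prob 0 s]_x f x = \int[mu]_x (f x * normal_pdf 0 s x).
Proof.
move=> mf bf; congr fine.
have mfE : measurable_fun setT (EFin \o f) by exact/measurable_EFinP.
have dom := @normal_prob_dominates R 0 s.
have intf : (normal_prob 0 s).-integrable setT (EFin \o f).
  by apply: integrable_bounded_measurable.
rewrite -(Radon_Nikodym_change_of_variables dom)//=.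
under [RHS]eq_integral do rewrite EFinM.
apply: ae_eq_integral => //.
- apply: emeasurable_funM; first exact: mfE.
  by apply: (measurable_int mu); exact: Radon_Nikodym_integrable.
- by apply: emeasurable_funM => //; exact/measurable_EFinP.
- apply: ae_eqe_mul2l => /=.
  rewrite Radon_NikodymE//=.
  case: cid => /= h [h1 h2 h3].
  apply: integral_ae_eq => //=.
  + exact/measurable_EFinP.
  + by move=> E _ mE; rewrite -h3.
Qed.

End normal_charfun.

Section centered_normal.
Context {R : realType} {d : measure_display} {T : measurableType d}
  (P : probability T R).

(** The degenerate case s = 0 is a Dirac mass, for which the formula is
    immediate. *)
Lemma centered_normal_charfun (Y : T -> R) : measurable_fun setT Y ->
  centered_normal P Y -> exists s : R, forall c th,
  \int[P]_w cos (th * Y w + c) = cos c * expR (- (th ^+ 2 * s ^+ 2 / 2)).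
Proof.
move=> mY [s hs]; exists s => c th.
pose Y' : {mfun T >-> measurableTypeR R} := HB.pack (Y : T -> measurableTypeR R) (isMeasurableFun.Build _ _ T (measurableTypeR R) Y mY).
have mcos : measurable_fun setT (fun y : R => cos (th * y + c)).
  apply: measurable_cos; apply: continuous_measurable_fun => x.
  by apply: cvgD; [apply: cvgM; [exact: cvg_cst|exact: cvg_id]|exact: cvg_cst].
have bcos : bounded_measurable (fun y : R => cos (th * y + c)).
  by split => //; exists 1 => x; rewrite ler_norml cos_geN1 cos_le1.
have -> : \int[P]_w cos (th * Y w + c) =
    \int[distribution P Y']_y cos (th * y + c).
  rewrite /Rintegral integral_distribution//; first exact/measurable_EFinP.
  apply: integrable_bounded_measurable.
  by have [? ?] := bounded_measurable_comp mY bcos.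
have [s0|s0] := eqVneq s 0.
  rewrite s0 expr0n /= mulr0 mul0r oppr0 expR0 mulr1.
  have -> : \int[distribution P Y']_y cos (th * y + c) =
      \int[\d_(0 : measurableTypeR R)]_y cos (th * y + c).
    congr fine; apply: eq_measure_integral => A mA _.
    by have := hs A mA; rewrite s0 eqxx.
  rewrite /Rintegral integral_dirac//; last exact/measurable_EFinP.
  by rewrite diracT mul1e /= mulr0 add0r.
rewrite -normal_charfun// -integral_normal_prob//; last by case: bcos.
rewrite /Rintegral; congr fine.
apply: (@eq_measure_integral _ (measurableTypeR R) R setT (normal_prob 0 s) (distribution P Y')) => A mA _.
by have := hs A mA; rewrite (negPf s0).
Qed.

End centered_normal.

(** * Sums of independent variables *)

Lemma bounded_measurable_prod (R : realType) (d : measure_display)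
    (T : measurableType d) (I : Type) (r : seq I) (p : pred I)
    (F : I -> T -> R) : (forall i, bounded_measurable (F i)) ->
  bounded_measurable (fun w => \prod_(i <- r | p i) F i w).
Proof.
move=> bF; elim: r => [|i r IH].
  rewrite (_ : (fun _ => _) = cst 1); first exact: bounded_measurable_cst.
  by apply/funext => w; rewrite big_nil.
have [pi|npi] := boolP (p i).
  rewrite (_ : (fun _ => _) = F i \* (fun w => \prod_(i <- r | p i) F i w)).
    exact: bounded_measurableM.
  by apply/funext => w; rewrite big_cons pi.
rewrite (_ : (fun _ => _) = (fun w => \prod_(i <- r | p i) F i w))//.
by apply/funext => w; rewrite big_cons (negPf npi).
Qed.

Section independence.
Context {R : realType} {d : measure_display} {T : measurableType d}
  (P : probability T R).
Implicit Types (Y Z : T -> R).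

Let int_bm Z : bounded_measurable Z -> P.-integrable setT (EFin \o Z).
Proof. exact: integrable_bounded_measurable. Qed.

Lemma Rintegral_indic (A : set T) : measurable A ->
  \int[P]_w \1_A w = fine (P A).
Proof. by move=> mA; rewrite /Rintegral integral_indic// setIT. Qed.

Section factorization.
Variables (Y Z : T -> R).
Hypothesis mY : measurable_fun setT Y.
Hypothesis bZ : bounded_measurable Z.
Hypothesis YZ : forall B : set R, measurable B ->
  \int[P]_w (\1_(Y @^-1` B) w * Z w) = fine (P (Y @^-1` B)) * \int[P]_w Z w.

Let factors (f : R -> R) := \int[P]_w (f (Y w) * Z w) =
  \int[P]_w f (Y w) * \int[P]_w Z w.

Let bfY (f : R -> R) : bounded_measurable f -> bounded_measurable (f \o Y).
Proof. exact: bounded_measurable_comp. Qed.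

Let factorsZD a (f g : R -> R) : bounded_measurable f -> bounded_measurable g ->
  factors f -> factors g -> factors (fun x => a * f x + g x).
Proof.
move=> bf bg ff fg; rewrite /factors.
have ifZ := int_bm (bounded_measurableM (bfY bf) bZ).
have igZ := int_bm (bounded_measurableM (bfY bg) bZ).
have iaf := int_bm (bounded_measurableZ a (bfY bf)).
under eq_Rintegral do rewrite mulrDl -mulrA.
rewrite [LHS]RintegralD//; last exact: (integrableZl measurableT a ifZ).
rewrite RintegralZl// ff fg.
rewrite [X in _ = X * _]RintegralD//; last exact: int_bm (bfY bg).
by rewrite RintegralZl ?mulrDl ?mulrA//; exact: int_bm (bfY bf).
Qed.

Let factors_indic (B : set R) : measurable B -> factors (\1_B).
Proof.
move=> mB; rewrite /factors.
have mYB : measurable (Y @^-1` B) by rewrite -[X in measurable X]setTI; exact: mY.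
by rewrite -[X in _ = X * _]/(\int[P]_w \1_(Y @^-1` B) w) Rintegral_indic// -YZ.
Qed.

Let factors_cvg (F : nat -> R -> R) (f : R -> R) (C : R) : (forall n, factors (F n)) ->
  (forall n, measurable_fun setT (F n)) -> (forall n x, `|F n x| <= C) ->
  measurable_fun setT f -> (forall x, F n x @[n --> \oo] --> f x) -> factors f.
Proof.
move=> fF mF FC mf Ff; have [mZ [D ZD]] := bZ.
have c1 : \int[P]_w F n (Y w) @[n --> \oo] --> \int[P]_w f (Y w).
  apply: (@Rintegral_bounded_cvg _ _ _ P (fun n w => F n (Y w)) _ C) => //.
  - by move=> n; exact: measurableT_comp.
  - exact: measurableT_comp.
  - by apply: aeW => w; exact: Ff.
have c2 : \int[P]_w (F n (Y w) * Z w) @[n --> \oo] --> \int[P]_w (f (Y w) * Z w).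
  apply: (@Rintegral_bounded_cvg _ _ _ P (fun n w => F n (Y w) * Z w) _ (C * D)) => //.
  - by move=> n; apply: measurable_funM => //; exact: measurableT_comp.
  - by move=> n w; rewrite normrM ler_pM.
  - by apply: measurable_funM => //; exact: measurableT_comp.
  - by apply: aeW => w; apply: cvgMl; exact: Ff.
have c3 : \int[P]_w F n (Y w) * \int[P]_w Z w @[n --> \oo] -->
    \int[P]_w f (Y w) * \int[P]_w Z w by apply: cvgMl.
rewrite /factors -(cvg_lim _ c2)// -(cvg_lim _ c3)//.
by congr (limn _); apply/funext => n; exact: fF.
Qed.

Import HBNNSimple.

Let factors_nnsfun (h : {nnsfun R >-> R}) : factors h.
Proof.
have -> : (h : R -> R) = fun x => \sum_(y <- finmap.enum_fset (fset_set (range h)))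
    y * \1_(h @^-1` [set y]) x by apply/funext => x; exact: nnsfun_sum.
elim: (finmap.enum_fset _) => [|y r IH].
  rewrite /factors; under eq_Rintegral do rewrite big_nil mul0r.
  under [in RHS]eq_Rintegral do rewrite big_nil.
  by rewrite /Rintegral integral0 mul0r.
have mh z : measurable (h @^-1` [set z]) by exact: measurable_funPTI.
rewrite (_ : (fun x => _) = (fun x => y * \1_(h @^-1` [set y]) x +
    \sum_(z <- r) z * \1_(h @^-1` [set z]) x)).
  apply: factorsZD => //.
  - exact: bounded_measurable_indic.
  - elim: r {IH} => [|z r IH].
      by under eq_fun do rewrite big_nil; exact: bounded_measurable_cst.
    under eq_fun do rewrite big_cons; apply: bounded_measurableD => //.
    by apply: bounded_measurableZ; exact: bounded_measurable_indic.
  - exact: factors_indic.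
by apply/funext => x; rewrite big_cons.
Qed.

(** From indicators to simple functions by linearity, then to nonnegative
    functions by monotone approximation, then to f by adding a bound. *)
Lemma factorization (f : R -> R) : bounded_measurable f ->
  \int[P]_w (f (Y w) * Z w) = \int[P]_w f (Y w) * \int[P]_w Z w.
Proof.
move=> [mf [C fC]].
have g0 x : 0 <= f x + C by have := fC x; rewrite ler_norml => /andP[h _]; lra.
have mg : measurable_fun setT (fun x => f x + C) by exact: measurable_funD.
have gC x : f x + C <= C + C by have := fC x; rewrite ler_norml => /andP[_ h]; lra.
have [F [Fg cF]] := nnsfun_approximation mg g0.
have fg : factors (fun x => f x + C).
  apply: (factors_cvg (F := fun n => F n) (C := C + C)) => // n x.
  by rewrite ger0_norm// (le_trans (Fg n x)).
have := @factorsZD (- C) (\1_setT) (fun x => f x + C)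
  (bounded_measurable_indic measurableT) _ (factors_indic measurableT) fg.
have -> : (fun x => - C * \1_setT x + (f x + C)) = f.
  by apply/funext => x; rewrite indicT mulr1 addrCA addNr addr0.
by apply; split => //; exists (C + C) => x; rewrite ger0_norm.
Qed.

End factorization.

Section sum_charfun.
Variables (n : nat) (Y : 'I_n -> T -> R).
Hypothesis mY : forall i, measurable_fun setT (Y i).
Hypothesis indepY : mutually_independent P Y.
Hypothesis sinY : forall i, \int[P]_w sin (Y i w) = 0.

(* The variables outside r are carried along as indicators, so that the product
   rule for events is turned into one for cosines one variable at a time. *)
Let ind (r : seq 'I_n) (B : 'I_n -> set R) w : R :=
  \prod_(i | i \notin r) \1_(Y i @^-1` B i) w.

Let mYB i (B : set R) : measurable B -> measurable (Y i @^-1` B).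
Proof. by move=> mB; rewrite -[X in measurable X]setTI; exact: mY. Qed.

Let bprod (p : pred 'I_n) (B : 'I_n -> set R) : (forall i, measurable (B i)) ->
  bounded_measurable (fun w => \prod_(i | p i) (\1_(Y i @^-1` B i) w : R)).
Proof.
move=> mB; apply: bounded_measurable_prod => i.
by apply: bounded_measurable_indic; exact: mYB.
Qed.

Let partial (r : seq 'I_n) : uniq r -> forall B c, (forall i, measurable (B i)) ->
  \int[P]_w (cos (\sum_(i <- r) Y i w + c) * ind r B w) =
    cos c * (\prod_(i <- r) (\int[P]_w cos (Y i w)) *
    \prod_(i | i \notin r) fine (P (Y i @^-1` B i))).
Proof.
elim: r => [_ B c mB|j r IH /= /andP[jr ur] B c mB].
  have -> : ind [::] B = \1_(\bigcap_i (Y i @^-1` B i)).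
    apply/funext => w; rewrite /ind indicE; case: (boolP (w \in _)) => [|wB].
      by rewrite inE => h; rewrite big1// => i _; rewrite indicE mem_set//; exact: h.
    apply/eqP/prodf_eq0.
    have /existsNP[i hi] : ~ forall i, (Y i @^-1` B i) w.
      by move=> h; move/negP: wB; apply; rewrite inE => i _; exact: h.
    by exists i => //; rewrite indicE memNset.
  have mI : measurable (\bigcap_i (Y i @^-1` B i)).
    by apply: fin_bigcap_measurable => // i _; exact: mYB.
  under eq_Rintegral do rewrite big_nil add0r.
  rewrite RintegralZl//; last first.
    by apply: int_bm; exact: bounded_measurable_indic.
  rewrite Rintegral_indic// big_nil mul1r indepY//.
  rewrite (eq_bigr (fun i => (fine (P (Y i @^-1` B i)))%:E)); last first.
    by move=> i _; rewrite fineK// fin_num_measure//; exact: mYB.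
  by rewrite prodEFin.
pose upd (C : set R) i := if i == j then C else B i.
have mupd C i : measurable C -> measurable (upd C i).
  by move=> mC; rewrite /upd; case: ifP.
pose Z c' w := cos (\sum_(i <- r) Y i w + c') * ind (j :: r) B w.
have bZ c' : bounded_measurable (Z c').
  apply: bounded_measurableM; last exact: bprod.
  by apply: bounded_measurable_cos; apply: measurable_funD => //; exact: measurable_sum.
pose E := \prod_(i <- r) (\int[P]_w cos (Y i w)) *
  \prod_(i | i \notin j :: r) fine (P (Y i @^-1` B i)).
have indD C w : ind r (upd C) w = \1_(Y j @^-1` C) w * ind (j :: r) B w.
  rewrite /ind (bigD1 j)//= /upd eqxx; congr (_ * _).
  apply: eq_big => i; first by rewrite in_cons negb_or andbC.
  by case/andP => _ /negPf ->.
have PD C : \prod_(i | i \notin r) fine (P (Y i @^-1` upd C i)) =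
    fine (P (Y j @^-1` C)) * \prod_(i | i \notin j :: r) fine (P (Y i @^-1` B i)).
  rewrite (bigD1 j)//= /upd eqxx; congr (_ * _).
  apply: eq_big => i; first by rewrite in_cons negb_or andbC.
  by case/andP => _ /negPf ->.
have intC C c' : measurable C -> \int[P]_w (\1_(Y j @^-1` C) w * Z c' w) =
    fine (P (Y j @^-1` C)) * (cos c' * E).
  move=> mC; have h := IH ur _ c' (fun i => mupd C i mC).
  transitivity (\int[P]_w (cos (\sum_(i <- r) Y i w + c') * ind r (upd C) w)).
    by apply: eq_Rintegral => w _; rewrite indD /Z mulrCA.
  by rewrite h PD /E; ring.
have intZ c' : \int[P]_w Z c' w = cos c' * E.
  have := intC _ c' (@measurableT _ R).
  have PT : fine (P (Y j @^-1` setT)) = 1 by rewrite preimage_setT probability_setT.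
  rewrite PT mul1r => <-; apply: eq_Rintegral => w _.
  by rewrite indicE preimage_setT in_setT mul1r.
have fac c' (f : R -> R) : bounded_measurable f ->
    \int[P]_w (f (Y j w) * Z c' w) = \int[P]_w f (Y j w) * (cos c' * E).
  move=> bf; rewrite -intZ; apply: (factorization (mY j) (bZ c')) => // C mC.
  by rewrite intC// intZ.
have bcos : bounded_measurable (@cos R).
  by apply: (@bounded_measurable_cos _ _ _ id); exact: measurable_id.
have bsin : bounded_measurable (@sin R).
  by apply: (@bounded_measurable_sin _ _ _ id); exact: measurable_id.
have bf (f : R -> R) c' : bounded_measurable f ->
    P.-integrable setT (EFin \o (fun w => f (Y j w) * Z c' w)).
  move=> bf; apply: int_bm; apply: bounded_measurableM => //.
  exact: (bounded_measurable_comp (mY j) bf).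
(* the shifted phase turns the sine of the addition formula into a cosine *)
have -> : \int[P]_w (cos (\sum_(i <- j :: r) Y i w + c) * ind (j :: r) B w) =
    \int[P]_w (cos (Y j w) * Z c w - sin (Y j w) * Z (c - pi / 2) w).
  apply: eq_Rintegral => w _; rewrite big_cons -addrA cosD /Z addrA cosBpihalf.
  by ring.
rewrite RintegralB//; [|exact: bf..].
by rewrite !fac// sinY mul0r subr0 big_cons -/E /E; ring.
Qed.

(** The sines of the variables integrate to 0, so that only the products of
    cosines survive in the addition formula. *)
Lemma sum_charfun c :
  \int[P]_w cos (\sum_i Y i w + c) = cos c * \prod_i \int[P]_w cos (Y i w).
Proof.
have := partial (index_enum_uniq 'I_n) c (fun=> @measurableT _ R).
rewrite (@big_pred0 _ _ _ _ _ (fun i => i \notin index_enum 'I_n)) => [|i]; last first.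
  by rewrite mem_index_enum.
rewrite mulr1 => <-; apply: eq_Rintegral => w _.
by rewrite /ind big_pred0 ?mulr1// => i; rewrite mem_index_enum.
Qed.

End sum_charfun.
End independence.

(** * Integrals of simple functions *)

Lemma ae_forall_fin (R : realType) (d : measure_display) (T : measurableType d)
    (P : probability T R) (I : finType) (Q : I -> T -> Prop) :
  (forall i, {ae P, forall w, Q i w}) -> {ae P, forall w, forall i, Q i w}.
Proof.
move=> h; suff : {ae P, forall w, forall i, i \in enum I -> Q i w}.
  by apply: filterS => w hw i; apply: hw; rewrite mem_enum.
elim: (enum I) => [|j r IH]; first by apply: aeW.
apply: filterS2 IH (h j) => w hr hj i; rewrite in_cons => /orP[/eqP->//|].
exact: hr.
Qed.

Lemma ae_eq_Rintegral (R : realType) (d : measure_display) (T : measurableType d)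
    (P : probability T R) (f g : T -> R) :
  measurable_fun setT f -> measurable_fun setT g ->
  {ae P, forall w, f w = g w} -> \int[P]_w f w = \int[P]_w g w.
Proof.
move=> mf mg fg; congr fine; apply: ae_eq_integral => //.
- exact/measurable_EFinP.
- exact/measurable_EFinP.
- by apply: filterS fg => w /= -> _.
Qed.

Section gaussian_functional.
Context {R : realType} {V : nzRingType}.

(** R and R[i], with iota the inclusion of R, are the two cases of interest; b is
    then the scalar product of the plane, and b v v the squared modulus. *)
Record inner_product (iota : R -> V) (b : V -> V -> R) : Prop := {
  ip_sym : forall v w, b v w = b w v ;
  ip_add : forall u v w, b (u + v) w = b u w + b v w ;
  ip_scale : forall a v w, b (iota a * v) w = a * b v w ;
  ip_ge0 : forall v, 0 <= b v v ;
  iotaN1 : forall v, iota (-1) * v = - v ;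
  iotaD : forall a c v, iota (a + c) * v = iota a * v + iota c * v }.

Context {d : measure_display} {T : measurableType d} (P : probability T R)
  {d' : measure_display} {S : measurableType d'}
  (mu : {measure set S -> \bar R}) (iota : R -> V) (b : V -> V -> R).

Let q v := b v v.

(** What is left of a random measure M with values in V once the real random
    variables N v A = v M(A) (or the real part of it) are singled out. *)
Record gaussian_functional (N : V -> set S -> T -> R) : Prop := {
  gf_measurable : forall v A, has_finite_measure mu A ->
    measurable_fun setT (N v A) ;
  gf_cos : forall v A, has_finite_measure mu A ->
    \int[P]_w cos (N v A w) = expR (- (q v * fine (mu A))) ;
  gf_sin : forall v A, has_finite_measure mu A -> \int[P]_w sin (N v A w) = 0 ;
  gf_independent : forall (n : nat) (v : 'I_n -> V) (A : 'I_n -> set S),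
    (forall i, has_finite_measure mu (A i)) -> trivIset setT A ->
    mutually_independent P (fun i => N (v i) (A i)) ;
  gf_sigma_additive : forall v (A : nat -> set S),
    (forall i, measurable (A i)) -> trivIset setT A ->
    (mu (\bigcup_i A i) < +oo)%E ->
    {ae P, forall w, (fun n => \sum_(i < n) N v (A i) w) @ \oo -->
                     N v (\bigcup_i A i) w} ;
  gf_add : forall u v A w, N (u + v) A w = N u A w + N v A w ;
  gf_scale : forall a v A w, N (iota a * v) A w = a * N v A w }.

Definition real_integral (N : V -> set S -> T -> R) (s : seq (V * set S)) w : R :=
  \sum_(a <- s) N a.1 a.2 w.

Variable N : V -> set S -> T -> R.
Hypothesis ipb : inner_product iota b.
Hypothesis gfN : gaussian_functional N.

Lemma ip0l v : b 0 v = 0.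
Proof. by have := ip_add ipb 0 0 v; rewrite addr0 => /esym/eqP; rewrite -subr_eq0 addrK => /eqP. Qed.

Lemma gf0l A w : N 0 A w = 0.
Proof. by have := gf_add gfN 0 0 A w; rewrite addr0 => /esym/eqP; rewrite -subr_eq0 addrK => /eqP. Qed.

Lemma has_finite_measure0 : has_finite_measure mu set0.
Proof. by split => //; rewrite measure0 ltry. Qed.

(** Sigma-additivity for a sequence of empty sets makes the multiples of the
    value converge, so that the value vanishes. *)
Lemma gf_set0 v : {ae P, forall w, N v set0 w = 0}.
Proof.
have := @gf_sigma_additive _ gfN v (fun=> set0) (fun=> measurable0).
rewrite bigcup0// measure0 ltry => /(_ (@trivIset_set0 _ _ _) isT).
apply: filterS => w; under eq_fun do rewrite sumr_const card_ord.
move=> cv; have cv1 : N v set0 w *+ n.+1 @[n --> \oo] --> N v set0 w.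
  by have := cv; rewrite -(cvg_shiftn 1) /=; under eq_fun do rewrite addn1.
have : N v set0 w *+ n.+1 - N v set0 w *+ n @[n --> \oo] -->
    N v set0 w - N v set0 w by exact: cvgB.
rewrite subrr; under eq_fun do rewrite mulrS addrK.
by move=> h; rewrite -(cvg_lim _ h)// lim_cst.
Qed.

Lemma gf_additive n v (A : 'I_n -> set S) :
  (forall i, has_finite_measure mu (A i)) -> trivIset setT A ->
  has_finite_measure mu (\bigcup_i A i) ->
  {ae P, forall w, N v (\bigcup_i A i) w = \sum_i N v (A i) w}.
Proof.
move=> fA tA [mU fU].
pose F k := oapp A set0 (insub k).
have FE (i : 'I_n) : F i = A i by rewrite /F valK.
have F0 k : (n <= k)%N -> F k = set0 by move=> nk; rewrite /F insubN// -leqNgt.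
have UE : \bigcup_k F k = \bigcup_i A i.
  apply/seteqP; split => x /= [k _ Fx].
    have [kn|nk] := ltnP k n; last by move: Fx; rewrite F0.
    by exists (Ordinal kn) => //; rewrite -FE.
  by exists k => //; rewrite FE.
have mF k : measurable (F k).
  by rewrite /F; case: insubP => /= [i _ _|_]; [case: (fA i)|exact: measurable0].
have tF : trivIset setT F.
  apply/trivIsetP => i j _ _ ij.
  have [ni|iN] := leqP n i; first by rewrite F0// set0I.
  have [nj|jN] := leqP n j; first by rewrite [F j]F0// setI0.
  have -> : F i = A (Ordinal iN) by exact: (FE (Ordinal iN)).
  have -> : F j = A (Ordinal jN) by exact: (FE (Ordinal jN)).
  by move/trivIsetP: tA; apply.
have h := @gf_sigma_additive _ gfN v F mF tF; rewrite UE in h.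
apply: filterS2 (h fU) (gf_set0 v) => w cv N0.
rewrite -(cvg_lim _ cv)//; apply: lim_near_cst => //.
exists n => // m /= nm.
rewrite -(big_mkord xpredT (fun k => N v (F k) w)) (big_cat_nat (leq0n n) nm)//=.
rewrite [X in _ + X = _]big_nat_cond [X in _ + X = _]big1 ?addr0.
  by rewrite big_mkord; apply: eq_bigr => i _; rewrite FE.
by move=> k /andP[/andP[nk _] _]; rewrite F0.
Qed.

Section simple.
Variable s : seq (V * set S).
Hypothesis simple_s : simple_integrand mu s.

Let n := size s.
Let c i := (nth (0, set0) s i).1.
Let A i := (nth (0, set0) s i).2.

Let fA (i : 'I_n) : has_finite_measure mu (A i).
Proof. by apply: simple_s; exact: mem_nth. Qed.

(* The atoms of the algebra generated by the sets in s are the fibers of the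
   map sending a point to its membership pattern. *)
Let pattern x : {ffun 'I_n -> bool} := [ffun i => `[< A (i : 'I_n) x >]].
Let m := #|{ffun 'I_n -> bool}|.
Let J (k : 'I_m) : {ffun 'I_n -> bool} := enum_val k.
Let D k : set S := if J k == [ffun=> false] then set0
  else [set x | pattern x = J k].
Let coef k : V := \sum_(i < n) (if J k i then c i else 0).

Let DE k x : D k x -> pattern x = J k.
Proof. by rewrite /D; case: ifP. Qed.

Let fD k : has_finite_measure mu (D k).
Proof.
rewrite /D; case: ifPn => [_|J0]; first exact: has_finite_measure0.
have mD : measurable [set x | pattern x = J k].
  rewrite (_ : [set _ | _] =
      \bigcap_(i in [set: 'I_n]) (if J k i then A i else ~` A i)).
    apply: fin_bigcap_measurable => // i _.
    by case: ifP => _; [|apply: measurableC]; case: (fA i).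
  apply/seteqP; split => x /=.
    move=> <- i _; rewrite /pattern ffunE.
    by case: ifPn => /asboolP.
  move=> h; apply/ffunP => i; have := h i I; rewrite /pattern ffunE.
  by case: ifP => _ Ax; [exact/asboolP|apply/asboolP].
split => //.
have [[i Ji]|h] := pselect (exists i, J k i); last first.
  case/eqP: J0; apply/ffunP => i; rewrite ffunE; apply/negbTE/negP => Ji.
  by apply: h; exists i.
have [mA lA] := fA i.
apply: le_lt_trans lA; apply: le_measure; rewrite ?inE//.
move=> x /= px; apply/asboolP; move: Ji; rewrite -px /pattern ffunE; exact.
Qed.

Let tD : trivIset setT D.
Proof.
apply/trivIsetP => i j _ _ ij; apply/seteqP; split => // x [/DE xi /DE xj].
by move/eqP: ij; apply; apply: enum_val_inj; rewrite -/(J i) -xi xj.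
Qed.

Let A_union (i : 'I_n) : A i = \bigcup_k (if J k i then D k else set0).
Proof.
apply/seteqP; split => [x Ax|x [k _]].
  exists (enum_rank (pattern x)) => //=.
  have Jx : J (enum_rank (pattern x)) = pattern x by rewrite /J enum_rankK.
  have pi : pattern x i by rewrite /pattern ffunE; exact/asboolP.
  rewrite Jx pi /D Jx; case: eqP => // /ffunP/(_ i).
  by rewrite pi ffunE.
case: ifP => // Ji /DE e; apply/asboolP.
by move: Ji; rewrite -e /pattern ffunE.
Qed.

Let simple_fctE x : simple_fct s x =
  if pattern x == [ffun=> false] then 0 else coef (enum_rank (pattern x)).
Proof.
rewrite /simple_fct (big_nth (0, set0)) big_mkord.
rewrite (eq_bigr (fun i : 'I_n => if pattern x i then c i else 0)); last first.
  move=> i _; rewrite /pattern ffunE indicE; case: asboolP => Ax.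
    by rewrite mem_set// mulr1.
  by rewrite memNset// mulr0.
case: eqP => [->|_]; first by rewrite big1// => i _; rewrite ffunE.
by rewrite /coef /J enum_rankK.
Qed.

Let q_simple x : (q (simple_fct s x))%:E =
  (\sum_(k < m) (q (coef k))%:E * (\1_(D k) x)%:E)%E.
Proof.
rewrite (bigD1 (enum_rank (pattern x)))//= big1 => [|k kx]; last first.
  rewrite indicE memNset ?mule0// => /DE e.
  by move/eqP: kx; apply; rewrite e /J enum_valK.
rewrite adde0 simple_fctE indicE /D /J enum_rankK.
case: eqP => _; first by rewrite in_set0 /q ip0l mule0.
by rewrite mem_set//= mule1.
Qed.

Let int_q : (\int[mu]_x (q (simple_fct s x))%:E =
  (\sum_(k < m) q (coef k) * fine (mu (D k)))%:E)%E.
Proof.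
under eq_integral do rewrite q_simple.
rewrite ge0_integral_sum//=; first last.
- by move=> k x _; rewrite mule_ge0// lee_fin ?(ip_ge0 ipb)// indicE.
- move=> k; apply: measurable_funeM.
  by apply/measurable_EFinP; apply: measurable_indic; case: (fD k).
rewrite -sumEFin; apply: eq_bigr => k _.
have [mDk lDk] := fD k.
rewrite ge0_integralZl_EFin//=; last exact: (ip_ge0 ipb).
- by rewrite integral_indic// setIT EFinM fineK// ge0_fin_numE.
- by apply/measurable_EFinP; apply: measurable_indic.
Qed.

Let mN k : measurable_fun setT (N (coef k) (D k)).
Proof. exact: (gf_measurable gfN (coef k) (fD k)). Qed.

Lemma measurable_real_integral : measurable_fun setT (real_integral N s).
Proof.
rewrite (_ : real_integral N s = fun w => \sum_(i < n) N (c i) (A i) w).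
  by apply: measurable_sum => i; apply: (gf_measurable gfN).
by apply/funext => w; rewrite /real_integral (big_nth (0, set0)) big_mkord.
Qed.

Let real_integralE :
  {ae P, forall w, real_integral N s w = \sum_(k < m) N (coef k) (D k) w}.
Proof.
have h (i : 'I_n) : {ae P, forall w, N (c i) (A i) w =
    \sum_(k < m) N (c i) (if J k i then D k else set0) w}.
  have fJ k : has_finite_measure mu (if J k i then D k else set0).
    by case: ifP => _; [exact: fD|exact: has_finite_measure0].
  have tJ : trivIset setT (fun k => if J k i then D k else set0).
    apply/trivIsetP => k l _ _ kl; move/trivIsetP: tD => /(_ k l I I kl) Dkl.
    by case: ifP => _; case: ifP => _; rewrite ?set0I ?setI0.
  have fU : has_finite_measure mu (\bigcup_k (if J k i then D k else set0)).
    by rewrite -A_union.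
  by have := gf_additive (c i) fJ tJ fU; rewrite -A_union.
have h0 : {ae P, forall w, forall i : 'I_n, N (c i) set0 w = 0}.
  by apply: ae_forall_fin => i; exact: gf_set0.
apply: filterS2 (ae_forall_fin h) h0 => w hw h0w.
rewrite /real_integral (big_nth (0, set0)) big_mkord.
rewrite (eq_bigr (fun i : 'I_n => N (c i) (A i) w))//.
under eq_bigr do rewrite hw.
rewrite exchange_big /=; apply: eq_bigr => k _.
rewrite /coef (big_morph (fun v => N v (D k) w) (fun u v => gf_add gfN u v (D k) w) (gf0l (D k) w)).
by apply: eq_bigr => i _; case: ifP => _; rewrite ?h0w ?gf0l.
Qed.

(** The integral is almost surely the sum of the values on the atoms, which are
    independent; on an atom the integrand is constant. *)
Lemma simple_charfun :
  (forall c0, \int[P]_w cos (real_integral N s w + c0) =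
     cos c0 * expR (- fine (\int[mu]_x (q (simple_fct s x))%:E)%E)) /\
  (\int[mu]_x (q (simple_fct s x))%:E < +oo)%E.
Proof.
have mS : measurable_fun setT (fun w => \sum_(k < m) N (coef k) (D k) w).
  exact: measurable_sum.
split=> [c0|]; last by rewrite int_q ltry.
rewrite int_q /= -sumrN expR_sum.
rewrite (@ae_eq_Rintegral _ _ _ P _ (fun w => cos (\sum_(k < m) N (coef k) (D k) w + c0))).
- rewrite (sum_charfun mN (gf_independent gfN coef fD tD)
    (fun k => gf_sin gfN (coef k) (fD k))).
  by congr (_ * _); apply: eq_bigr => k _; exact: (gf_cos gfN).
- by apply: measurable_cos; apply: measurable_funD => //; exact: measurable_real_integral.
- by apply: measurable_cos; exact: measurable_funD.
- by apply: filterS real_integralE => w ->.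
Qed.

End simple.
End gaussian_functional.

(** * Second moments and convergence in probability *)

Section sine_bounds.
Context {R : realType}.
Implicit Types x y : R.

Lemma lipschitz_of_derive (f f' : R -> R) :
  (forall x, is_derive x (1 : R) f (f' x)) -> (forall x, `|f' x| <= 1) ->
  forall x y, `|f x - f y| <= `|x - y|.
Proof.
move=> df f1 x y; wlog xy : x y / y <= x => [hw|].
  have [yx|/ltW xy] := leP y x; first exact: hw.
  by rewrite distrC [leRHS]distrC; exact: hw.
have cf : {within `[y, x], continuous f}.
  apply: continuous_subspaceT => z.
  by apply/differentiable_continuous/derivable1_diffP; case: (df z).
have [z _ ->] := MVT_segment xy (fun z _ => df z) cf.
by rewrite normrM ler_piMl.
Qed.

Lemma cos_lipschitz x y : `|cos x - cos y| <= `|x - y|.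
Proof.
apply: (lipschitz_of_derive (f' := fun x => - sin x)) => z.
by rewrite normrN ler_norml sin_geN1 sin_le1.
Qed.

Lemma sin_lipschitz x y : `|sin x - sin y| <= `|x - y|.
Proof.
apply: (lipschitz_of_derive (f' := cos)) => z.
by rewrite ler_norml cos_geN1 cos_le1.
Qed.

Lemma oneB_cosE x : 1 - cos x = 2 * sin (x / 2) ^+ 2.
Proof.
have -> : cos x = cos (x / 2 + x / 2) by congr cos; field.
rewrite cosD -!expr2; have := cos2Dsin2 (x / 2); lra.
Qed.

Lemma oneB_cos_le x : 2 * (1 - cos x) <= x ^+ 2.
Proof.
have h : `|sin (x / 2)| <= `|x / 2|.
  by have := sin_lipschitz (x / 2) 0; rewrite sin0 !subr0.
have h2 : sin (x / 2) ^+ 2 <= (x / 2) ^+ 2.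
  by rewrite -(real_normK (num_real (sin _))) -(real_normK (num_real (x / 2))) ler_sqr ?nnegrE.
rewrite oneB_cosE (_ : x ^+ 2 = 4 * (x / 2) ^+ 2); last by field.
lra.
Qed.

Lemma mul_sin_div_cvg x : n.+1%:R * sin (x / n.+1%:R) @[n --> \oo] --> x.
Proof.
have [->|x0] := eqVneq x 0.
  by under eq_fun do rewrite mul0r sin0 mulr0; exact: cvg_cst.
have [ds es] := is_derive_sin (0 : R).
have cv : h^-1 *: ((sin \o shift 0) (h *: (1 : R)) - sin 0) @[h --> 0^'] -->
    'D_1 (@sin R) 0 by exact: ds.
have xn0 : (forall n, x / n.+1%:R != 0) /\ x / n.+1%:R @[n --> \oo] --> (0 : R).
  split=> [n|]; first by rewrite mulf_neq0// invr_eq0 pnatr_eq0.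
  rewrite -[X in _ --> X](mulr0 x); apply: cvgM; first exact: cvg_cst.
  exact: cvg_harmonic.
have cvn := (cvgr_dnbhsP _ _ _).1 cv _ xn0; rewrite es cos0 in cvn.
have cvx : x * ((x / n.+1%:R)^-1 *: ((sin \o shift 0) (x / n.+1%:R *: (1 : R)) - sin 0))
    @[n --> \oo] --> x * 1 by apply: cvgM => //; exact: cvg_cst.
rewrite mulr1 in cvx; apply: cvg_trans cvx; apply: near_eq_cvg; apply: nearW => n.
rewrite sin0 subr0 /= addr0 /GRing.scale /= mulr1 invf_div mulrA.
by congr (_ * _); rewrite mulrCA mulfV// mulr1.
Qed.

Lemma oneB_cos_cvg x :
  2 * n.+1%:R ^+ 2 * (1 - cos (x / n.+1%:R)) @[n --> \oo] --> x ^+ 2.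
Proof.
have -> : (fun n => 2 * n.+1%:R ^+ 2 * (1 - cos (x / n.+1%:R))) =
    (fun n => (2 * (n.+1%:R * sin ((x / 2) / n.+1%:R))) ^+ 2).
  apply/funext => n; rewrite oneB_cosE.
  by rewrite (_ : x / n.+1%:R / 2 = x / 2 / n.+1%:R); [ring|rewrite mulrAC].
have -> : x ^+ 2 = (2 * (x / 2)) ^+ 2 by field.
have cv : 2 * (n.+1%:R * sin ((x / 2) / n.+1%:R)) @[n --> \oo] --> 2 * (x / 2).
  by apply: cvgM; [exact: cvg_cst|exact: mul_sin_div_cvg].
by rewrite expr2; under eq_fun do rewrite expr2; exact: cvgM.
Qed.

End sine_bounds.

Section second_moment.
Context {R : realType} {d : measure_display} {T : measurableType d}
  (P : probability T R).

Let bcos n (Y : T -> R) : measurable_fun setT Y ->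
  bounded_measurable (fun w => cos (Y w / n.+1%:R)).
Proof. by move=> mY; apply: bounded_measurable_cos; exact: measurable_funM. Qed.

Lemma integrable_sinusoid n (Y : T -> R) : measurable_fun setT Y ->
  P.-integrable setT
    (EFin \o (fun w => 2 * n.+1%:R ^+ 2 * (1 - cos (Y w / n.+1%:R)))).
Proof.
move=> mY; apply: integrable_bounded_measurable; apply: bounded_measurableZ.
apply: bounded_measurableD; first exact: bounded_measurable_cst.
have := bounded_measurableZ (-1) (bcos n mY).
by under eq_fun do rewrite mulN1r.
Qed.

Lemma Rintegral_sinusoid n (Y : T -> R) : measurable_fun setT Y ->
  \int[P]_w (2 * n.+1%:R ^+ 2 * (1 - cos (Y w / n.+1%:R))) =
  2 * n.+1%:R ^+ 2 * (1 - \int[P]_w cos (Y w / n.+1%:R)).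
Proof.
move=> mY; have bc := integrable_bounded_measurable P (bcos n mY).
have b1 := integrable_bounded_measurable P (bounded_measurable_cst (1 : R)).
have PT : fine (P setT) = 1 by rewrite probability_setT.
rewrite RintegralZl//; last first.
  by have := integrableB measurableT b1 bc; apply: eq_integrable.
by rewrite RintegralB// Rintegral_cst// PT mulr1.
Qed.

(** Fatou applied to the integrands 2 n^2 (1 - cos (Y / n)), which tend to Y^2. *)
Lemma second_moment_le (Y : T -> R) (c : R) : measurable_fun setT Y ->
  (forall n, 1 - c / n.+1%:R ^+ 2 <= \int[P]_w cos (Y w / n.+1%:R)) ->
  (\int[P]_w (Y w ^+ 2)%:E <= (2 * c)%:E)%E.
Proof.
move=> mY hc.
pose f n w := 2 * n.+1%:R ^+ 2 * (1 - cos (Y w / n.+1%:R)).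
have mcos n : measurable_fun setT (fun w => cos (Y w / n.+1%:R)).
  by apply: measurable_cos; apply: measurable_funM.
have f0 n w : 0 <= f n w.
  by rewrite mulr_ge0 ?mulr_ge0 ?exprn_ge0// subr_ge0 cos_le1.
have mf n : measurable_fun setT (EFin \o f n).
  by apply/measurable_EFinP; apply: measurable_funM => //; exact: measurable_funB.
have intf n : (\int[P]_w (f n w)%:E <= (2 * c)%:E)%E.
  have b3 : P.-integrable setT (EFin \o f n) := integrable_sinusoid n mY.
  have -> : (\int[P]_w (f n w)%:E = (\int[P]_w f n w)%:E)%E.
    by rewrite fineK//; exact: integrable_fin_num.
  rewrite lee_fin Rintegral_sinusoid//.
  have n0 : 0 < n.+1%:R ^+ 2 :> R by rewrite exprn_gt0.
  have := hc n; rewrite -(ler_pM2l n0) mulrBr mulr1 (mulrC _ (c / _)) divfK ?gt_eqF//.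
  rewrite -mulrA mulrBr mulr1; lra.
have fat := @fatou _ _ _ P setT measurableT (fun n => EFin \o f n) mf
  (fun n w _ => f0 n w).
have fE w : limn_einf (fun n => (f n w)%:E) = (Y w ^+ 2)%:E.
  have cvf : (f n w)%:E @[n --> \oo] --> (Y w ^+ 2)%:E.
    by apply: cvg_EFin; [exact: nearW|exact: oneB_cos_cvg].
  by have [-> _] := cvg_limn_einf_sup cvf.
under eq_integral do rewrite -fE.
apply: (le_trans fat); rewrite limn_einf_lim; apply: lime_le.
  exact: is_cvg_einfs.
apply: nearW => n; apply: le_trans (intf n).
by apply: ereal_inf_lbound; exists n => //=.
Qed.

(** The lower bound for V compares 1 - exp (- x) with x / (1 + x), where
    x = s^2 / (2 n^2) tends to 0. *)
Lemma second_moment_eq (Y : T -> R) (s V : R) : measurable_fun setT Y ->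
  (forall th, \int[P]_w cos (th * Y w) = expR (- (th ^+ 2 * s ^+ 2 / 2))) ->
  (\int[P]_w (Y w ^+ 2)%:E)%E = V%:E -> s ^+ 2 = V.
Proof.
move=> mY hc hV.
have c1 n : \int[P]_w cos (Y w / n.+1%:R) = expR (- (s ^+ 2 / (2 * n.+1%:R ^+ 2))).
  under eq_Rintegral do rewrite mulrC; rewrite hc; congr expR.
  by rewrite exprVn; field.
apply/eqP; rewrite eq_le; apply/andP; split; last first.
  rewrite -lee_fin -hV (_ : s ^+ 2 = 2 * (s ^+ 2 / 2)); last by field.
  apply: second_moment_le => // n; rewrite c1.
  apply: le_trans (expR_ge1Dx _); rewrite lerD2l lerN2.
  by rewrite invfM mulrA.
have V0 : 0 <= V by rewrite -lee_fin -hV integral_ge0// => w _; rewrite lee_fin sqr_ge0.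
have iY : P.-integrable setT (fun w => (Y w ^+ 2)%:E).
  apply/integrableP; split; first by apply/measurable_EFinP; exact: measurable_funX.
  under eq_integral do rewrite /= ger0_norm ?sqr_ge0//.
  by rewrite hV ltry.
have h n : s ^+ 2 <= V * (1 + s ^+ 2 / (2 * n.+1%:R ^+ 2)).
  set x := s ^+ 2 / (2 * n.+1%:R ^+ 2).
  have n0 : 0 < n.+1%:R ^+ 2 :> R by rewrite exprn_gt0.
  have x0 : 0 <= x by rewrite divr_ge0 ?sqr_ge0// mulr_ge0// ltW.
  have : 2 * n.+1%:R ^+ 2 * (1 - expR (- x)) <= V.
    have -> : V = \int[P]_w (Y w ^+ 2) by rewrite /Rintegral hV.
    rewrite -c1 -Rintegral_sinusoid//; apply: le_Rintegral => //.
      exact: integrable_sinusoid.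
    move=> w _.
    have := oneB_cos_le (Y w / n.+1%:R).
    rewrite expr_div_n ler_pdivlMr//; lra.
  have : expR (- x) <= (1 + x)^-1.
    by rewrite expRN lef_pV2 ?posrE ?expR_gt0 ?ltr_wpDr// expR_ge1Dx.
  have xn : s ^+ 2 = x * (2 * n.+1%:R ^+ 2) by rewrite /x divfK// gt_eqF// mulr_gt0.
  have x1 : 0 < 1 + x by rewrite ltr_wpDr.
  rewrite -ler_pdivrMr//; move=> h1 h2; apply: le_trans h2.
  have gen (a c : R) : 0 < 1 + a -> a * c / (1 + a) = c * (1 - (1 + a)^-1).
    by move=> a1; field; rewrite gt_eqF.
  rewrite xn gen// ler_wpM2l ?mulr_ge0 ?(ltW n0)//.
  by rewrite lerD2l lerN2.
apply/ler_addgt0Pr => e e0.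
have [N _ hN] : \forall n \near \oo, V * s ^+ 2 / e < n%:R by exact: nbhs_infty_gtr.
have := hN _ (leqnn N) => /= hNN.
apply: (le_trans (h N)); rewrite mulrDr mulr1 lerD2l mulrA.
rewrite ler_pdivrMr; last by rewrite mulr_gt0 ?exprn_gt0.
move: hNN; rewrite ltr_pdivrMr// => hNN.
have N1 : N%:R <= 2 * N.+1%:R ^+ 2 :> R.
  rewrite -natr1; have : 0 <= N%:R :> R by [].
  nra.
by apply: (le_trans (ltW hNN)); rewrite mulrC ler_wpM2l// ltW.
Qed.

End second_moment.

Lemma le_cvge0 (R : realType) (u v : nat -> \bar R) :
  (forall n, 0 <= u n <= v n)%E -> v n @[n --> \oo] --> 0%E ->
  u n @[n --> \oo] --> 0%E.
Proof.
by move=> uv v0; apply: (squeeze_cvge _ (cvg_cst 0%E) v0); exact: nearW.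
Qed.

Section convergence_in_probability.
Context {R : realType} {d : measure_display} {T : measurableType d}
  (P : probability T R).
Implicit Types (X : nat -> T -> R) (Y : T -> R).

Definition cvg_in_probability X Y := forall e : R, 0 < e ->
  (fun n => P [set w | e <= `|X n w - Y w|]) @ \oo --> 0%E.

Let mset X Y (e : R) n : (forall n, measurable_fun setT (X n)) -> measurable_fun setT Y ->
  measurable [set w | e <= `|X n w - Y w|].
Proof.
move=> mX mY; apply: measurable_superlevel.
by apply: measurableT_comp => //; exact: measurable_funB.
Qed.

(** Where |X n - Y| is less than e / 2 the Lipschitz bound applies, elsewhere the
    difference is at most 2. *)
Lemma cvg_in_probability_expectation (g : R -> R) X Y :
  (forall n, measurable_fun setT (X n)) -> measurable_fun setT Y ->
  measurable_fun setT g -> (forall x, `|g x| <= 1) ->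
  (forall x y, `|g x - g y| <= `|x - y|) ->
  cvg_in_probability X Y ->
  \int[P]_w g (X n w) @[n --> \oo] --> \int[P]_w g (Y w).
Proof.
move=> mX mY mg g1 glip XY.
have bg Z : measurable_fun setT Z -> P.-integrable setT (EFin \o (fun w => g (Z w))).
  move=> mZ; apply: integrable_bounded_measurable; split; last by exists 1.
  exact: measurableT_comp.
have PT : fine (P setT) = 1 by rewrite probability_setT.
apply/cvgrPdist_le => /= e e0.
have e2 : 0 < e / 2 by rewrite divr_gt0.
have /fine_cvgP[_ /cvgrPdist_lt/(_ _ (divr_gt0 e0 (ltr0n R 4)))] := XY _ e2.
move=> /= [N _ hN]; exists N => // n /= /hN; rewrite sub0r normrN => hn.
set A := [set w | e / 2 <= `|X n w - Y w|] in hn.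
have mA : measurable A by exact: mset.
rewrite -RintegralB//; [|exact: bg..].
apply: (le_trans (le_normr_Rintegral _ _)) => //.
  have := integrableB measurableT (bg _ mY) (bg _ (mX n)).
  by apply: eq_integrable.
have bA : P.-integrable setT (EFin \o (fun w => e / 2 + 2 * \1_A w)).
  apply: integrable_bounded_measurable; apply: bounded_measurableD.
    exact: bounded_measurable_cst.
  by apply: bounded_measurableZ; exact: bounded_measurable_indic.
apply: (@le_trans _ _ (\int[P]_w (e / 2 + 2 * \1_A w))).
  apply: le_Rintegral => //.
    have := integrable_abse (integrableB measurableT (bg _ mY) (bg _ (mX n))).
    by apply: eq_integrable.
  move=> w _; rewrite indicE; case: (boolP (w \in A)) => [_|wA].
    apply: (@le_trans _ _ 2); last by rewrite mulr1; lra.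
    by apply: (le_trans (ler_normB _ _)); have := g1 (Y w); have := g1 (X n w); lra.
  rewrite mulr0 addr0; apply: (le_trans (glip _ _)); rewrite distrC.
  by move: wA; rewrite notin_setE /A /= => /negP; rewrite -ltNge => /ltW.
rewrite RintegralD//; last 2 first.
- by apply: integrable_bounded_measurable; exact: bounded_measurable_cst.
- apply: integrable_bounded_measurable.
  by apply: bounded_measurableZ; exact: bounded_measurable_indic.
rewrite Rintegral_cst// PT mulr1 RintegralZl//; last first.
  by apply: integrable_bounded_measurable; exact: bounded_measurable_indic.
rewrite Rintegral_indic//.
move: hn; rewrite ger0_norm ?fine_ge0// => hn; lra.
Qed.

Lemma cvg_ae_in_probability X Y :
  (forall n, measurable_fun setT (X n)) -> measurable_fun setT Y ->
  {ae P, forall w, X n w @[n --> \oo] --> Y w} -> cvg_in_probability X Y.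
Proof.
move=> mX mY XY e e0.
have mA n : measurable [set w | e <= `|X n w - Y w|] by exact: mset.
have h : \int[P]_w \1_[set w | e <= `|X n w - Y w|] w @[n --> \oo] -->
    \int[P]_w (cst 0 w : R).
  apply: (@Rintegral_bounded_cvg _ _ _ P _ _ 1).
  - by move=> n; exact: measurable_indic.
  - by move=> n w; rewrite indicE; case: (_ \in _); rewrite ?normr1 ?normr0.
  - exact: measurable_cst.
  - apply: filterS XY => w /cvgrPdist_lt/(_ _ e0)[N _ hN].
    apply: cvg_near_cst; exists N => // n /= /hN.
    rewrite distrC ltNge => /negP h; rewrite indicE memNset//.
have -> : (fun n => P [set w | e <= `|X n w - Y w|]) =
    (fun n => (\int[P]_w \1_[set w | e <= `|X n w - Y w|] w)%:E).
  by apply/funext => n; rewrite Rintegral_indic// fineK// fin_num_measure.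
apply: cvg_EFin; first exact: nearW.
by move: h; rewrite /Rintegral integral0.
Qed.

Lemma cvg_in_probabilityZ a X Y : (forall n, measurable_fun setT (X n)) ->
  measurable_fun setT Y -> cvg_in_probability X Y ->
  cvg_in_probability (fun n w => a * X n w) (fun w => a * Y w).
Proof.
move=> mX mY XY e e0; have a0 : 0 < `|a| + 1 by rewrite ltr_wpDl.
apply: le_cvge0 (XY _ (divr_gt0 e0 a0)) => n; rewrite measure_ge0 /=.
apply: le_measure; rewrite ?inE.
- apply: (@mset (fun n w => a * X n w) (fun w => a * Y w)) => [k|];
    exact: measurable_funM.
- exact: mset.
- move=> w /=; rewrite -mulrBr normrM ler_pdivrMr// => h; apply: (le_trans h).
  by rewrite mulrC ler_wpM2l// lerDl.
Qed.

Lemma cvg_in_probabilityD X X' Y Y' :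
  (forall n, measurable_fun setT (X n)) -> measurable_fun setT Y ->
  (forall n, measurable_fun setT (X' n)) -> measurable_fun setT Y' ->
  cvg_in_probability X Y -> cvg_in_probability X' Y' ->
  cvg_in_probability (fun n w => X n w + X' n w) (fun w => Y w + Y' w).
Proof.
move=> mX mY mX' mY' XY XY' e e0; have e2 : 0 < e / 2 by rewrite divr_gt0.
have h : (P [set w | e / 2 <= `|X n w - Y w|]%R +
    P [set w | e / 2 <= `|X' n w - Y' w|]%R)%E @[n --> \oo] --> 0%E.
  by rewrite -[0%E]adde0; apply: cvgeD => //; [exact: XY|exact: XY'].
apply: le_cvge0 h => n; rewrite measure_ge0 /=.
have m1 := mset (e / 2) n mX mY; have m2 := mset (e / 2) n mX' mY'.
apply: le_trans (measureU2 _ m1 m2); apply: le_measure; rewrite ?inE.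
- apply: (@mset (fun n w => X n w + X' n w) (fun w => Y w + Y' w)) => [k|];
    exact: measurable_funD.
- exact: measurableU.
- move=> w /= h; apply/orP; rewrite -implyNb -ltNge; apply/implyP => h1.
  have : `|X n w + X' n w - (Y w + Y' w)| <= `|X n w - Y w| + `|X' n w - Y' w|.
    by rewrite opprD addrACA ler_normD.
  by move: h h1; lra.
Qed.

End convergence_in_probability.

(** * Gaussian integrals *)

Section inner_product_theory.
Context {R : realType} {V : nzRingType} (iota : R -> V) (b : V -> V -> R).
Hypothesis ipb : inner_product iota b.
Let q v := b v v.

Let sym := ip_sym ipb.
Let add := ip_add ipb.
Let scale := ip_scale ipb.

Lemma ip_addr u v w : b w (u + v) = b w u + b w v.
Proof. by rewrite sym add !(sym w). Qed.

Lemma ip_scaler a v w : b w (iota a * v) = a * b w v.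
Proof. by rewrite sym scale (sym w). Qed.

Lemma ipN v : q (- v) = q v.
Proof. by rewrite /q -(iotaN1 ipb) scale ip_scaler mulrA mulN1r opprK mul1r. Qed.

Lemma ipZ a v : q (iota a * v) = a ^+ 2 * q v.
Proof. by rewrite /q scale ip_scaler mulrA. Qed.

Lemma ipD u v : q (u + v) = q u + 2 * b u v + q v.
Proof. rewrite /q add !ip_addr (sym v u); ring. Qed.

Lemma ipB u v : q (u - v) = q u - 2 * b u v + q v.
Proof.
by rewrite ipD -(iotaN1 ipb) ipZ ip_scaler sqrrN expr1n mul1r mulN1r mulrN.
Qed.

Lemma ip_sum n (a : 'I_n -> R) (v : 'I_n -> V) :
  q (\sum_i iota (a i) * v i) =
  \sum_i \sum_j a i * a j * ((q (v i) + q (v j) - q (v i - v j)) / 2).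
Proof.
have b0 w : b 0 w = 0 := ip0l ipb w.
rewrite /q (big_morph (fun u => b u (\sum_i iota (a i) * v i))
  (fun u w => add u w _) (b0 _)).
apply: eq_bigr => i _; rewrite scale sym.
rewrite (big_morph (fun u => b u (v i)) (fun u w => add u w _) (b0 _)).
rewrite mulr_sumr; apply: eq_bigr => j _; rewrite scale mulrA; congr (_ * _).
have := ipB (v i) (v j); rewrite /q => ->; rewrite (sym (v j)); by field.
Qed.

(** Young's inequality: expand the nonnegative number q (e u - v). *)
Lemma ip_young (e : R) u v : 0 < e ->
  q (u + v) <= (1 + e) * q u + (1 + e^-1) * q v.
Proof.
move=> e0; have := ip_ge0 ipb (iota e * u - v).
rewrite -/(q _) ipB ipZ scale => h.
have : 0 <= e^-1 * (e ^+ 2 * q u - 2 * (e * b u v) + q v).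
  by rewrite mulr_ge0// invr_ge0 ltW.
have -> : e^-1 * (e ^+ 2 * q u - 2 * (e * b u v) + q v) =
    e * q u - 2 * b u v + e^-1 * q v by field; rewrite gt_eqF.
rewrite ipD; lra.
Qed.

End inner_product_theory.

Section real_gaussian_integral.
Context {R : realType} {V : nzRingType} (iota : R -> V) (b : V -> V -> R).
Hypothesis ipb : inner_product iota b.
Let q v := b v v.
Context {d : measure_display} {T : measurableType d} (P : probability T R)
  {d' : measure_display} {S : measurableType d'}
  (mu : {measure set S -> \bar R}).

(** A class of measurable functions with values in V, closed under what the
    approximation of integrands needs. *)
Record measurable_class (mV : set (S -> V)) : Prop := {
  mc_simple : forall s, simple_integrand mu s -> mV (simple_fct s) ;
  mcD : forall f g, mV f -> mV g -> mV (fun x => f x + g x) ;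
  mcZ : forall a f, mV f -> mV (fun x => iota a * f x) ;
  mcq : forall f, mV f -> measurable_fun setT (fun x => q (f x)) }.

Variable mV : set (S -> V).
Hypothesis mcV : measurable_class mV.

Lemma mcB f g : mV f -> mV g -> mV (fun x => f x - g x).
Proof.
move=> mf mg; have := mcD mcV mf (mcZ mcV (-1) mg).
by under eq_fun do rewrite (iotaN1 ipb).
Qed.

Definition sqnorm (f : S -> V) : \bar R := (\int[mu]_x (q (f x))%:E)%E.

Lemma sqnorm_ge0 f : (0 <= sqnorm f)%E.
Proof. by apply: integral_ge0 => x _; rewrite lee_fin (ip_ge0 ipb). Qed.

Let mqE f : mV f -> measurable_fun setT (fun x => (q (f x))%:E).
Proof. by move=> mf; apply/measurable_EFinP; exact: (mcq mcV). Qed.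

Lemma sqnorm_young (e : R) f g : 0 < e -> mV f -> mV g ->
  (sqnorm (fun x => (f x + g x)%R) <=
   (1 + e)%:E * sqnorm f + (1 + e^-1)%:E * sqnorm g)%E.
Proof.
move=> e0 mf mg; have e1 : 0 <= 1 + e by rewrite addr_ge0// ltW.
have e2 : 0 <= 1 + e^-1 by rewrite addr_ge0// invr_ge0 ltW.
have q0 f' x : (0 <= (q (f' x))%:E)%E by rewrite lee_fin (ip_ge0 ipb).
rewrite /sqnorm -ge0_integralZl_EFin//; [|exact: mqE].
rewrite -ge0_integralZl_EFin//; [|exact: mqE].
rewrite -ge0_integralD//; last 4 first.
- by move=> x _; rewrite mule_ge0.
- by apply: measurable_funeM; exact: mqE.
- by move=> x _; rewrite mule_ge0.
- by apply: measurable_funeM; exact: mqE.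
apply: ge0_le_integral => //.
- by apply: mqE; exact: (mcD mcV).
- by apply: emeasurable_funD; apply: measurable_funeM; exact: mqE.
- by move=> x _; rewrite -!EFinM -EFinD lee_fin (ip_young ipb).
Qed.

Lemma sqnormZ a f : mV f -> sqnorm (fun x => iota a * f x) = ((a ^+ 2)%:E * sqnorm f)%E.
Proof.
move=> mf; rewrite /sqnorm.
under eq_integral do rewrite /q (ipZ ipb) EFinM.
rewrite ge0_integralZl_EFin ?sqr_ge0//; last exact: mqE.
by move=> x _; rewrite lee_fin (ip_ge0 ipb).
Qed.

Lemma sqnorm_opp f : sqnorm (fun x => - f x) = sqnorm f.
Proof. by apply: eq_integral => x _; rewrite /q (ipN ipb). Qed.

Lemma sqnorm_sub_lty f g : mV f -> mV g -> (sqnorm f < +oo)%E ->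
  (sqnorm g < +oo)%E -> (sqnorm (fun x => (f x - g x)%R) < +oo)%E.
Proof.
move=> mf mg lf lg.
have mNg : mV (fun x => - g x).
  by have := mcZ mcV (-1) mg; under eq_fun do rewrite (iotaN1 ipb).
apply: le_lt_trans (@sqnorm_young 1 f (fun x => - g x) ltr01 mf mNg) _.
rewrite sqnorm_opp lte_add_pinfty// lte_mul_pinfty// lee_fin addr_ge0//.
Qed.

(** Polarization: the scalar products are determined by the squared norms of the
    functions and of their differences. *)
Lemma sqnorm_sum n (a : 'I_n -> R) (f : 'I_n -> S -> V) :
  (forall i, mV (f i)) -> (forall i, sqnorm (f i) < +oo)%E ->
  sqnorm (fun x => \sum_i iota (a i) * f i x) =
  (\sum_i \sum_j a i * a j * ((fine (sqnorm (f i)) + fine (sqnorm (f j)) -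
    fine (sqnorm (fun x => (f i x - f j x)%R))) / 2))%:E.
Proof.
move=> mf lf.
have iq g : mV g -> (sqnorm g < +oo)%E -> mu.-integrable setT (EFin \o (fun x => q (g x))).
  move=> mg lg; apply/integrableP; split; first exact: mqE.
  by under eq_integral do rewrite /= ger0_norm ?(ip_ge0 ipb)//.
have ii i := iq _ (mf i) (lf i).
have id i j := iq _ (mcB (mf i) (mf j)) (sqnorm_sub_lty (mf i) (mf j) (lf i) (lf j)).
pose h i j x := a i * a j * ((q (f i x) + q (f j x) - q (f i x - f j x)) / 2).
have ih0 i j : mu.-integrable setT
    (EFin \o (fun x => q (f i x) + q (f j x) - q (f i x - f j x))).
  have := integrableB measurableT (integrableD measurableT (ii i) (ii j)) (id i j).
  by apply: eq_integrable.
have ih i j : mu.-integrable setT (EFin \o h i j).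
  have := integrableZl measurableT (a i * a j / 2) (ih0 i j).
  by apply: eq_integrable => // x _ /=; rewrite -EFinM /h; congr EFin; ring.
have isum (F : 'I_n -> S -> R) (r : seq 'I_n) :
    (forall i, mu.-integrable setT (EFin \o F i)) ->
    mu.-integrable setT (EFin \o (fun x => \sum_(i <- r) F i x)) /\
    \int[mu]_x (\sum_(i <- r) F i x) = \sum_(i <- r) \int[mu]_x F i x.
  move=> iF; elim: r => [|i r [IH1 IH2]].
    have -> : (fun x => \sum_(i <- [::]) F i x) = cst 0.
      by apply/funext => x; rewrite big_nil.
    split; first exact: (integrable0 mu setT).
    by rewrite big_nil /Rintegral integral0.
  have -> : (fun x => \sum_(i <- i :: r) F i x) =
      (fun x => F i x + \sum_(i <- r) F i x).
    by apply/funext => x; rewrite big_cons.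
  split; first by have := integrableD measurableT (iF i) IH1; apply: eq_integrable.
  by rewrite RintegralD// IH2 big_cons.
have ihi i := isum (h i) (index_enum 'I_n) (ih i).
have [ih' hE] := isum (fun i x => \sum_j h i j x) (index_enum 'I_n) (fun i => (ihi i).1).
rewrite /sqnorm; under eq_integral do rewrite /q (ip_sum ipb).
rewrite -[LHS]fineK; last exact: integrable_fin_num ih'.
congr EFin; apply: (etrans hE).
apply: eq_bigr => i _; rewrite (ihi i).2; apply: eq_bigr => j _.
rewrite /h; under eq_Rintegral do rewrite mulrCA mulrC.
transitivity (a i * a j / 2 * \int[mu]_x (q (f i x) + q (f j x) - q (f i x - f j x))).
  by rewrite -RintegralZl.
rewrite RintegralB//; last first.
  by have := integrableD measurableT (ii i) (ii j); apply: eq_integrable.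
by rewrite RintegralD// mulrAC -mulrA.
Qed.

Variable N : V -> set S -> T -> R.
Hypothesis gfN : gaussian_functional P mu iota b N.

(** The real part of the integral of f, for the functional N. *)
Definition gaussian_integral (f : S -> V) (Y : T -> R) : Prop :=
  [/\ mV f, (sqnorm f < +oo)%E, measurable_fun setT Y &
   exists s : nat -> seq (V * set S), [/\ forall n, simple_integrand mu (s n),
     sqnorm (fun x => simple_fct (s n) x - f x) @[n --> \oo] --> 0%E &
     cvg_in_probability P (fun n => real_integral N (s n)) Y]].

Let scaled a (s : seq (V * set S)) := [seq (iota a * p.1, p.2) | p <- s].

Let simple_scaled a s : simple_integrand mu s -> simple_integrand mu (scaled a s).
Proof. by move=> hs _ /mapP[p ps ->] /=; exact: hs. Qed.

Let simple_fct_scaled a s x : simple_fct (scaled a s) x = iota a * simple_fct s x.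
Proof.
rewrite /simple_fct big_map mulr_sumr; apply: eq_bigr => p _ /=.
by rewrite mulrA.
Qed.

Let real_integral_scaled a s w : real_integral N (scaled a s) w = a * real_integral N s w.
Proof.
rewrite /real_integral big_map mulr_sumr; apply: eq_bigr => p _ /=.
exact: (gf_scale gfN).
Qed.

Let simple_cat (s s' : seq (V * set S)) : simple_integrand mu s -> simple_integrand mu s' ->
  simple_integrand mu (s ++ s').
Proof. by move=> hs hs' p; rewrite mem_cat => /orP[/hs|/hs']. Qed.

Let simple_fct_cat (s s' : seq (V * set S)) x : simple_fct (s ++ s') x = simple_fct s x + simple_fct s' x.
Proof. by rewrite /simple_fct big_cat. Qed.

Let real_integral_cat s s' w :
  real_integral N (s ++ s') w = real_integral N s w + real_integral N s' w.
Proof. by rewrite /real_integral big_cat. Qed.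

Let mI s : simple_integrand mu s -> measurable_fun setT (real_integral N s).
Proof. by move=> hs; apply: (measurable_real_integral gfN). Qed.

Let I_lty s : simple_integrand mu s -> (sqnorm (simple_fct s) < +oo)%E.
Proof. by move=> hs; have [_] := simple_charfun ipb gfN hs. Qed.

Lemma gaussian_integralZ a f Y : gaussian_integral f Y ->
  gaussian_integral (fun x => iota a * f x) (fun w => a * Y w).
Proof.
move=> [mf lf mY [s [hs cs cY]]]; split.
- exact: (mcZ mcV).
- by rewrite sqnormZ// lte_mul_pinfty ?sqnorm_ge0// lee_fin sqr_ge0.
- exact: measurable_funM.
- exists (fun n => scaled a (s n)); split.
  + by move=> n; exact: simple_scaled.
  + have e n : sqnorm (fun x => simple_fct (scaled a (s n)) x - iota a * f x) =
        ((a ^+ 2)%:E * sqnorm (fun x => (simple_fct (s n) x - f x)%R))%E.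
      rewrite -sqnormZ; last by apply: mcB => //; exact: (mc_simple mcV).
      by congr sqnorm; apply/funext => x; rewrite simple_fct_scaled mulrBr.
    have h : ((a ^+ 2)%:E * sqnorm (fun x => (simple_fct (s n) x - f x)%R))%E
        @[n --> \oo] --> 0%E.
      by rewrite -[X in _ --> X](mule0 (a ^+ 2)%:E); exact: cvgeZl.
    by under eq_fun do rewrite e.
  + rewrite (_ : (fun n => _) = (fun n w => a * real_integral N (s n) w)).
      by apply: cvg_in_probabilityZ => // n; exact: mI.
    by apply/funext => n; apply/funext => w; exact: real_integral_scaled.
Qed.

Lemma gaussian_integralD f g Y Z : gaussian_integral f Y ->
  gaussian_integral g Z ->
  gaussian_integral (fun x => f x + g x) (fun w => Y w + Z w).
Proof.
move=> [mf lf mY [s [hs cs cY]]] [mg lg mZ [s' [hs' cs' cZ]]].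
have m1 n : mV (fun x => simple_fct (s n) x - f x).
  by apply: mcB => //; exact: (mc_simple mcV).
have m2 n : mV (fun x => simple_fct (s' n) x - g x).
  by apply: mcB => //; exact: (mc_simple mcV).
split.
- exact: (mcD mcV).
- apply: le_lt_trans (@sqnorm_young 1 f g ltr01 mf mg) _.
  by rewrite lte_add_pinfty// lte_mul_pinfty ?sqnorm_ge0// lee_fin addr_ge0// invr1.
- exact: measurable_funD.
- exists (fun n => s n ++ s' n); split.
  + by move=> n; exact: simple_cat.
  + have h : ((1 + 1)%:E * sqnorm (fun x => (simple_fct (s n) x - f x)%R) +
        (1 + 1^-1)%:E * sqnorm (fun x => (simple_fct (s' n) x - g x)%R))%E
        @[n --> \oo] --> 0%E.
      rewrite -[X in _ --> X]adde0; apply: cvgeD => //.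
        by rewrite -[X in _ --> X](mule0 (1 + 1)%:E); exact: cvgeZl.
      by rewrite -[X in _ --> X](mule0 (1 + 1^-1)%:E); exact: cvgeZl.
    apply: le_cvge0 h => n; rewrite sqnorm_ge0 /=.
    apply: le_trans (sqnorm_young ltr01 (m1 n) (m2 n)).
    rewrite le_eqVlt; apply/orP; left; apply/eqP; congr sqnorm.
    by apply/funext => x; rewrite simple_fct_cat opprD addrACA.
  + rewrite (_ : (fun n => _) =
        (fun n w => real_integral N (s n) w + real_integral N (s' n) w)).
      by apply: cvg_in_probabilityD => // n; exact: mI.
    by apply/funext => n; apply/funext => w; exact: real_integral_cat.
Qed.

Lemma gaussian_integral0 : gaussian_integral (fun=> 0) (fun=> 0).
Proof.
have s0 : simple_fct [::] = (fun=> 0 : V) :> (S -> V).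
  by apply/funext => x; rewrite /simple_fct big_nil.
have h0 : simple_integrand mu ([::] : seq (V * set S)) by [].
have n0 : sqnorm (fun=> 0) = 0%E.
  by rewrite /sqnorm; under eq_integral do rewrite /q (ip0l ipb); rewrite integral0.
split => //.
- by rewrite -s0; exact: (mc_simple mcV).
- by rewrite n0 ltry.
- exists (fun=> [::]); split => //.
  + by rewrite s0; under eq_fun do under eq_fun do rewrite subr0; rewrite n0; exact: cvg_cst.
  + move=> e e0; rewrite (_ : (fun n => _) = cst 0%E); first exact: cvg_cst.
    apply/funext => n; rewrite (_ : [set w | _] = set0) ?measure0//.
    apply/seteqP; split => // w /=; rewrite /real_integral big_nil subr0 normr0.
    by rewrite leNgt e0.
Qed.

Lemma gaussian_integral_sum n (a : 'I_n -> R) (f : 'I_n -> S -> V)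
    (Y : 'I_n -> T -> R) : (forall i, gaussian_integral (f i) (Y i)) ->
  gaussian_integral (fun x => \sum_i iota (a i) * f i x)
    (fun w => \sum_i a i * Y i w).
Proof.
move=> h; elim: (index_enum 'I_n) => [|i r IH].
  by under eq_fun do rewrite big_nil; under [X in gaussian_integral _ X]eq_fun do rewrite big_nil;
     exact: gaussian_integral0.
under eq_fun do rewrite big_cons; under [X in gaussian_integral _ X]eq_fun do rewrite big_cons.
by apply: gaussian_integralD => //; exact: gaussian_integralZ.
Qed.

(** Young's inequality replaces the triangle inequality for the norm, which
    would require square roots of extended reals. *)
Lemma cvg_sqnorm (u : nat -> S -> V) f : (forall n, mV (u n)) -> mV f ->
  (forall n, sqnorm (u n) < +oo)%E -> (sqnorm f < +oo)%E ->
  sqnorm (fun x => u n x - f x) @[n --> \oo] --> 0%E ->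
  fine (sqnorm (u n)) @[n --> \oo] --> fine (sqnorm f).
Proof.
move=> mu_ mf lu lf cu.
have md n : mV (fun x => u n x - f x) by exact: mcB.
have ld n : (sqnorm (fun x => (u n x - f x)%R) < +oo)%E by exact: sqnorm_sub_lty.
have fK g : (sqnorm g < +oo)%E -> sqnorm g = (fine (sqnorm g))%:E.
  by move=> lg; rewrite fineK// ge0_fin_numE// sqnorm_ge0.
pose A n := fine (sqnorm (u n)); pose F := fine (sqnorm f).
pose D n := fine (sqnorm (fun x => u n x - f x)).
have A0 n : 0 <= A n by rewrite fine_ge0// sqnorm_ge0.
have F0 : 0 <= F by rewrite fine_ge0// sqnorm_ge0.
have D0 n : 0 <= D n by rewrite fine_ge0// sqnorm_ge0.
have cD : D n @[n --> \oo] --> 0 by exact: (fine_cvg cu).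
have h1 e n : 0 < e -> A n <= (1 + e) * F + (1 + e^-1) * D n.
  move=> e0; have := sqnorm_young e0 mf (md n).
  rewrite (_ : (fun x => f x + (u n x - f x)) = u n); last first.
    by apply/funext => x; rewrite addrC subrK.
  by rewrite (fK _ (lu n)) (fK _ lf) (fK _ (ld n)) -!EFinM -EFinD lee_fin.
have h2 e n : 0 < e -> F <= (1 + e) * A n + (1 + e^-1) * D n.
  move=> e0; have mNd : mV (fun x => - (u n x - f x)).
    by have := mcZ mcV (-1) (md n); under eq_fun do rewrite (iotaN1 ipb).
  have := sqnorm_young e0 (mu_ n) mNd; rewrite sqnorm_opp.
  rewrite (_ : (fun x => u n x - (u n x - f x)) = f); last first.
    by apply/funext => x; rewrite opprB addrC subrK.
  by rewrite (fK _ (lu n)) (fK _ lf) (fK _ (ld n)) -!EFinM -EFinD lee_fin.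
apply/cvgrPdist_le => /= eta eta0.
pose e := Num.min 1 (eta / (4 * (F + 1))).
have F1 : 0 < 4 * (F + 1) by rewrite mulr_gt0// ltr_wpDl.
have e0 : 0 < e by rewrite lt_min ltr01 divr_gt0.
have e1 : e <= 1 by rewrite ge_min lexx.
have eF : 2 * e * F <= eta / 2.
  have : e * (4 * (F + 1)) <= eta by rewrite -ler_pdivlMr// ge_min lexx orbT.
  nra.
have K0 : 0 < 3 + e^-1 by rewrite ltr_wpDr// invr_ge0 ltW.
have d0 : 0 < eta / 2 / (3 + e^-1) by rewrite !divr_gt0.
move/cvgrPdist_le : cD => /(_ _ d0)[M _ hM].
exists M => // n /= /hM; rewrite sub0r normrN ger0_norm// ler_pdivlMr// => hn.
have a1 := h1 1 n ltr01; rewrite invr1 in a1.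
have a2 := h1 e n e0; have a3 := h2 e n e0.
have ei : 0 <= e^-1 * D n by rewrite mulr_ge0// invr_ge0 ltW.
have eA : e * A n <= e * (2 * F + 2 * D n) by rewrite ler_pM2l//; lra.
have eD : e * D n <= D n by rewrite ler_piMl.
have eF0 : 0 <= e * F by rewrite mulr_ge0// ltW.
have Dn := D0 n.
by rewrite ler_norml -/(A n) -/F; apply/andP; split; lra.
Qed.

(** Both sides pass to the limit from simple integrands: on the left because the
    cosine is bounded and Lipschitz, on the right by continuity of the norm. *)
Lemma gaussian_integral_charfun f Y c : gaussian_integral f Y ->
  \int[P]_w cos (Y w + c) = cos c * expR (- fine (sqnorm f)).
Proof.
move=> [mf lf mY [s [hs cs cY]]].
have mX n : measurable_fun setT (real_integral N (s n)) by exact: mI.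
have mc : measurable_fun setT (fun x : R => cos (x + c)).
  by apply: measurable_cos; exact: measurable_funD.
have c1 := cvg_in_probability_expectation mX mY mc
  (fun x => ltac:(by rewrite ler_norml cos_geN1 cos_le1))
  (fun x y => ltac:(by have := cos_lipschitz (x + c) (y + c);
    rewrite opprD addrACA subrr addr0)) cY.
have c2 : \int[P]_w cos (real_integral N (s n) w + c) @[n --> \oo] -->
    cos c * expR (- fine (sqnorm f)).
  rewrite (_ : (fun n => _) = (fun n => cos c * expR (- fine (sqnorm (simple_fct (s n)))))); last first.
    by apply/funext => n; have [] := simple_charfun ipb gfN (hs n).
  apply: cvgM; first exact: cvg_cst.
  apply: (cvg_comp _ expR); last exact: continuous_expR.
  apply: cvgN; apply: cvg_sqnorm => //.
  - by move=> n; exact: (mc_simple mcV).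
  - by move=> n; exact: I_lty.
by rewrite -(cvg_lim _ c1)// (cvg_lim _ c2).
Qed.

End real_gaussian_integral.

(** * Existence of the integral *)

Section existence.
Context {R : realType} {V : nzRingType} (iota : R -> V) (b : V -> V -> R).
Hypothesis ipb : inner_product iota b.
Context {d : measure_display} {T : measurableType d} (P : probability T R)
  {d' : measure_display} {S : measurableType d'}
  (mu : {measure set S -> \bar R}).
Variable mV : set (S -> V).
Hypothesis mcV : measurable_class iota b mu mV.
Variable N : V -> set S -> T -> R.
Hypothesis gfN : gaussian_functional P mu iota b N.
Let I := real_integral N.
Let nrm := sqnorm b mu.

Let scaled a (s : seq (V * set S)) := [seq (iota a * p.1, p.2) | p <- s].

(** The transform of the integral at 1 / n is exp (- |f|^2 / n^2), which is at
    least 1 - |f|^2 / n^2. *)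
Lemma simple_second_moment s : simple_integrand mu s ->
  (\int[P]_w (I s w ^+ 2)%:E <= 2%:E * nrm (simple_fct s))%E.
Proof.
move=> hs; have [_ ls] := simple_charfun ipb gfN hs.
have nK : nrm (simple_fct s) = (fine (nrm (simple_fct s)))%:E.
  by rewrite fineK// ge0_fin_numE// (sqnorm_ge0 ipb).
rewrite nK -EFinM; apply: second_moment_le.
  exact: (measurable_real_integral gfN hs).
move=> n; pose t := scaled n.+1%:R^-1 s.
have ht : simple_integrand mu t by move=> _ /mapP[p ps ->] /=; exact: hs.
have tI w : I t w = I s w / n.+1%:R.
  rewrite /I /real_integral big_map mulrC mulr_sumr; apply: eq_bigr => p _ /=.
  exact: (gf_scale gfN).
have tf : simple_fct t = (fun x => iota n.+1%:R^-1 * simple_fct s x).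
  apply/funext => x; rewrite /simple_fct big_map mulr_sumr.
  by apply: eq_bigr => p _ /=; rewrite mulrA.
have [/(_ 0) + _] := simple_charfun ipb gfN ht; rewrite cos0 mul1r.
under eq_Rintegral do rewrite addr0 -/(I t _) tI.
move=> ->; rewrite tf -/(sqnorm b mu _) (sqnormZ ipb mcV); last exact: (mc_simple mcV).
rewrite -/nrm nK -EFinM /=; apply: le_trans (expR_ge1Dx _).
by rewrite exprVn mulrC.
Qed.

Section limit.
Variables (f : S -> V) (s : nat -> seq (V * set S)).
Hypothesis mf : mV f.
Hypothesis simple_s : forall n, simple_integrand mu (s n).
Hypothesis s_f : forall n, (nrm (fun x => (simple_fct (s n) x - f x)%R) <= (4 ^- n)%:E)%E.

Let X n := I (s n).
Let D n w := X n.+1 w - X n w.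

Let mX n : measurable_fun setT (X n).
Proof. exact: (measurable_real_integral gfN). Qed.

Let mD n : measurable_fun setT (D n).
Proof. exact: measurable_funB. Qed.

Let D_moment n : (\int[P]_w (D n w ^+ 2)%:E <= (8 * 4 ^- n)%:E)%E.
Proof.
pose t := s n.+1 ++ scaled (-1) (s n).
have ht : simple_integrand mu t.
  by move=> p; rewrite mem_cat => /orP[/simple_s//|/mapP[p' ps ->]] /=; exact: simple_s ps.
have tI w : D n w = I t w.
  rewrite /I /real_integral big_cat /= big_map; congr (_ + _).
  rewrite -[LHS]mulN1r /X /I /real_integral mulr_sumr; apply: eq_bigr => p _ /=.
  by rewrite (gf_scale gfN).
have tf : simple_fct t = (fun x => (simple_fct (s n.+1) x - f x) + - (simple_fct (s n) x - f x)).
  apply/funext => x; rewrite /simple_fct big_cat /= big_map opprB addrA subrK; congr (_ + _).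
  rewrite -(iotaN1 ipb) mulr_sumr; apply: eq_bigr => p _ /=.
  by rewrite mulrA.
have ms k : mV (fun x => simple_fct (s k) x - f x).
  by apply: (mcB ipb mcV) => //; exact: (mc_simple mcV).
have mNs : mV (fun x => - (simple_fct (s n) x - f x)).
  by have := mcZ mcV (-1) (ms n); under eq_fun do rewrite (iotaN1 ipb).
under eq_integral do rewrite tI.
apply: le_trans (simple_second_moment ht) _.
have h : (nrm (simple_fct t) <= (4 * 4 ^- n)%:E)%E.
  rewrite tf; apply: le_trans (sqnorm_young ipb mcV ltr01 (ms n.+1) mNs) _.
  rewrite (sqnorm_opp ipb).
  apply: (@le_trans _ _ ((1 + 1)%:E * (4 ^- n.+1)%:E + (1 + 1^-1)%:E * (4 ^- n)%:E)%E).
    by apply: leeD; apply: lee_wpmul2l; rewrite ?lee_fin ?addr_ge0 ?invr_ge0// -/nrm s_f.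
  have p0 : 0 < 4 ^- n :> R by rewrite invr_gt0 exprn_gt0.
  rewrite -!EFinM -EFinD lee_fin invr1 exprS invfM; lra.
apply: (@le_trans _ _ (2%:E * (4 * 4 ^- n)%:E)%E).
  by apply: lee_wpmul2l.
by rewrite -EFinM lee_fin mulrA; lra.
Qed.

Let D_abs n : (\int[P]_w (`|D n w|)%:E <= (9 * 2 ^- n)%:E)%E.
Proof.
have p0 : 0 < 2 ^- n :> R by rewrite invr_gt0 exprn_gt0.
have h w : `|D n w| <= 2 ^- n + 2 ^+ n * D n w ^+ 2.
  rewrite -[D n w ^+ 2]real_normK ?num_real//; set x := `|_|.
  have x0 : 0 <= x by exact: normr_ge0.
  have [xl|xl] := leP x (2 ^- n).
    by apply: (le_trans xl); rewrite lerDl mulr_ge0 ?exprn_ge0 ?sqr_ge0.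
  have : 1 <= 2 ^+ n * x by rewrite mulrC -ler_pdivrMr ?exprn_gt0// div1r ltW.
  move=> h1; have : x <= 2 ^+ n * x * x by rewrite ler_peMl.
  rewrite expr2 mulrA; lra.
apply: (@le_trans _ _ (\int[P]_w ((2 ^- n)%:E + (2 ^+ n)%:E * (D n w ^+ 2)%:E))%E).
  apply: ge0_le_integral => //.
  - by apply/measurable_EFinP; apply: measurableT_comp.
  - apply: emeasurable_funD => //; apply: measurable_funeM.
    by apply/measurable_EFinP; exact: measurable_funX.
  - by move=> w _; rewrite -EFinM -EFinD lee_fin.
have a1 w : setT w -> (0 <= (2 ^- n)%:E :> \bar R)%E.
  by move=> _; rewrite lee_fin ltW.
have a2 w : setT w -> (0 <= (2 ^+ n)%:E * (D n w ^+ 2)%:E)%E.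
  by move=> _; rewrite -EFinM lee_fin mulr_ge0 ?sqr_ge0 ?exprn_ge0.
have m2 : measurable_fun setT (fun w => (D n w ^+ 2)%:E).
  by apply/measurable_EFinP; exact: measurable_funX.
have m3 : measurable_fun setT (fun w => (2 ^+ n)%:E * (D n w ^+ 2)%:E)%E.
  exact: measurable_funeM.
have a3 w : setT w -> (0 <= (D n w ^+ 2)%:E)%E by move=> _; rewrite lee_fin sqr_ge0.
have a4 : 0 <= 2 ^+ n :> R by rewrite exprn_ge0.
rewrite ge0_integralD// ge0_integralZl_EFin//.
have -> : (\int[P]_w (2 ^- n)%:E = (2 ^- n)%:E)%E.
  rewrite integral_cst// [X in (_ * X)%E](_ : _ = 1%E) ?mule1//.
  exact: probability_setT.
apply: (@le_trans _ _ ((2 ^- n)%:E + (2 ^+ n)%:E * (8 * 4 ^- n)%:E)%E).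
  by apply: leeD => //; apply: lee_wpmul2l; [rewrite lee_fin exprn_ge0|exact: D_moment].
rewrite -EFinM -EFinD lee_fin (_ : 4 = 2 * 2); last by rewrite -natrM.
rewrite exprMn invfM mulrCA [2 ^+ n * _]mulrA mulfV ?expf_neq0// mul1r; lra.
Qed.

Let X_cvg : {ae P, forall w, cvgn (fun n => X n w)}.
Proof.
pose G w := (\sum_(n <oo) (`|D n w|)%:E)%E.
have mDE n : measurable_fun setT (fun w => (`|D n w|)%:E).
  by apply/measurable_EFinP; apply: measurableT_comp.
have G0 w : (0 <= G w)%E by apply: nneseries_ge0 => n _ _; rewrite lee_fin.
have iG : P.-integrable setT G.
  apply/integrableP; split.
    by apply: ge0_emeasurable_sum => // n w _ _; rewrite lee_fin.
  under eq_integral do rewrite gee0_abs//.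
  rewrite integral_nneseries//.
  apply: (@le_lt_trans _ _ 18%:E); last by rewrite ltry.
  apply: lime_le.
    by apply: is_cvg_nneseries => n _ _; apply: integral_ge0 => w _; rewrite lee_fin.
  apply: nearW => n.
  apply: (@le_trans _ _ (\sum_(0 <= k < n) (9 * 2 ^- k)%:E)%E).
    by apply: lee_sum => k _; exact: D_abs.
  rewrite sumEFin lee_fin.
  have : \sum_(0 <= k < n) (9 * 2 ^- k) = 18 * (1 - 2 ^- n) :> R.
    elim: n => [|n IH]; first by rewrite big_geq// expr0 invr1 subrr mulr0.
    by rewrite big_nat_recr//= IH exprS invfM; lra.
  move=> ->; have : 0 < 2 ^- n :> R by rewrite invr_gt0 exprn_gt0.
  lra.
apply: filterS (integrable_ae measurableT iG) => w /(_ Logic.I) Gw.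
have cS : cvgn (series (fun n => D n w)).
  apply: normed_cvg; apply: nondecreasing_is_cvgn.
    by apply: nondecreasing_series => n _ _; exact: normr_ge0.
  exists (fine (G w)) => _ [n _ <-].
  rewrite -lee_fin fineK// /series /= -sumEFin.
  by apply: nneseries_lim_ge => k _; rewrite lee_fin.
have -> : (fun n => X n w) = (fun n => X 0%N w + series (fun n => D n w) n).
  by apply/funext => n; rewrite /series /= telescope_sumr// addrC subrK.
by apply: is_cvgD => //; exact: is_cvg_cst.
Qed.

(** The second moments of the increments decay like 4^-n, hence the increments
    are almost surely summable. *)
Lemma simple_integrals_converge : exists2 Y : T -> R, measurable_fun setT Y &
  cvg_in_probability P (fun n => real_integral N (s n)) Y.
Proof.
pose Y w := fine (limn_esup (fun n => (X n w)%:E)).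
have mY : measurable_fun setT Y.
  apply: measurableT_comp; first exact: (fine_measurable measurableT).
  by apply: measurable_fun_limn_esup => n; exact/measurable_EFinP.
exists Y => //; apply: cvg_ae_in_probability => //.
apply: filterS X_cvg => w cX.
have cE : (X n w)%:E @[n --> \oo] --> (limn (fun n => X n w))%:E.
  by apply: cvg_EFin; [exact: nearW|exact: cX].
by rewrite /Y (cvg_limn_einf_sup cE).2.
Qed.

End limit.
End existence.

Section simple_approximation.
Context {R : realType} {d : measure_display} {S : measurableType d}
  (mu : {measure set S -> \bar R}).
Import HBNNSimple.

(** Only the nonzero levels of h are listed: they have finite measure, because
    f is square integrable. *)
Lemma nnsfun_simple_fct (f : S -> R) (h : {nnsfun S >-> R}) :
  measurable_fun setT f -> (\int[mu]_x (f x ^+ 2)%:E < +oo)%E ->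
  (forall x, h x <= `|f x|) ->
  exists2 s, simple_integrand mu s & forall x, simple_fct s x = h x.
Proof.
move=> mf lf hf.
pose s := [seq (y, h @^-1` [set y]) | y <- finmap.enum_fset (fset_set (range h)) & y != 0].
exists s.
  move=> p /mapP[y]; rewrite mem_filter => /andP[y0 _] ->; split => /=.
    exact: measurable_funPTI.
  have my : measurable (h @^-1` [set y]) by exact: measurable_funPTI.
  have : ((y ^+ 2)%:E * mu (h @^-1` [set y]) < +oo)%E.
    apply: le_lt_trans lf.
    rewrite -[X in (_ * mu X)%E]setIT -integral_indic// -ge0_integralZl_EFin ?sqr_ge0//.
    + apply: ge0_le_integral => //.
      * by move=> x _; rewrite mule_ge0// lee_fin ?sqr_ge0.
      * by apply: measurable_funeM; apply/measurable_EFinP; exact: measurable_indic.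
      * by apply/measurable_EFinP; exact: measurable_funX.
      * move=> x _; rewrite indicE -EFinM lee_fin; case: (boolP (x \in _)) => [|_].
          rewrite inE /= mulr1 => <-.
          by rewrite -[f x ^+ 2]real_normK ?num_real// ler_sqr ?nnegrE.
        by rewrite mulr0 sqr_ge0.
    + by apply/measurable_EFinP; exact: measurable_indic.
  have y2 : 0 < y ^+ 2 by rewrite exprn_even_gt0.
  have [->|] := eqVneq (mu (h @^-1` [set y])) +oo%E; last by move=> ? _; rewrite ltey.
  by rewrite gt0_muley ?lte_fin// ltxx.
move=> x; rewrite /simple_fct big_map big_filter nnsfun_sum.
rewrite [RHS](bigID (fun y => y != 0)) /= [X in _ + X]big1 ?addr0//.
by move=> y /negPn/eqP ->; rewrite mul0r.
Qed.

(** Positive and negative parts are approximated from below, and |f|^2 dominates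
    the squared error. *)
Lemma simple_fct_dense (f : S -> R) : measurable_fun setT f ->
  (\int[mu]_x (f x ^+ 2)%:E < +oo)%E ->
  forall e : R, 0 < e -> exists2 s, simple_integrand mu s &
    (\int[mu]_x ((simple_fct s x - f x) ^+ 2)%:E <= e%:E)%E.
Proof.
move=> mf lf e e0.
have mp : measurable_fun setT (fun x => Num.max (f x) 0) by exact: measurable_funrpos.
have mm : measurable_fun setT (fun x => Num.max (- f x) 0) by exact: measurable_funrneg.
have [fp [fp_le fp_cvg]] := nnsfun_approximation mp
  (fun x => ltac:(by rewrite le_max lexx orbT)).
have [fm [fm_le fm_cvg]] := nnsfun_approximation mm
  (fun x => ltac:(by rewrite le_max lexx orbT)).
pose g n x := fp n x - fm n x.
have g_le n x : `|g n x - f x| <= `|f x|.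
  have a0 : 0 <= fp n x by []. have b0 : 0 <= fm n x by [].
  have := fp_le n x; have := fm_le n x; rewrite /g.
  by have [f0|f0] := leP 0 (f x); rewrite ?(max_l f0) ?(max_r (ltW f0));
    [rewrite (max_r (_ : - f x <= 0)) ?oppr_le0//|rewrite (max_l (_ : 0 <= - f x)) ?oppr_ge0 ?(ltW f0)//];
    rewrite ?(ger0_norm f0) ?(ltr0_norm f0) ler_norml => h1 h2; apply/andP; split; lra.
have g_cvg x : g n x @[n --> \oo] --> f x.
  have -> : f x = Num.max (f x) 0 - Num.max (- f x) 0.
    have [f0|f0] := leP 0 (f x).
      by rewrite max_r ?subr0// oppr_le0.
    by rewrite max_l ?opprK ?add0r// oppr_ge0 ltW.
  exact: cvgB.
have mg n : measurable_fun setT (g n) by exact: measurable_funB.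
have if2 : mu.-integrable setT (fun x => (f x ^+ 2)%:E).
  apply/integrableP; split; first by apply/measurable_EFinP; exact: measurable_funX.
  by under eq_integral do rewrite /= ger0_norm ?sqr_ge0//.
have [_ _] : [/\ mu.-integrable setT (cst 0%E : S -> \bar R),
  (\int[mu]_x `|((g n x - f x) ^+ 2)%:E - cst 0%E x|)%E @[n --> \oo] --> 0%E &
  (\int[mu]_x ((g n x - f x) ^+ 2)%:E)%E @[n --> \oo] --> (\int[mu]_x (cst 0%E x : \bar R))%E].
  apply: (@dominated_convergence _ _ _ mu setT measurableT
      (fun n x => ((g n x - f x) ^+ 2)%:E) _ (fun x => (f x ^+ 2)%:E)) => //.
  - by move=> n; apply/measurable_EFinP; apply: measurable_funX; exact: measurable_funB.
  - apply: aeW => x _; apply: cvg_EFin; first exact: nearW.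
    have h : g n x - f x @[n --> \oo] --> (0 : R) by exact/subr_cvg0.
    rewrite -[X in _ --> X](mulr0 (0 : R)); under eq_fun do rewrite /= expr2.
    exact: cvgM.
  - apply: aeW => x n _ /=; rewrite lee_fin ger0_norm ?sqr_ge0//.
    rewrite -[_ ^+ 2]real_normK ?num_real// -[leRHS]real_normK ?num_real//.
    by rewrite ler_sqr ?nnegrE.
rewrite integral_cst// mul0e => /fine_cvgP[[N1 _ h1] /cvgrPdist_le/(_ _ e0)[N2 _ h2]].
pose n := maxn N1 N2.
have := h1 n (leq_maxl _ _); have := h2 n (leq_maxr _ _) => /= h2n h1n.
have fp_norm x : fp n x <= `|f x|.
  by apply: (le_trans (fp_le n x)); rewrite ge_max ler_norm normr_ge0.
have fm_norm x : fm n x <= `|f x|.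
  by apply: (le_trans (fm_le n x)); rewrite ge_max -normrN ler_norm normr_ge0.
have [s hs sE] := nnsfun_simple_fct mf lf fp_norm.
have [t ht tE] := nnsfun_simple_fct mf lf fm_norm.
exists (s ++ [seq (- p.1, p.2) | p <- t]).
  by move=> p; rewrite mem_cat => /orP[/hs//|/mapP[p' pt ->]] /=; exact: ht pt.
have -> : simple_fct (s ++ [seq (- p.1, p.2) | p <- t]) = g n.
  apply/funext => x; rewrite /simple_fct big_cat /= big_map /g -sE -tE.
  congr (_ + _); rewrite -sumrN; apply: eq_bigr => p _ /=; exact: mulNr.
rewrite -(fineK h1n) lee_fin; move: h2n; rewrite sub0r normrN; apply: le_trans.
exact: ler_norm.
Qed.

End simple_approximation.

(** * Comparison with the fractional Brownian motion *)

Section real_scalars.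
Context {R : realType}.

Lemma inner_product_real : inner_product (fun a : R => a) (fun v w : R => v * w).
Proof.
split => //.
- by move=> v w; rewrite mulrC.
- by move=> u v w; rewrite mulrDl.
- by move=> a v w; rewrite mulrA.
- by move=> v; rewrite -expr2 sqr_ge0.
- by move=> v; rewrite mulN1r.
- by move=> a c v; rewrite mulrDl.
Qed.

Lemma measurable_class_real {d : measure_display} {S : measurableType d}
    (mu : {measure set S -> \bar R}) :
  measurable_class (fun a : R => a) (fun v w : R => v * w) mu
    [set f : S -> R | measurable_fun setT f].
Proof.
split => /=.
- move=> s; elim: s => [_|p s IH hs].
    rewrite (_ : simple_fct _ = cst 0); first exact: measurable_cst.
    by apply/funext => x; rewrite /simple_fct big_nil.
  rewrite (_ : simple_fct _ = (fun x => p.1 * \1_(p.2) x) \+ simple_fct s).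
    apply: measurable_funD.
      apply: measurable_funM => //; apply: measurable_indic.
      by case: (hs p (mem_head _ _)).
    by apply: IH => q qs; apply: hs; rewrite in_cons qs orbT.
  by apply/funext => x; rewrite /simple_fct big_cons.
- by move=> f g mf mg; exact: measurable_funD.
- by move=> a f mf; exact: measurable_funM.
- by move=> f mf; exact: measurable_funM.
Qed.

End real_scalars.

Section real_measure.
Context {R : realType} {d : measure_display} {T : measurableType d}
  (P : probability T R) {d' : measure_display} {S : measurableType d'}
  (mu : {measure set S -> \bar R}) (M : set S -> T -> R).
Hypothesis grmM : gaussian_random_measure P mu M.

Let N (v : R) (A : set S) (w : T) := v * M A w.

Lemma gaussian_functional_real :
  gaussian_functional P mu (fun a : R => a) (fun v w : R => v * w) N.
Proof.
have char v A (fA : has_finite_measure mu A) := grm_char grmM fA v.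
rewrite /complex_expectation /expi /= unlock in char.
split.
- by move=> v A fA; apply: measurable_funM => //; exact: (grm_measurable grmM).
- by move=> v A fA; have := congr1 (@complex.Re R) (char v A fA); rewrite /= expr2.
- by move=> v A fA; have := congr1 (@complex.Im R) (char v A fA).
- move=> n v A fA tA B mB.
  have mv i : measurable_fun setT (fun x : R => v i * x) by exact: measurable_funM.
  have := grm_independent grmM fA tA (fun i => _ : measurable ((fun x => v i * x) @^-1` B i)).
  by apply => i; rewrite -[X in measurable X]setTI; exact: mv.
- move=> v A mA tA lA; apply: filterS (grm_sigma_additive grmM mA tA lA) => w cv.
  rewrite /N; under eq_fun do rewrite -mulr_sumr.
  by apply: cvgM => //; exact: cvg_cst.
- by move=> u v A w; rewrite /N mulrDl.
- by move=> a v A w; rewrite /N mulrA.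
Qed.

Lemma gaussian_integral_of_is_integral f Y : is_integral P mu M f Y ->
  gaussian_integral (fun v w : R => v * w) P mu
    [set f : S -> R | measurable_fun setT f] N f Y.
Proof. by move=> [mf lf mY [s [h1 h2 h3]]]; split => //; exists s; split. Qed.

Lemma is_integral_exists (f : S -> R) : measurable_fun setT f ->
  (\int[mu]_x (f x ^+ 2)%:E < +oo)%E -> exists Y, is_integral P mu M f Y.
Proof.
move=> mf lf.
have p0 n : 0 < 4 ^- n :> R by rewrite invr_gt0 exprn_gt0.
have h n := simple_fct_dense mf lf (p0 n).
have {}h n : exists s, simple_integrand mu s /\
    (\int[mu]_x ((simple_fct s x - f x) ^+ 2)%:E <= (4 ^- n)%:E)%E.
  by have [s h1 h2] := h n; exists s.
have [s hs] := choice h.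
have [Y mY cY] := simple_integrals_converge inner_product_real
  (measurable_class_real mu) gaussian_functional_real mf
  (fun n => (hs n).1) (fun n => (hs n).2).
exists Y; split => //; exists s; split => //.
  by move=> n; exact: (hs n).1.
apply: (le_cvge0 (v := fun n => (4 ^- n)%:E)).
  move=> n; rewrite (hs n).2 andbT; apply: integral_ge0 => x _.
  by rewrite lee_fin sqr_ge0.
apply: cvg_EFin; first exact: nearW.
under eq_fun do rewrite -exprVn; apply: cvg_expr.
by rewrite ger0_norm ?invr_ge0// invf_lt1// ltr1n.
Qed.

End real_measure.

Section comparison.
Context {R : realType} {p : nat} (K : padicFieldType p R) (H : R)
  {d0 : measure_display} {T0 : measurableType d0} (P0 : probability T0 R)
  (B : K -> T0 -> R).
Hypothesis fB : is_padic_fBm P0 H B.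

Let rho (t : K) := padic_abs t `^ (2 * H).

Let mB t : measurable_fun setT (B t).
Proof. by have [h _] := fBm_gaussian fB; exact: h. Qed.

Let sq (X : T0 -> R) := sqnorm (fun v w : R => v * w) P0 X.

Let sqB t s : sq (fun w => B t w - B s w) = (rho (t - s))%:E.
Proof. by have := fBm_increments fB t s; rewrite unlock => <-. Qed.

Let sqB0 t : sq (B t) = (rho t)%:E.
Proof.
rewrite -[t in RHS]subr0 -sqB; apply: ae_eq_integral => //.
- by apply/measurable_EFinP; exact: measurable_funM.
- by apply/measurable_EFinP; apply: measurable_funM; exact: measurable_funB.
- by apply: filterS (fBm0 fB) => w B0 _; rewrite B0 subr0.
Qed.

(** The variance of the combination is computed from the variances of the
    increments by polarization. *)
Lemma fBm_charfun (I : Type) (tau : I -> K) n (t : 'I_n -> I) (a : 'I_n -> R) c th :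
  \int[P0]_w cos (th * (\sum_i a i * B (tau (t i)) w) + c) =
  cos c * expR (- (th ^+ 2 * (\sum_i \sum_j a i * a j *
    ((rho (tau (t i)) + rho (tau (t j)) - rho (tau (t i) - tau (t j))) / 2)) / 2)).
Proof.
pose Z w := \sum_i a i * B (tau (t i)) w.
have mZ : measurable_fun setT Z.
  by apply: measurable_sum => i; exact: measurable_funM.
have [_ /(_ n (fun i => tau (t i)) a) gZ] := fBm_gaussian fB.
have [s hs] := centered_normal_charfun mZ gZ.
set v := \sum_i _; suff sv : s ^+ 2 = v by rewrite (hs c th) sv.
apply: (second_moment_eq (P := P0) mZ).
  move=> th'; have h := hs 0 th'; rewrite cos0 mul1r in h.
  by apply: etrans h; apply: eq_Rintegral => w _; rewrite addr0.
rewrite -[LHS]/(sq Z) /sq (sqnorm_sum inner_product_real (measurable_class_real P0) a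
  (f := fun i => B (tau (t i))) (fun i => mB _)); last first.
  by move=> i; rewrite -/(sq _) sqB0 ltry.
congr EFin; apply: eq_bigr => i _; apply: eq_bigr => j _.
by rewrite -!/(sq _) !sqB0 sqB.
Qed.

Section integrals.
Context {V : nzRingType} (iota : R -> V) (b : V -> V -> R).
Hypothesis ipb : inner_product iota b.
Context {d : measure_display} {T : measurableType d} (P : probability T R)
  {d' : measure_display} {S : measurableType d'}
  (mu : {measure set S -> \bar R}).
Variable mV : set (S -> V).
Hypothesis mcV : measurable_class iota b mu mV.
Variable N : V -> set S -> T -> R.
Hypothesis gfN : gaussian_functional P mu iota b N.

(** Every linear combination has the same transform on both sides, since its
    variance is computed by polarization from proportional data. *)
Lemma fdd_eq_fBm (I : Type) (tau : I -> K) (f : I -> S -> V) (X : I -> T -> R)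
    (C : R) :
  0 < C -> (forall i, gaussian_integral b P mu mV N (f i) (X i)) ->
  (forall i, sqnorm b mu (f i) = (C * rho (tau i))%:E) ->
  (forall i j, sqnorm b mu (fun x => (f i x - f j x)%R) =
    (C * rho (tau i - tau j))%:E) ->
  fdd_eq P X P0 (fun i w => Num.sqrt (2 * C) * B (tau i) w).
Proof.
move=> C0 gX hf hff; apply: fdd_eq_of_cos.
- by move=> i; case: (gX i).
- by move=> i; exact: measurable_funM.
move=> n t a c.
have gs := gaussian_integral_sum ipb mcV gfN a (fun i => gX (t i)).
rewrite (gaussian_integral_charfun ipb mcV gfN c gs).
have mf i : mV (f i) by case: (gX i).
have lf i : (sqnorm b mu (f i) < +oo)%E by rewrite hf ltry.
have BE w : \sum_i a i * (Num.sqrt (2 * C) * B (tau (t i)) w) =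
    Num.sqrt (2 * C) * (\sum_i a i * B (tau (t i)) w).
  by rewrite mulr_sumr; apply: eq_bigr => i _; rewrite mulrCA.
under [RHS]eq_Rintegral do rewrite BE.
rewrite fBm_charfun sqr_sqrtr; last by rewrite mulr_ge0// ltW.
rewrite (sqnorm_sum ipb mcV a (f := fun i => f (t i)))//=.
set v := \sum_i \sum_j a i * a j * ((rho _ + _ - _) / 2).
rewrite (_ : \sum_i _ = C * v); first by congr (_ * expR (- _)); field.
rewrite /v mulr_sumr; apply: eq_bigr => i _; rewrite mulr_sumr.
by apply: eq_bigr => j _; rewrite !hf hff /=; ring.
Qed.

End integrals.

Lemma real_kernel_fdd_eq (I : Type) (tau : I -> K) {d' : measure_display}
    {S : measurableType d'} (mu : {measure set S -> \bar R}) (f : I -> S -> R)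
    (C : R) {d : measure_display} {T : measurableType d} (P : probability T R)
    (M : set S -> T -> R) : 0 < C -> gaussian_random_measure P mu M ->
  (forall i, measurable_fun setT (f i)) ->
  (forall i, (\int[mu]_x (f i x ^+ 2)%:E)%E = (C * rho (tau i))%:E) ->
  (forall i j, (\int[mu]_x ((f i x - f j x) ^+ 2)%:E)%E =
    (C * rho (tau i - tau j))%:E) ->
  (forall i, exists Y, is_integral P mu M (f i) Y) /\
  (forall X, (forall i, is_integral P mu M (f i) (X i)) ->
     fdd_eq P X P0 (fun i w => Num.sqrt (2 * C) * B (tau i) w)).
Proof.
move=> C0 grmM mf hf hff; split=> [i|X hX].
  by apply: (is_integral_exists grmM) => //; rewrite hf ltry.
apply: (fdd_eq_fBm inner_product_real (measurable_class_real mu)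
  (gaussian_functional_real grmM) C0 _ hf hff) => i.
exact: (gaussian_integral_of_is_integral (hX i)).
Qed.

End comparison.

(** * Complex random measures *)

Section complex_scalars.
Import ComplexField.Normc.
Context {R : realType}.
Implicit Types z w : R[i].

Lemma Re_add z w : complex.Re (z + w) = complex.Re z + complex.Re w.
Proof. by case: z w => [? ?] [? ?]. Qed.

Lemma Im_add z w : complex.Im (z + w) = complex.Im z + complex.Im w.
Proof. by case: z w => [? ?] [? ?]. Qed.

Lemma Re_opp z : complex.Re (- z) = - complex.Re z.
Proof. by case: z. Qed.

Lemma Im_opp z : complex.Im (- z) = - complex.Im z.
Proof. by case: z. Qed.

Lemma Re_mul z w : complex.Re (z * w) =
  complex.Re z * complex.Re w - complex.Im z * complex.Im w.
Proof. by case: z w => [? ?] [? ?]. Qed.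

Lemma Im_mul z w : complex.Im (z * w) =
  complex.Re z * complex.Im w + complex.Im z * complex.Re w.
Proof. by case: z w => [? ?] [? ?]. Qed.

Lemma Re_sum (I : Type) (r : seq I) (F : I -> R[i]) :
  complex.Re (\sum_(i <- r) F i) = \sum_(i <- r) complex.Re (F i).
Proof. by elim/big_rec2: _ => //= i x y _ <-; rewrite Re_add. Qed.

Lemma Im_sum (I : Type) (r : seq I) (F : I -> R[i]) :
  complex.Im (\sum_(i <- r) F i) = \sum_(i <- r) complex.Im (F i).
Proof. by elim/big_rec2: _ => //= i x y _ <-; rewrite Im_add. Qed.

Lemma sqr_normc z : normc z ^+ 2 = complex.Re z ^+ 2 + complex.Im z ^+ 2.
Proof. by case: z => x y /=; rewrite sqr_sqrtr// addr_ge0// sqr_ge0. Qed.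

Lemma normc_nonneg z : 0 <= normc z.
Proof. by case: z => x y /=; exact: sqrtr_ge0. Qed.

Lemma norm_Re_le z : `|complex.Re z| <= normc z.
Proof.
by case: z => x y /=; rewrite -sqrtr_sqr ler_sqrt ?addr_ge0 ?sqr_ge0// lerDl sqr_ge0.
Qed.

Lemma normc_le z : normc z <= `|complex.Re z| + `|complex.Im z|.
Proof.
rewrite -(ler_pXn2r (ltn0Sn 1)) ?nnegrE ?normc_nonneg ?addr_ge0//.
rewrite sqr_normc sqrrD !real_normK ?num_real// -addrA lerD2l lerDr.
by rewrite mulrn_wge0// mulr_ge0.
Qed.

Lemma conjC_Re z : complex.Re (Num.conj z) = complex.Re z.
Proof. by case: z. Qed.

Lemma conjC_Im z : complex.Im (Num.conj z) = - complex.Im z.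
Proof. by case: z. Qed.

Definition dotc z w : R :=
  complex.Re z * complex.Re w + complex.Im z * complex.Im w.

Lemma dotcE z : dotc z z = normc z ^+ 2.
Proof. by rewrite sqr_normc !expr2. Qed.

Lemma inner_product_complex : inner_product (fun a : R => a%:C%C) dotc.
Proof.
split; rewrite /dotc.
- by move=> v w; rewrite mulrC [X in _ + X]mulrC.
- by move=> u v w; rewrite Re_add Im_add; ring.
- by move=> a v w; rewrite Re_mul Im_mul /=; ring.
- by move=> v; rewrite -!expr2 addr_ge0// sqr_ge0.
- by move=> v; rewrite (_ : (-1)%:C%C = -1) ?mulN1r//; apply/eqP; rewrite eq_complex /= oppr0 !eqxx.
- move=> a c v; rewrite -mulrDl; congr (_ * _).
  by apply/eqP; rewrite eq_complex /= addr0 !eqxx.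
Qed.

Section measurability.
Context {d : measure_display} {S : measurableType d}.

Definition complex_measurable : set (S -> R[i]) :=
  [set f | measurable_fun setT (fun x => complex.Re (f x)) /\
           measurable_fun setT (fun x => complex.Im (f x))].

Lemma complex_measurableE f :
  measurable_fun setT (fun x => complex_pair (f x)) <-> complex_measurable f.
Proof.
split=> [mf|[mr mi]].
- by split; [exact: (measurableT_comp measurable_fst mf)|
             exact: (measurableT_comp measurable_snd mf)].
- exact: measurable_fun_pair.
Qed.

Lemma complex_measurableB f g : complex_measurable f -> complex_measurable g ->
  complex_measurable (fun x => f x - g x).
Proof.
move=> [fr fi] [gr gi]; split; under eq_fun do rewrite ?Re_add ?Im_add ?Re_opp ?Im_opp.
  exact: measurable_funB.
exact: measurable_funB.
Qed.

Lemma complex_measurableM f g : complex_measurable f -> complex_measurable g ->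
  complex_measurable (fun x => f x * g x).
Proof.
move=> [fr fi] [gr gi]; split; under eq_fun do rewrite ?Re_mul ?Im_mul.
  by apply: measurable_funB; exact: measurable_funM.
by apply: measurable_funD; exact: measurable_funM.
Qed.

Lemma complex_measurable_cst c : complex_measurable (cst c).
Proof. by split; exact: measurable_cst. Qed.

Lemma measurable_normc f : complex_measurable f ->
  measurable_fun setT (fun x => normc (f x)).
Proof.
move=> [fr fi].
rewrite (_ : (fun x => _) = Num.sqrt \o (fun x => complex.Re (f x) ^+ 2 + complex.Im (f x) ^+ 2)).
  apply: measurableT_comp; first by apply: continuous_measurable_fun; exact: sqrt_continuous.
  by apply: measurable_funD; apply: measurable_funX.
by apply/funext => x /=; rewrite -sqr_normc sqrtr_sqr ger0_norm// normc_nonneg.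
Qed.

Lemma simple_fct_complex_measurable (mu : {measure set S -> \bar R}) (s : seq (R[i] * set S)) :
  simple_integrand mu s -> complex_measurable (simple_fct s).
Proof.
elim: s => [_|q s IH hs].
  rewrite (_ : simple_fct _ = cst 0); first exact: complex_measurable_cst.
  by apply/funext => x; rewrite /simple_fct big_nil.
have [h1 h2] : complex_measurable (simple_fct s).
  by apply: IH => a sa; apply: hs; rewrite in_cons sa orbT.
have mq : measurable q.2 by case: (hs q (mem_head _ _)).
have [g1 g2] : complex_measurable (fun x => q.1 * \1_(q.2) x).
  apply: complex_measurableM; first exact: complex_measurable_cst.
  split.
    rewrite (_ : (fun x => _) = \1_(q.2)); first exact: measurable_indic.
    by apply/funext => x; rewrite /indic; case: (x \in q.2).
  rewrite (_ : (fun x => _) = cst 0); first exact: measurable_cst.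
  by apply/funext => x; rewrite /indic; case: (x \in q.2).
split.
  under eq_fun do rewrite /simple_fct big_cons Re_add; exact: measurable_funD.
under eq_fun do rewrite /simple_fct big_cons Im_add; exact: measurable_funD.
Qed.

Lemma measurable_class_complex (mu : {measure set S -> \bar R}) :
  measurable_class (fun a : R => a%:C%C) dotc mu complex_measurable.
Proof.
split.
- by move=> s hs; exact: (simple_fct_complex_measurable hs).
- move=> f g [fr fi] [gr gi]; split; under eq_fun do rewrite ?Re_add ?Im_add; exact: measurable_funD.
- by move=> a f mf; apply: complex_measurableM => //; exact: complex_measurable_cst.
- by move=> f [fr fi]; apply: measurable_funD; exact: measurable_funM.
Qed.

(** Real and imaginary parts are approximated separately. *)
Lemma complex_simple_fct_dense (mu : {measure set S -> \bar R}) (f : S -> R[i]) :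
  complex_measurable f -> (\int[mu]_x (normc (f x) ^+ 2)%:E < +oo)%E ->
  forall e : R, 0 < e -> exists2 s, simple_integrand mu s &
    (\int[mu]_x (normc (simple_fct s x - f x) ^+ 2)%:E <= e%:E)%E.
Proof.
move=> [fr fi] lf e e0.
have mE (g : S -> R) : measurable_fun setT g -> measurable_fun setT (fun x => (g x ^+ 2)%:E).
  by move=> mg; apply/measurable_EFinP; exact: measurable_funX.
have lr : (\int[mu]_x (complex.Re (f x) ^+ 2)%:E < +oo)%E.
  apply: le_lt_trans lf; apply: ge0_le_integral => //.
  - by move=> x _; rewrite lee_fin sqr_ge0.
  - exact: mE.
  - by apply: mE; exact: measurable_normc.
  - by move=> x _; rewrite lee_fin sqr_normc lerDl sqr_ge0.
have li : (\int[mu]_x (complex.Im (f x) ^+ 2)%:E < +oo)%E.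
  apply: le_lt_trans lf; apply: ge0_le_integral => //.
  - by move=> x _; rewrite lee_fin sqr_ge0.
  - exact: mE.
  - by apply: mE; exact: measurable_normc.
  - by move=> x _; rewrite lee_fin sqr_normc lerDr sqr_ge0.
have e2 : 0 < e / 2 by rewrite divr_gt0.
have [s hs es] := simple_fct_dense fr lr e2.
have [s' hs' es'] := simple_fct_dense fi li e2.
exists ([seq (a.1%:C%C, a.2) | a <- s] ++ [seq ('i%C * a.1%:C%C, a.2) | a <- s']).
  by move=> a; rewrite mem_cat => /orP[] /mapP[q qs ->] /=; [exact: hs|exact: hs'].
have E x : normc (simple_fct ([seq (a.1%:C%C, a.2) | a <- s] ++
    [seq ('i%C * a.1%:C%C, a.2) | a <- s']) x - f x) ^+ 2 =
    (simple_fct s x - complex.Re (f x)) ^+ 2 + (simple_fct s' x - complex.Im (f x)) ^+ 2.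
  rewrite sqr_normc Re_add Im_add Re_opp Im_opp /simple_fct big_cat !big_map /=.
  rewrite Re_add Im_add !Re_sum !Im_sum; congr ((_ - _) ^+ 2 + (_ - _) ^+ 2).
    rewrite [X in _ + X]big1 ?addr0.
      by apply: eq_bigr => a _; rewrite /indic; case: (x \in a.2) => /=; ring.
    by move=> a _; rewrite /indic; case: (x \in a.2) => /=; ring.
  rewrite [X in X + _]big1 ?add0r.
    by apply: eq_bigr => a _; rewrite /indic; case: (x \in a.2) => /=; ring.
  by move=> a _; rewrite /indic; case: (x \in a.2) => /=; ring.
under eq_integral do rewrite E EFinD.
have msf (q : seq (R * set S)) (g : S -> R) : simple_integrand mu q -> measurable_fun setT g ->
    measurable_fun setT (fun x => ((simple_fct q x - g x) ^+ 2)%:E).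
  by move=> hq mg; apply: mE; apply: measurable_funB => //; exact: (mc_simple (measurable_class_real mu)).
rewrite ge0_integralD//; first last.
- exact: msf.
- by move=> x _; rewrite lee_fin sqr_ge0.
- exact: msf.
- by move=> x _; rewrite lee_fin sqr_ge0.
by rewrite [e]splitr EFinD; exact: leeD.
Qed.

End measurability.

End complex_scalars.

Section complex_measure.
Import ComplexField.Normc.
Context {R : realType} {d : measure_display} {T : measurableType d}
  (P : probability T R) {d' : measure_display} {S : measurableType d'}
  (mu : {measure set S -> \bar R}) (M : set S -> T -> R[i]).
Hypothesis grmM : complex_gaussian_random_measure P mu M.

Let N (u v : R[i]) (A : set S) (w : T) := complex.Re (u * v * M A w).

Let mM A : has_finite_measure mu A -> complex_measurable (M A).
Proof. by move=> /(cgrm_measurable grmM)/complex_measurableE. Qed.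

(** By isotropy, the real and the imaginary part of the integral, u = 1 and
    u = - i, are of the same type. *)
Lemma gaussian_functional_complex u : normc u = 1 ->
  gaussian_functional P mu (fun a : R => a%:C%C) dotc (N u).
Proof.
move=> u1.
have char v A (fA : has_finite_measure mu A) := cgrm_char grmM fA (Num.conj v).
rewrite /complex_expectation /expi /= unlock in char.
have nrm v : dotc v v = normc (Num.conj (u * v)) ^+ 2.
  rewrite sqr_normc conjC_Re conjC_Im sqrrN -sqr_normc normcM u1 mul1r.
  by rewrite dotcE.
split.
- move=> v A fA; apply: (complex_measurableM _ (mM fA)).1.
  exact: complex_measurable_cst.
- move=> v A fA; have := congr1 (@complex.Re R) (char (u * v) A fA).
  by rewrite /= conjCK -nrm.
- move=> v A fA; have := congr1 (@complex.Im R) (char (u * v) A fA).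
  by rewrite /= conjCK.
- move=> n v A fA tA B mB.
  pose g i (z : R * R) := complex.Re (u * v i) * z.1 - complex.Im (u * v i) * z.2.
  have mg i : measurable_fun setT (g i).
    by apply: measurable_funB; apply: measurable_funM => //.
  have mgB i : measurable (g i @^-1` B i) by rewrite -[X in measurable X]setTI; exact: mg.
  have := cgrm_independent grmM fA tA mgB.
  have E i : (fun w => complex_pair (M (A i) w)) @^-1` (g i @^-1` B i) = N u (v i) (A i) @^-1` B i.
    by apply/seteqP; split => w /=; rewrite /N Re_mul.
  under eq_bigcapr do rewrite E.
  by under eq_bigr do rewrite E.
- move=> v A mA tA lA; apply: filterS (cgrm_sigma_additive grmM mA tA lA) => w cv.
  apply/subr_cvg0/norm_cvg0P.
  apply: (squeeze_cvgr (f := fun=> 0) (h := fun n => normc (u * v) *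
      normc (\sum_(i < n) M (A i) w - M (\bigcup_i A i) w))).
  + apply: nearW => n; rewrite normr_ge0 /= -normcM mulrBr mulr_sumr.
    rewrite /N -Re_sum -Re_opp -Re_add; exact: norm_Re_le.
  + exact: cvg_cst.
  + by rewrite -(mulr0 (normc (u * v))); apply: cvgM => //; exact: cvg_cst.
- by move=> a v A w; rewrite /N mulrDr mulrDl Re_add.
- by move=> a v A w; rewrite /N mulrCA -!mulrA Re_mul; case: (u * _) => x y; exact: (etrans (congr1 (fun z => _ - z) (mul0r _)) (subr0 _)).
Qed.

Lemma Re_simple_integral u s w :
  real_integral (N u) s w = complex.Re (u * simple_integral M s w).
Proof.
rewrite /real_integral /simple_integral mulr_sumr Re_sum.
by apply: eq_bigr => a _; rewrite /N mulrA.
Qed.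

Lemma complex_measurable_simple_integral s : simple_integrand mu s ->
  complex_measurable (simple_integral M s).
Proof.
rewrite /simple_integral; elim: s => [_|q s IH hs].
  under eq_fun do rewrite big_nil; exact: complex_measurable_cst.
under eq_fun do rewrite big_cons.
have [h1 h2] := IH (fun a sa => hs a (mem_behead (s := q :: s) sa)).
have [g1 g2] := complex_measurableM (complex_measurable_cst q.1) (mM (hs q (mem_head _ _))).
split; under eq_fun do rewrite ?Re_add ?Im_add; exact: measurable_funD.
Qed.

Let mset (Z : T -> R[i]) e : complex_measurable Z -> measurable [set w | e <= normc (Z w)].
Proof.
by move=> /measurable_normc mZ; exact: measurable_superlevel.
Qed.

Lemma gaussian_integral_of_is_complex_integral f Y : is_complex_integral P mu M f Y ->
  gaussian_integral dotc P mu complex_measurable (N 1) f (fun w => complex.Re (Y w)).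
Proof.
move=> [/complex_measurableE mf lf /complex_measurableE mY [s [h1 h2 h3]]]; split => //.
- by rewrite /sqnorm; under eq_integral do rewrite dotcE.
- exact: mY.1.
exists s; split => //.
  by rewrite /sqnorm; under eq_fun do under eq_integral do rewrite dotcE.
move=> e e0; apply: le_cvge0 (h3 e e0) => n; rewrite measure_ge0 /=.
have mZ := complex_measurableB (complex_measurable_simple_integral (h1 n)) mY.
apply: le_measure; rewrite ?inE; [|exact: mset|].
  apply: measurable_superlevel; apply: measurableT_comp => //.
  have [mZr _] := mZ; rewrite (_ : (fun w => _) =
    (fun w => complex.Re (simple_integral M (s n) w - Y w)))//.
  by apply/funext => w; rewrite Re_simple_integral mul1r Re_add Re_opp.
move=> w /= /le_trans; apply; rewrite Re_simple_integral mul1r -Re_opp -Re_add.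
exact: norm_Re_le.
Qed.

Lemma is_complex_integral_exists (f : S -> R[i]) : complex_measurable f ->
  (\int[mu]_x (normc (f x) ^+ 2)%:E < +oo)%E -> exists Y, is_complex_integral P mu M f Y.
Proof.
move=> mf lf.
have p0 n : 0 < 4 ^- n :> R by rewrite invr_gt0 exprn_gt0.
have h n := complex_simple_fct_dense mf lf (p0 n).
have {}h n : exists s, simple_integrand mu s /\
    (\int[mu]_x (normc (simple_fct s x - f x) ^+ 2)%:E <= (4 ^- n)%:E)%E.
  by have [s h1 h2] := h n; exists s.
have [s hs] := choice h.
have hs' n : (sqnorm dotc mu (fun x => (simple_fct (s n) x - f x)%R) <= (4 ^- n)%:E)%E.
  by have := (hs n).2; rewrite /sqnorm; under eq_integral do rewrite -dotcE.
have n1 : normc (1 : R[i]) = 1 by rewrite normc1.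
have ni : normc (- 'i%C : R[i]) = 1 by rewrite /= oppr0 sqrrN expr0n expr1n add0r sqrtr1.
have [Yr mYr cYr] := simple_integrals_converge inner_product_complex
  (measurable_class_complex mu) (gaussian_functional_complex n1) mf
  (fun n => (hs n).1) hs'.
have [Yi mYi cYi] := simple_integrals_converge inner_product_complex
  (measurable_class_complex mu) (gaussian_functional_complex ni) mf
  (fun n => (hs n).1) hs'.
pose Y w := (Yr w +i* Yi w)%C.
have mY : complex_measurable Y by [].
exists Y; split => //; [exact/complex_measurableE|exact/complex_measurableE|].
exists s; split => //.
- by move=> n; exact: (hs n).1.
- apply: (le_cvge0 (v := fun n => (4 ^- n)%:E)).
    move=> n; rewrite (hs n).2 andbT; apply: integral_ge0 => x _.
    by rewrite lee_fin sqr_ge0.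
  apply: cvg_EFin; first exact: nearW.
  under eq_fun do rewrite -exprVn; apply: cvg_expr.
  by rewrite ger0_norm ?invr_ge0// invf_lt1// ltr1n.
move=> e e0; have e2 : 0 < e / 2 by rewrite divr_gt0.
have c0 := cvgeD (isT : ((0 : \bar R) +? (0 : \bar R))%E) (cYr _ e2) (cYi _ e2).
have {}c0 := c0 _; rewrite adde0 in c0; apply: le_cvge0 (c0 _) => n; rewrite measure_ge0 /=.
have mZ := complex_measurableB (complex_measurable_simple_integral (hs n).1) mY.
have mabs (g : T -> R) : measurable_fun setT g -> measurable [set w | e / 2 <= `|g w|].
  by move=> mg; apply: measurable_superlevel; exact: measurableT_comp.
have Er w : complex.Re (simple_integral M (s n) w - Y w) = real_integral (N 1) (s n) w - Yr w.
  by rewrite Re_simple_integral mul1r Re_add Re_opp.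
have Ei w : complex.Im (simple_integral M (s n) w - Y w) = real_integral (N (- 'i%C)) (s n) w - Yi w.
  rewrite Re_simple_integral Im_add Im_opp Re_mul /=; congr (_ - _); ring.
have mr : measurable [set w | e / 2 <= `|real_integral (N 1) (s n) w - Yr w|].
  by apply: mabs; under eq_fun do rewrite -Er; exact: mZ.1.
have mi : measurable [set w | e / 2 <= `|real_integral (N (- 'i%C)) (s n) w - Yi w|].
  by apply: mabs; under eq_fun do rewrite -Ei; exact: mZ.2.
apply: le_trans (measureU2 P mr mi).
apply: le_measure; rewrite ?inE; [exact: mset|exact: measurableU|].
move=> w /= h'; apply: contrapT => /not_orP[/negP + /negP]; rewrite -!ltNge => h1 h2.
have := le_lt_trans (le_trans h' (normc_le _)) (ltrD _ _).
rewrite Er Ei; move=> /(_ _ _ h1 h2); rewrite -splitr ltxx.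
done.
Qed.

End complex_measure.

Lemma complex_kernel_fdd_eq {R : realType} {p : nat} (K : padicFieldType p R) (H : R)
    {d0 : measure_display} {T0 : measurableType d0} (P0 : probability T0 R)
    (B : K -> T0 -> R) (fB : is_padic_fBm P0 H B)
    (I : Type) (tau : I -> K) {d' : measure_display}
    {S : measurableType d'} (mu : {measure set S -> \bar R}) (f : I -> S -> R[i])
    (C : R) {d : measure_display} {T : measurableType d} (P : probability T R)
    (M : set S -> T -> R[i]) : 0 < C -> complex_gaussian_random_measure P mu M ->
  (forall i, complex_measurable (f i)) ->
  (forall i, (\int[mu]_x (ComplexField.Normc.normc (f i x) ^+ 2)%:E)%E = 
     (C * padic_abs (tau i) `^ (2 * H))%:E) ->
  (forall i j, (\int[mu]_x (ComplexField.Normc.normc (f i x - f j x) ^+ 2)%:E)%E =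
    (C * padic_abs (tau i - tau j) `^ (2 * H))%:E) ->
  (forall i, exists Y, is_complex_integral P mu M (f i) Y) /\
  (forall Z, (forall i, is_complex_integral P mu M (f i) (Z i)) ->
     fdd_eq P (fun i w => complex.Re (Z i w)) P0
       (fun i w => Num.sqrt (2 * C) * B (tau i) w)).
Proof.
move=> C0 grmM mf hf hff; split=> [i|X hX].
  by apply: (is_complex_integral_exists grmM) => //; rewrite hf ltry.
have n1 : ComplexField.Normc.normc (1 : R[i]) = 1 by rewrite ComplexField.Normc.normc1.
apply: (fdd_eq_fBm fB inner_product_complex (measurable_class_complex mu)
  (gaussian_functional_complex grmM n1) C0 (f := f)).
- by move=> i; exact: (gaussian_integral_of_is_complex_integral grmM (hX i)).
- by move=> i; rewrite /sqnorm; under eq_integral do rewrite dotcE.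
- by move=> i j; rewrite /sqnorm; under eq_integral do rewrite dotcE.
Qed.

(** * Arithmetic of the p-adic field *)

Section padic_arithmetic.
Context {p : nat} (p_prime : prime p) {R : realType} {K : padicFieldType p R}.
Implicit Types x y z : K.

Let p_gt0 : 0 < p%:R :> R. Proof. by rewrite ltr0n prime_gt0. Qed.
Let p_gt1 : 1 < p%:R :> R. Proof. by rewrite ltr1n prime_gt1. Qed.

Lemma padic_abs_nat_gt0 n : (0 < n)%N -> padic_abs (n%:R : K) = p%:R ^- logn p n.
Proof.
move=> n0; rewrite -[n%:R]ratr_nat padic_abs_rat /rat_padic_abs pnatr_eq0 -[n == 0%N]negbK -lt0n n0 /=.
by rewrite -[n%:R : rat]/(n%:Z%:~R) numq_int denq_int /= logn1 sub0r -exprnN.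
Qed.

Lemma padic_abs0 : padic_abs (0 : K) = 0.
Proof. by rewrite -[0](ratr_nat _ 0) padic_abs_rat /rat_padic_abs eqxx. Qed.

Lemma padic_abs1 : padic_abs (1 : K) = 1.
Proof. by rewrite (padic_abs_nat_gt0 (ltn0Sn 0)) logn1 invr1. Qed.

Lemma padic_abs_gt0 x : x != 0 -> 0 < padic_abs x.
Proof.
move=> x0; rewrite lt_neqAle padic_abs_ge0 andbT; apply: contra_neq x0 => /esym.
exact: padic_abs_eq0.
Qed.

Lemma padic_absN x : padic_abs (- x) = padic_abs x.
Proof.
suff N1 : padic_abs (-1 : K) = 1 by rewrite -mulN1r padic_absM N1 mul1r.
have : padic_abs (-1 : K) ^+ 2 = 1 by rewrite expr2 -padic_absM mulrNN mulr1 padic_abs1.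
by move=> /eqP; rewrite sqrf_eq1 => /orP[/eqP//|/eqP h]; have := padic_abs_ge0 (-1 : K); rewrite h oppr_ge0 ler10.
Qed.

Lemma padic_abs_distC x y : padic_abs (x - y) = padic_abs (y - x).
Proof. by rewrite -padic_absN opprB. Qed.

Lemma padic_absV x : padic_abs x^-1 = (padic_abs x)^-1.
Proof.
have [->|x0] := eqVneq x 0; first by rewrite invr0 padic_abs0 invr0.
by apply: (mulfI (lt0r_neq0 (padic_abs_gt0 x0))); rewrite -padic_absM !divff ?padic_abs1// lt0r_neq0// padic_abs_gt0.
Qed.

Lemma padic_absX x n : padic_abs (x ^+ n) = padic_abs x ^+ n.
Proof. by elim: n => [|n IH]; rewrite ?expr0 ?padic_abs1// !exprS padic_absM IH. Qed.

Lemma padic_abs_p : padic_abs (p%:R : K) = p%:R^-1.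
Proof. by rewrite (padic_abs_nat_gt0 (prime_gt0 p_prime)) logn_prime// eqxx expr1. Qed.

Lemma padic_absB x y : padic_abs (x - y) <= Num.max (padic_abs x) (padic_abs y).
Proof. by rewrite -[padic_abs y]padic_absN; exact: padic_absD. Qed.

Lemma padic_absD_le r x y : padic_abs x <= r -> padic_abs y <= r -> padic_abs (x + y) <= r.
Proof. by move=> xr yr; rewrite (le_trans (padic_absD x y))// ge_max xr. Qed.

Lemma padic_absB_le r x y : padic_abs x <= r -> padic_abs y <= r -> padic_abs (x - y) <= r.
Proof. by move=> xr yr; apply: padic_absD_le; rewrite ?padic_absN. Qed.

(** Every triangle is isosceles. *)
Lemma padic_absD_eq x y : padic_abs y < padic_abs x -> padic_abs (x + y) = padic_abs x.
Proof.
move=> yx; apply/le_anti/andP; split; first by rewrite padic_absD_le// ltW.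
rewrite leNgt; apply/negP => h.
have := padic_absB (x + y) y; rewrite addrK le_max => /orP[] /le_lt_trans.
  by move=> /(_ _ h); rewrite ltxx.
by move=> /(_ _ yx); rewrite ltxx.
Qed.

Lemma padic_abs_close x y : padic_abs (y - x) < padic_abs x -> padic_abs y = padic_abs x.
Proof. by move=> h; rewrite -(padic_absD_eq h) addrC subrK. Qed.

(** A rational number close enough to x has the same absolute value. *)
Lemma padic_abs_value x : x != 0 -> exists k : int, padic_abs x = p%:R ^ k.
Proof.
move=> x0; have [q hq] := padic_rat_dense x _ (padic_abs_gt0 x0).
rewrite padic_abs_distC in hq; have E := padic_abs_close hq.
have : padic_abs (ratr q : K) != 0 by rewrite E lt0r_neq0// padic_abs_gt0.
rewrite -E padic_abs_rat /rat_padic_abs; case: ifP => _; first by rewrite eqxx.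
by eexists.
Qed.

Lemma padic_abs_lt1 x : x != 0 -> padic_abs x < 1 ->
  exists n : nat, padic_abs x = p%:R ^- n.+1.
Proof.
move=> x0; have [[n|n] ->] := padic_abs_value x0; last by exists n.
by rewrite -exprnP ltNge exprn_ege1// ltW.
Qed.

Lemma padic_abs_gt1 x : 1 < padic_abs x -> exists n : nat, padic_abs x = p%:R ^+ n.+1.
Proof.
move=> x1; have x0 : x != 0 by apply: contraTneq x1 => ->; rewrite padic_abs0 ltr10.
move: x1; have [[[|n]|n] ->] := padic_abs_value x0.
- by rewrite ltxx.
- by exists n.
- by rewrite ltNge invf_le1 ?exprn_gt0// exprn_ege1// ltW.
Qed.

Lemma padic_abs_nat_le (n k : nat) :
  (padic_abs (n%:R : K) <= p%:R ^- k) = (p ^ k %| n)%N.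
Proof.
have [->|n0] := posnP n; first by rewrite dvdn0 padic_abs0 invr_ge0 exprn_ge0// ltW.
rewrite padic_abs_nat_gt0// pfactor_dvdn// lef_pV2 ?posrE ?exprn_gt0//.
by rewrite ler_eXn2l.
Qed.

Lemma padic_abs_natB_le (a b k : nat) :
  (padic_abs (a%:R - b%:R : K) <= p%:R ^- k) = (a == b %[mod p ^ k]).
Proof.
wlog ab : a b / (a <= b)%N => [h|].
  have [|/ltnW] := leqP a b; first exact: h.
  by move=> /h e; rewrite padic_abs_distC e eq_sym.
by rewrite padic_abs_distC -natrB// padic_abs_nat_le eq_sym eqn_mod_dvd.
Qed.

Lemma padic_abs_nat_le1 n : padic_abs (n%:R : K) <= 1.
Proof. by have := padic_abs_nat_le n 0; rewrite expr0 invr1 dvd1n. Qed.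

Lemma padic_abs_int_le1 (z : int) : padic_abs (z%:~R : K) <= 1.
Proof. by case: z => n; rewrite ?NegzE ?mulrNz ?padic_absN; exact: padic_abs_nat_le1. Qed.

(** A rational number n / d close to x has d prime to p, hence it is congruent
    to the integer n d^-1 modulo p ^ k. *)
Lemma padic_residue k x : padic_abs x <= 1 ->
  exists2 a : nat, (a < p ^ k)%N & padic_abs (x - a%:R) <= p%:R ^- k.
Proof.
move=> x1; have pk0 : 0 < p%:R ^- k :> R by rewrite invr_gt0 exprn_gt0.
have pk1 : p%:R ^- k <= 1 :> R by rewrite invf_le1 ?exprn_gt0// exprn_ege1// ltW.
have [q /ltW hq] := padic_rat_dense x _ pk0.
have q1 : padic_abs (ratr q : K) <= 1.
  by rewrite -[ratr q](subKr x) padic_absB_le// (le_trans hq).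
have vd : logn p `|denq q| = 0%N.
  apply/eqP; rewrite -leqn0 leqNgt logn_gt0 mem_primes p_prime /=.
  apply/negP => /andP[_ pd]; have q0 : q != 0.
    by apply: contraTneq pd => ->; rewrite -[0]/(0%:~R) denq_int dvdn1 neq_ltn prime_gt1// orbT.
  have vn : logn p `|numq q| = 0%N.
    apply/eqP; rewrite -leqn0 leqNgt logn_gt0 mem_primes p_prime /=.
    apply/negP => /andP[_ pn]; have := coprime_num_den q.
    by rewrite /coprime => /eqP h; have := dvdn_gcd p `|numq q| `|denq q|; rewrite h pn pd dvdn1 => /eqP p1; have := prime_gt1 p_prime; rewrite p1.
  move: q1; rewrite padic_abs_rat /rat_padic_abs (negPf q0) vn subr0 -exprnP.
  rewrite leNgt exprn_egt1// -lt0n logn_gt0 mem_primes p_prime pd.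
  by rewrite absz_gt0 denq_neq0.
have ad : padic_abs ((denq q)%:~R : K) = 1.
  rewrite -[denq q]gtz0_abs ?denq_gt0// padic_abs_nat_gt0 ?absz_gt0 ?denq_neq0//.
  by rewrite vd expr0 invr1.
have cp : coprimez (denq q) (p ^ k)%N.
  rewrite /coprimez -[_ == _]/(coprime `|denq q| (p ^ k)) coprimeXr// coprime_sym prime_coprime//.
  apply/negP => pd; have := vd; apply/eqP; rewrite -lt0n logn_gt0 mem_primes p_prime pd.
  by rewrite absz_gt0 denq_neq0.
have [[u v] /= uv] := coprimezP _ _ cp.
pose a := (numq q * u %% (p ^ k)%N)%Z.
have pkz : (p ^ k)%N != 0 :> int by rewrite -lt0n expn_gt0 prime_gt0.
have a0 : 0 <= a by exact: modz_ge0.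
exists `|a|%N; first by rewrite -ltz_nat gez0_abs// ltz_pmod// ltz_nat expn_gt0 prime_gt0.
rewrite -(subrK (ratr q) x) -addrA; apply: padic_absD_le => //.
have d0 : (denq q)%:~R != 0 :> K.
  by apply: contra_eq_neq ad => ->; rewrite padic_abs0 eq_sym oner_eq0.
pose w := numq q * v + (numq q * u %/ (p ^ k)%N)%Z * denq q.
have -> : ratr q - `|a|%N%:R = p%:R ^+ k * w%:~R / (denq q)%:~R :> K.
  apply: (mulIf d0); rewrite mulrBl /ratr !divfK//.
  rewrite -[_%:R]/((`|a|%N : int)%:~R) gez0_abs// -intrM -intrB -natrX.
  rewrite -[(p ^ k)%:R]/((p ^ k)%N%:Z%:~R) -intrM; congr (_%:~R).
  have E := divz_eq (numq q * u) (p ^ k)%N; rewrite -/a in E.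
  rewrite /w -[X in X - _]mulr1 -uv; move: E; set A := (_ %/ _)%Z => E.
  rewrite (_ : a = numq q * u - A * (p ^ k)%N); last by rewrite E addrC addKr.
  by ring.
rewrite !padic_absM padic_absV ad invr1 mulr1 padic_absX padic_abs_p exprVn.
by apply: ler_piMr; [exact: ltW|exact: padic_abs_int_le1].
Qed.

Lemma padic_residue_unique k (a b : nat) x : (a < p ^ k)%N -> (b < p ^ k)%N ->
  padic_abs (x - a%:R) <= p%:R ^- k -> padic_abs (x - b%:R) <= p%:R ^- k -> a = b.
Proof.
move=> ak bk ha hb; apply/eqP; rewrite -(modn_small ak) -(modn_small bk).
rewrite -padic_abs_natB_le.
rewrite (_ : a%:R - b%:R = (x - b%:R) - (x - a%:R)); first exact: padic_absB_le.
by ring.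
Qed.

End padic_arithmetic.

(** * Haar measure of balls and spheres *)

Section padic_measurability.
Context {p : nat} (p_prime : prime p) {R : realType} {K : padicFieldType p R}.

Lemma padic_open_measurable (U : set K) : padic_open U ->
  measurable (U : set (padic_borel K)).
Proof. by move=> oU; apply: sub_sigma_algebra. Qed.

Lemma measurable_padic_point (x : K) : measurable ([set x] : set (padic_borel K)).
Proof.
rewrite -[X in measurable X]setCK; apply: measurableC; apply: padic_open_measurable.
move=> y /= yx; exists (padic_abs (y - x)); first by rewrite padic_abs_gt0// subr_eq0; exact/eqP.
by move=> z /[swap] /= ->; rewrite padic_abs_distC// ltxx.
Qed.

Lemma finite_set_measurable_padic (F : set K) : finite_set F ->
  measurable (F : set (padic_borel K)).
Proof.
move=> fF; rewrite (_ : F = \bigcup_(x in F) [set x]); last first.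
  by apply/seteqP; split => [x Fx|x [y Fy ->]//]; exists x.
by apply: fin_bigcup_measurable => // x _; exact: measurable_padic_point.
Qed.

(** Outside F, the preimage of any set is open. *)
Lemma measurable_locally_constant {d : measure_display} {U : measurableType d}
    (F : set K) (f : K -> U) : finite_set F ->
  (forall x, ~ F x -> exists2 e : R, 0 < e &
     forall y, padic_abs (y - x) < e -> f y = f x) ->
  measurable_fun setT (f : padic_borel K -> U).
Proof.
move=> fF hf _ A mA; rewrite setTI.
pose V := [set x : K | exists2 e : R, 0 < e & forall y, padic_abs (y - x) < e -> A (f y)].
have mV : measurable (V : set (padic_borel K)).
  apply: padic_open_measurable => x [e e0 he]; exists e => // y yx; exists e => // z zy.
  apply: he; rewrite -(subrK y z) -addrA.
  by rewrite (le_lt_trans (padic_absD _ _))// gt_max zy.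
rewrite (_ : _ @^-1` _ = (V `\` F) `|` (F `&` f @^-1` A)).
  apply: measurableU; first by apply: measurableD => //; exact: finite_set_measurable_padic.
  by apply: finite_set_measurable_padic; apply: sub_finite_set fF => x [].
apply/seteqP; split => x /=.
  move=> Ax; have [Fx|nFx] := pselect (F x); [by right|left; split => //].
  by have [e e0 he] := hf _ nFx; exists e => // y /he ->.
by case=> [[[e e0 he] _]|[]//]; apply: he; rewrite subrr padic_abs0.
Qed.

Lemma measurable_padic_abs : measurable_fun setT (padic_abs : padic_borel K -> R).
Proof.
apply: (measurable_locally_constant (F := [set 0])) => // x /= /eqP x0.
by exists (padic_abs x); [exact: padic_abs_gt0|move=> y /padic_abs_close].
Qed.

Lemma measurable_padic_abs_set (A : set R) : measurable A ->
  measurable ([set x : K | A (padic_abs x)] : set (padic_borel K)).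
Proof. by move=> mA; rewrite -[X in measurable X]setTI; exact: measurable_padic_abs. Qed.

Lemma measurable_padic_translation (t : K) :
  measurable_fun setT ((fun x => x + t) : padic_borel K -> padic_borel K).
Proof.
have := @measurability _ _ (padic_borel K) (padic_borel K) setT (fun x => x + t)
  (@padic_open _ _ K) erefl.
apply => _ [U oU <-]; rewrite setTI.
apply: padic_open_measurable => x Ux; have [e e0 he] := oU _ Ux; exists e => // y yx.
by apply: he; rewrite opprD addrACA subrr addr0.
Qed.

End padic_measurability.

Section haar.
Context {p : nat} (p_prime : prime p) {R : realType} {K : padicFieldType p R}
  (m : {measure set (padic_borel K) -> \bar R}) (m_haar : is_haar m).

Let p_gt0 : 0 < p%:R :> R. Proof. by rewrite ltr0n prime_gt0. Qed.
Let p_gt1 : 1 < p%:R :> R. Proof. by rewrite ltr1n prime_gt1. Qed.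

Lemma haar_preimage (t : K) (A : set (padic_borel K)) : measurable A ->
  m [set x : K | A (x + t)] = m A.
Proof.
move=> mA; rewrite -[RHS](haar_translation m_haar (- t) mA); congr (m _).
apply/seteqP; split => x /=; first by move=> h; exists (x + t); rewrite ?addrK.
by move=> [y Ay <-]; rewrite subrK.
Qed.

Lemma haar_integral_translation (t : K) (f : padic_borel K -> \bar R) :
  measurable_fun setT f -> (forall x, 0 <= f x)%E ->
  (\int[m]_x f (x + t)%R = \int[m]_x f x)%E.
Proof.
move=> mf f0.
have mt := measurable_padic_translation t.
have := ge0_integral_pushforward mt m measurableT mf (fun x _ => f0 x).
rewrite preimage_setT => <-; apply: eq_measure_integral => A mA _.
exact: haar_preimage.
Qed.

Local Notation closed_ball r := [set x : K | (padic_abs x <= r)%R].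

Lemma measurable_closed_ball r : measurable (closed_ball r : set (padic_borel K)).
Proof.
rewrite (_ : closed_ball r = [set x : K | `]-oo, r]%classic (padic_abs x)]).
  exact: measurable_padic_abs_set.
by apply/seteqP; split => x; rewrite /= in_itv.
Qed.

(** The ball of radius |v| is the disjoint union of the p ^ i cosets a v + z,
    with |z| <= |v| p^-i, which all have the same measure. *)
Lemma haar_integral_coset (v : K) (i : nat) (f : padic_borel K -> \bar R) : v != 0 ->
  measurable_fun setT f -> (forall x, 0 <= f x)%E ->
  (forall x z : K, padic_abs z <= padic_abs v * p%:R ^- i -> f (x + z) = f x) ->
  (\int[m]_(x in [set x : K | (padic_abs x <= padic_abs v)%R]) f x =
   (\sum_(0 <= a < p ^ i) f (a%:R * v)%R) *
     m [set x : K | (padic_abs x <= padic_abs v * p%:R ^- i)%R])%E.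
Proof.
move=> v0 mf f0 fz; set r := padic_abs v * _.
have v1 := padic_abs_gt0 v0.
pose C (a : nat) := [set x : padic_borel K | padic_abs (x - a%:R * v : K) <= r].
have mball := measurable_closed_ball r.
have mC a : measurable (C a).
  have := measurable_padic_translation (- (a%:R * v)) measurableT mball.
  by rewrite setTI.
have -> : [set x : K | padic_abs x <= padic_abs v] = \big[setU/set0]_(a <- index_iota 0 (p ^ i)) C a.
  apply/seteqP; split => x /=.
    move=> xv; have [|a ai ha] := padic_residue p_prime i (x := x / v).
      by rewrite padic_absM padic_absV// ler_pdivrMr// mul1r.
    rewrite -bigcup_seq; exists a => /=; first by rewrite mem_index_iota.
    rewrite /C /= (_ : x - _ = (x / v - a%:R) * v); last by field.
    by rewrite padic_absM /r mulrC ler_pM2l.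
  rewrite -bigcup_seq => -[a /= _ Ca]; rewrite -(subrK (a%:R * v) x).
  apply: padic_absD_le; first by apply: le_trans Ca _; rewrite /r ler_piMr ?padic_abs_ge0// invf_le1 ?exprn_gt0// exprn_ege1// ltW.
  rewrite padic_absM ler_piMl ?padic_abs_ge0//; exact: padic_abs_nat_le1.
rewrite ge0_integral_bigsetU//; first last.
- by apply: (measurable_funS measurableT).
- move=> a b /=; rewrite !mem_index_iota /= => ai bi [x [/= xa xb]].
  apply: (padic_residue_unique p_prime ai bi (x := x / v)).
    rewrite (_ : x / v - _ = (x - a%:R * v) / v); last by field.
    by rewrite padic_absM padic_absV ler_pdivrMr// [X in _ <= X]mulrC.
  rewrite (_ : x / v - _ = (x - b%:R * v) / v); last by field.
  by rewrite padic_absM padic_absV ler_pdivrMr// [X in _ <= X]mulrC.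
- exact: iota_uniq.
rewrite ge0_sume_distrl//; apply: eq_bigr => a _.
transitivity (\int[m]_(x in C a) cst (f (a%:R * v)%R) x)%E.
  apply: eq_integral => x; rewrite inE => xa /=.
  by rewrite -[RHS](fz _ _ xa) [in RHS]addrC subrK.
rewrite integral_cst//; congr (_ * _)%E.
exact: (haar_preimage (- (a%:R * v)) mball).
Qed.

Lemma haar_ball_div (v : K) i : v != 0 -> m (closed_ball (padic_abs v)) =
  ((p%:R ^+ i)%:E * m (closed_ball (padic_abs v * p%:R ^- i)))%E.
Proof.
move=> v0; have := haar_integral_coset (i := i) (f := cst 1%E) v0 (measurable_cst _)
  (fun=> lee01) (fun _ _ _ => erefl).
rewrite integral_cst; last exact: measurable_closed_ball.
rewrite mul1e => ->; congr (_ * _)%E.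
by rewrite sumEFin big_const_nat iter_addr_0 subn0 natrX.
Qed.

(** Counting cosets compares any ball with the ball of p-adic integers. *)
Lemma haar_ball (u : K) : u != 0 -> m (closed_ball (padic_abs u)) = (padic_abs u)%:E.
Proof.
move=> u0.
have m1 : m (closed_ball 1) = 1%E := haar_padic_int m_haar.
have [lt1|gt1|->//] := ltgtP (padic_abs u) 1.
  have [n ->] := padic_abs_lt1 p_prime u0 lt1.
  have := haar_ball_div n.+1 (oner_neq0 K); rewrite padic_abs1 mul1r m1 => e.
  have pn : p%:R ^+ n.+1 != 0 :> R by rewrite expf_neq0// lt0r_neq0.
  by rewrite -[LHS]mul1e -[X in (X%:E * _)%E](mulVf pn) EFinM -muleA -e mule1.
have [n e] := padic_abs_gt1 p_prime gt1.
by rewrite (haar_ball_div n.+1 u0) e divff ?m1 ?mule1// expf_neq0// lt0r_neq0.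
Qed.

Lemma haar_sphere (u : K) : u != 0 ->
  m [set x : K | padic_abs x = padic_abs u] = (padic_abs u * (1 - p%:R^-1))%:E.
Proof.
move=> u0; have up : padic_abs u / p%:R = padic_abs (u * p%:R) by rewrite padic_absM padic_abs_p.
have pK : (p%:R : K) != 0.
  by apply/eqP => h; have := padic_abs_p p_prime (K := K); rewrite h padic_abs0 => /esym/eqP; rewrite invr_eq0 gt_eqF.
have -> : [set x : K | padic_abs x = padic_abs u] =
    closed_ball (padic_abs u) `\` closed_ball (padic_abs u / p%:R).
  apply/seteqP; split => x /=.
    rewrite /= => ->; split => //; apply/negP; rewrite -ltNge ltr_pdivrMr// ltr_pMr// padic_abs_gt0//.
  move=> [xu /negP]; rewrite -ltNge => ux; apply/eqP; rewrite eq_le xu /= leNgt.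
  apply/negP => xu'; have x0 : x != 0.
    by apply: contraTneq ux => ->; rewrite padic_abs0 -leNgt divr_ge0 ?padic_abs_ge0// ltW.
  have [|n] := padic_abs_lt1 p_prime (x := x / u) (mulf_neq0 x0 (invr_neq0 u0)).
    by rewrite padic_absM padic_absV ltr_pdivrMr ?padic_abs_gt0// mul1r.
  rewrite padic_absM padic_absV => e.
  have : padic_abs x <= padic_abs u / p%:R.
    rewrite -ler_pdivrMl ?padic_abs_gt0// mulrC e exprS invfM ler_piMr// ?invr_ge0 ?(ltW p_gt0)//.
    by rewrite invf_le1 ?exprn_gt0// exprn_ege1// ltW.
  by move=> /(lt_le_trans ux); rewrite ltxx.
rewrite measureD ?setIidr; first last.
- by rewrite [X in (X < _)%E](haar_ball u0) ltry.
- exact: measurable_closed_ball.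
- exact: measurable_closed_ball.
- by move=> x /= /le_trans; apply; rewrite ler_pdivrMr// ler_peMr ?padic_abs_ge0// ltW.
rewrite up [X in (X - _)%E](haar_ball u0) [X in (_ - X)%E]haar_ball ?mulf_neq0//.
by rewrite -EFinB -up mulrBr mulr1.
Qed.

(** A point is contained in balls of radius p^-n. *)
Lemma haar_point (x : K) : m [set x] = 0%E.
Proof.
have -> : m [set x] = m [set 0 : K].
  rewrite -(haar_preimage (- x) (measurable_padic_point 0)); congr (m _).
  by apply/seteqP; split => y /=; [move=> ->; rewrite subrr|move/eqP; rewrite subr_eq0 => /eqP].
apply/le_anti; rewrite measure_ge0 andbT; apply/lee_addgt0Pr => e e0; rewrite add0e.
have [n hn] : exists n : nat, p%:R ^- n < e.
  have p1 : `|p%:R^-1 : R| < 1 by rewrite ger0_norm ?invf_lt1// invr_ge0 ltW.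
  have /cvgrPdist_lt/(_ e e0) [n _ hn] := cvg_expr p1.
  exists n; have := hn n (leqnn n); rewrite /= sub0r normrN exprVn ger0_norm// invr_ge0 exprn_ge0// ltW.
have pn : p%:R ^- n = padic_abs (p%:R ^+ n : K) by rewrite padic_absX padic_abs_p// exprVn.
have pn0 : (p%:R ^+ n : K) != 0.
  apply/eqP => h; have : 0 < p%:R ^- n :> R by rewrite invr_gt0 exprn_gt0.
  by rewrite pn h padic_abs0 ltxx.
apply: (@le_trans _ _ (m (closed_ball (p%:R ^- n)))).
  apply: le_measure; rewrite ?inE; [exact: measurable_padic_point|exact: measurable_closed_ball|].
  by move=> _ ->; rewrite /= padic_abs0 invr_ge0 exprn_ge0// ltW.
by rewrite pn haar_ball// -pn lee_fin ltW.
Qed.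

Lemma haar_ae_eq (F : set K) (f g : padic_borel K -> \bar R) : finite_set F ->
  measurable_fun setT f -> measurable_fun setT g ->
  (forall x, ~ F x -> f x = g x) -> (\int[m]_x f x = \int[m]_x g x)%E.
Proof.
move=> fF mf mg fg; apply: ae_eq_integral => //.
exists F; split.
- exact: finite_set_measurable_padic.
- have -> : F = \bigcup_(x in F) [set x] by apply/seteqP; split => [x Fx|x [y Fy ->]//]; exists x.
  have /finite_seqP[s ->] := fF.
  rewrite bigcup_seq; apply/eqP; rewrite eq_le measure_ge0 andbT.
  elim: s => [|x s IH]; first by rewrite big_nil measure0.
  rewrite big_cons (le_trans (measureU2 _ _ _))//.
  + exact: measurable_padic_point.
  + by apply: bigsetU_measurable => y _; exact: measurable_padic_point.
  + by rewrite [X in (X + _)%E](haar_point x) add0e.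
- by move=> x /= h; apply: contrapT => nF; apply: h => _; exact: fg.
Qed.

Lemma measurable_sphere (r : R) : measurable ([set x : K | padic_abs x = r] : set (padic_borel K)).
Proof. exact: (measurable_padic_abs_set (measurable_set1 r)). Qed.

Lemma padic_exp_inj (r : R) (i j : nat) : 0 < r -> r * p%:R ^+ i.+1 = r * p%:R ^+ j.+1 -> i = j.
Proof.
move=> r0 /(mulfI (lt0r_neq0 r0))/eqP; rewrite eq_le !ler_eXn2l// !ltnS -eqn_leq => /eqP.
exact.
Qed.

Lemma haar_integral_spheres (r : nat -> R) (f : padic_borel K -> \bar R) :
  injective r -> measurable_fun setT f -> (forall x, 0 <= f x)%E ->
  (forall x : K, f x != 0%E -> exists n, padic_abs x = r n) ->
  (\int[m]_x f x =
   \sum_(0 <= n <oo) \int[m]_(x in [set x : K | padic_abs x = r n]) f x)%E.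
Proof.
move=> ri mf f0 fr; rewrite -ge0_integral_bigcup//.
- rewrite [RHS]integral_mkcond; apply: eq_integral => x _; rewrite patchE.
  case: ifPn => // /negP xF; apply/eqP/negP => /negP fx; apply: xF; rewrite inE.
  by have [n e] := fr _ fx; exists n.
- by move=> n; exact: measurable_sphere.
- by apply: (measurable_funS measurableT).
- by move=> i j _ _ [x [/= e1 e2]]; apply: ri; rewrite -e1.
Qed.

End haar.

(** * The additive character *)

Section roots_of_unity.
Context {R : realType}.

Lemma expiD (a b : R) : expi (a + b) = expi a * expi b.
Proof.
apply/eqP; rewrite eq_complex; apply/andP; split; apply/eqP.
  by rewrite Re_mul /= cosD.
by rewrite Im_mul /= sinD addrC [X in _ + X]mulrC [X in X + _]mulrC; ring.
Qed.

Lemma expi0 : expi (0 : R) = 1.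
Proof. by rewrite /expi cos0 sin0. Qed.

Lemma expi_2pi_nat (n : nat) : expi (2 * pi * n%:R : R) = 1.
Proof.
elim: n => [|n IH]; first by rewrite mulr0 expi0.
rewrite (_ : _ * _ = 2 * pi * n%:R + pi *+ 2); last by rewrite -(natr1 n) -(mulr_natl pi 2); ring.
by rewrite expiD IH mul1r /expi cos2pi sin2pi.
Qed.

Lemma normc_expi (a : R) : ComplexField.Normc.normc (expi a) = 1.
Proof. by rewrite /expi /= cos2Dsin2 sqrtr1. Qed.

End roots_of_unity.

Section character.
Context {p : nat} (p_prime : prime p) {R : realType} {K : padicFieldType p R}.
Implicit Types x y z : K.

Let p_gt0 : 0 < p%:R :> R. Proof. by rewrite ltr0n prime_gt0. Qed.
Let p_gt1 : 1 < p%:R :> R. Proof. by rewrite ltr1n prime_gt1. Qed.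
Let pn0 n : p%:R ^+ n != 0 :> R. Proof. by rewrite expf_neq0// gt_eqF. Qed.

Lemma padic_p_neq0 : (p%:R : K) != 0.
Proof.
apply/eqP => h; have := padic_abs_p p_prime (K := K).
by rewrite h padic_abs0 => /esym/eqP; rewrite invr_eq0 gt_eqF.
Qed.

Let pK0 n : p%:R ^+ n != 0 :> K. Proof. by rewrite expf_neq0// padic_p_neq0. Qed.

Let abs_pX n : padic_abs (p%:R ^+ n : K) = p%:R ^- n.
Proof. by rewrite padic_absX padic_abs_p// exprVn. Qed.

Let root (k n : nat) : R[i] := expi (2 * pi * n%:R / p%:R ^+ k).

Let root_mod k n : root k n = root k (n %% p ^ k).
Proof.
rewrite /root {1}(divn_eq n (p ^ k)) natrD natrM natrX.
set q := (n %/ _)%:R; set r := (_ %% _)%:R.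
rewrite (_ : _ / _ = 2 * pi * q + 2 * pi * r / p%:R ^+ k); last by field.
by rewrite expiD expi_2pi_nat mul1r.
Qed.

Let root_scale k j n : root (k + j) (n * p ^ j) = root k n.
Proof. by rewrite /root natrM natrX exprD; congr expi; field; rewrite !pn0. Qed.

Let root_close (a j n k : nat) :
  padic_abs (a%:R / p%:R ^+ j - n%:R / p%:R ^+ k : K) <= 1 -> root j a = root k n.
Proof.
move=> h; rewrite -(root_scale j k) -(root_scale k j) addnC.
rewrite root_mod [RHS]root_mod; congr root; apply/eqP.
rewrite -(padic_abs_natB_le p_prime (K := K)).
have -> : (a * p ^ k)%:R - (n * p ^ j)%:R =
    (a%:R / p%:R ^+ j - n%:R / p%:R ^+ k) * p%:R ^+ (k + j) :> K.
  by rewrite !natrM !natrX exprD; field; rewrite !pK0.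
by rewrite padic_absM abs_pX ler_piMl// invr_ge0 exprn_ge0// ltW.
Qed.

(** The value of the character at x depends on any fraction n / p ^ k
    approximating x up to p-adic integers; additivity follows. *)
Lemma padic_char_approx x (n k : nat) :
  padic_abs (x - n%:R / p%:R ^+ k) <= 1 ->
  padic_char x = expi (2 * pi * n%:R / p%:R ^+ k).
Proof.
move=> xn; rewrite /padic_char; case: ifPn => [x1|].
  rewrite -[RHS]/(root k n) -(@root_close 0 0 n k).
    by rewrite /root mulr0 mul0r expi0.
  by rewrite mul0r -[X in X - _](subrr x) -addrA addrCA addrC padic_absB_le.
rewrite -ltNge => x1; case: xgetP => [j _ /= xj|]; last first.
  have [j xj] := padic_abs_gt1 p_prime x1.
  by move=> /(_ j.+1) /=; rewrite xj.
rewrite /padic_mod; case: xgetP => [a _ /= [aj ha]|].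
  apply: root_close.
  rewrite (_ : _ - _ = (x - n%:R / p%:R ^+ k) - (p%:R ^+ j * x - a%:R) / p%:R ^+ j).
    apply: padic_absB_le => //; rewrite padic_absM padic_absV abs_pX invrK.
    by rewrite -ler_pdivlMr ?exprn_gt0// mul1r.
  have := pK0 j; have := pK0 k; set Pj := _ ^+ j; set Pk := _ ^+ k => Pk0 Pj0.
  clearbody Pj Pk; field; rewrite ?Pk0 ?Pj0//.
have [|a aj ha] := padic_residue p_prime j (x := p%:R ^+ j * x).
  by rewrite padic_absM abs_pX xj mulVf.
by move=> /(_ a) /=; case.
Qed.

Lemma padic_frac_approx x : exists n k : nat, padic_abs (x - n%:R / p%:R ^+ k) <= 1.
Proof.
have [x1|] := leP (padic_abs x) 1; first by exists 0%N, 0%N; rewrite mul0r subr0.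
move=> /(padic_abs_gt1 p_prime)[k xk].
have [|a _ ha] := padic_residue p_prime k.+1 (x := p%:R ^+ k.+1 * x).
  by rewrite padic_absM abs_pX xk mulVf.
exists a, k.+1; rewrite (_ : x - _ = (p%:R ^+ k.+1 * x - a%:R) / p%:R ^+ k.+1); last by field.
by rewrite padic_absM padic_absV abs_pX invrK -ler_pdivlMr ?exprn_gt0// mul1r.
Qed.

Lemma padic_charD x y : padic_char (x + y) = padic_char x * padic_char y.
Proof.
have [n [k xn]] := padic_frac_approx x; have [n' [k' yn]] := padic_frac_approx y.
rewrite (padic_char_approx xn) (padic_char_approx yn) -expiD.
rewrite (@padic_char_approx _ (n * p ^ k' + n' * p ^ k) (k + k')).
  by congr expi; rewrite natrD !natrM !natrX exprD; field; rewrite !pn0.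
rewrite (_ : _ - _ = (x - n%:R / p%:R ^+ k) + (y - n'%:R / p%:R ^+ k')).
  exact: padic_absD_le.
by rewrite natrD !natrM !natrX exprD; field; rewrite !pK0.
Qed.

Lemma padic_char_int x : padic_abs x <= 1 -> padic_char x = 1.
Proof. by rewrite /padic_char => ->. Qed.

Lemma normc_padic_char x : ComplexField.Normc.normc (padic_char x) = 1.
Proof. by have [n [k /padic_char_approx ->]] := padic_frac_approx x; exact: normc_expi. Qed.

Lemma normc_padic_charB x y : ComplexField.Normc.normc (padic_char x - padic_char y) =
  ComplexField.Normc.normc (padic_char (x - y) - 1).
Proof.
have -> : padic_char x - padic_char y = (padic_char (x - y) - 1) * padic_char y.
  by rewrite mulrBl mul1r -padic_charD subrK.
by rewrite ComplexField.Normc.normcM normc_padic_char mulr1.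
Qed.

End character.

(** * The moving average kernel *)

Lemma nneseries_geometric_bound {R : realType} (u : nat -> R) (c q : R) :
  0 <= q -> q < 1 -> 0 < u 0%N -> (forall n, 0 <= u n <= c * q ^+ n) ->
  exists2 C : R, 0 < C & (\sum_(0 <= n <oo) (u n)%:E = C%:E)%E.
Proof.
move=> q0 q1 u0 hu.
have un n : (0 <= (u n)%:E)%E by rewrite lee_fin; case/andP: (hu n).
have c0 : 0 <= c by have /andP[h1 h2] := hu 0%N; rewrite expr0 mulr1 in h2; exact: le_trans h2.
have ge : ((u 0%N)%:E <= \sum_(0 <= n <oo) (u n)%:E)%E.
  by apply: le_trans (nneseries_lim_ge 1 (fun n _ _ => un n)); rewrite big_nat1.
have le : (\sum_(0 <= n <oo) (u n)%:E <= (c / (1 - q))%:E)%E.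
  apply: lime_le; first exact: is_cvg_nneseries.
  apply: nearW => n; rewrite sumEFin lee_fin.
  have q10 : 0 < 1 - q by rewrite subr_gt0.
  rewrite ler_pdivlMr//.
  suff : (\sum_(0 <= i < n) u i) * (1 - q) <= c * (1 - q ^+ n).
    by move=> /le_trans; apply; rewrite ler_piMr// gerBl exprn_ge0.
  elim: n => [|n IH]; first by rewrite big_geq// mul0r expr0 subrr mulr0.
  rewrite big_nat_recr//= mulrDl; have /andP[_ h] := hu n.
  have := ler_wpM2r (ltW q10) h; rewrite exprS; move: IH.
  by set s := \sum_(0 <= _ < _) _; set t := q ^+ n; nra.
exists (fine (\sum_(0 <= n <oo) (u n)%:E)%E).
  apply: fine_gt0; apply/andP; split; first by apply: lt_le_trans ge; rewrite lte_fin.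
  by rewrite (le_lt_trans le)// ltry.
rewrite fineK// ge0_fin_numE ?(le_lt_trans le) ?ltry//.
by rewrite (le_trans _ ge)// un.
Qed.

Section moving_average.
Context {p : nat} (p_prime : prime p) {R : realType} {K : padicFieldType p R}
  (m : {measure set (padic_borel K) -> \bar R}) (m_haar : is_haar m)
  (H : R) (H_gt0 : 0 < H).

Let p_gt0 : 0 < p%:R :> R. Proof. by rewrite ltr0n prime_gt0. Qed.
Let p_gt1 : 1 < p%:R :> R. Proof. by rewrite ltr1n prime_gt1. Qed.

Let a := H - 2^-1.

Let phi (r : R) : R := if H == 2^-1 then ln r else r `^ a.

(* The additive shift of the logarithm cancels in differences, so that both
   cases scale with the exponent a. *)
Let phi_scale r s : 0 < r -> 0 < s -> phi (r * s) - phi r = r `^ a * (phi s - phi 1).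
Proof.
move=> r0 s0; rewrite /phi; case: ifPn => [/eqP h|_].
  by rewrite /a h subrr powRr0 mul1r lnM ?posrE// ln1 subr0 addrC addKr.
by rewrite powRM ?ltW// powR1 mulrBr mulr1.
Qed.

Let powR_2H r : 0 < r -> (r `^ a) ^+ 2 * r = r `^ (2 * H).
Proof.
move=> r0; rewrite -powR_mulrn ?powR_ge0// -powRrM -{2}[r]powRr1 ?ltW// -powRD.
  by congr (_ `^ _); rewrite /a; field.
by apply/implyP => _; rewrite gt_eqF.
Qed.

Lemma measurable_of_padic_abs (h : R -> R) :
  measurable_fun setT ((fun x : K => h (padic_abs x)) : padic_borel K -> R).
Proof.
apply: (measurable_locally_constant (F := [set 0])) => // x /= /eqP x0.
by exists (padic_abs x); [exact: padic_abs_gt0|move=> y /padic_abs_close ->].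
Qed.

(* The squared difference of the kernels, near one of the two singularities. *)
Let g (r : R) (x : K) : R :=
  if (0 < padic_abs x) && (padic_abs x < r) then (phi (padic_abs x) - phi r) ^+ 2 else 0.

Let mg r : measurable_fun setT (g r : padic_borel K -> R).
Proof.
exact: (@measurable_of_padic_abs (fun s => if (0 < s) && (s < r) then (phi s - phi r) ^+ 2 else 0)).
Qed.

Let g_ge0 r x : 0 <= g r x.
Proof. by rewrite /g; case: ifP => // _; exact: sqr_ge0. Qed.

Let Q (n : nat) : R := (phi (p%:R ^- n.+1) - phi 1) ^+ 2 * (p%:R ^- n.+1 * (1 - p%:R^-1)).

Let integral_g (u : K) : u != 0 -> (\int[m]_x (g (padic_abs u) x)%:E =
  \sum_(0 <= n <oo) (padic_abs u `^ (2 * H) * Q n)%:E)%E.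
Proof.
move=> u0; have u1 := padic_abs_gt0 u0.
have pn0 n : 0 < p%:R ^- n :> R by rewrite invr_gt0 exprn_gt0.
have pn1 n : p%:R ^- n.+1 < 1 :> R by rewrite invf_lt1 ?exprn_gt0// exprn_egt1.
rewrite (haar_integral_spheres m (r := fun n => padic_abs u * p%:R ^- n.+1)).
- apply: eq_eseriesr => n _.
  transitivity (\int[m]_(x in [set x : K | padic_abs x = (padic_abs u * p%:R ^- n.+1)%R])
    cst ((phi (padic_abs u * p%:R ^- n.+1) - phi (padic_abs u)) ^+ 2)%R%:E x)%E.
    apply: eq_integral => x; rewrite inE /= => xn.
    by rewrite /g xn mulr_gt0// gtr_pMr// pn1.
  rewrite integral_cst; last exact: measurable_sphere.
  have e : padic_abs u * p%:R ^- n.+1 = padic_abs (u * p%:R ^+ n.+1).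
    by rewrite padic_absM padic_absX padic_abs_p// exprVn.
  rewrite [in X in (_ * X)%E]e (haar_sphere p_prime m_haar) ?mulf_neq0 ?expf_neq0 ?padic_p_neq0// -e.
  rewrite -EFinM phi_scale// exprMn -powR_2H// /Q; congr EFin; ring.
- move=> i j /(mulfI (lt0r_neq0 u1)) /eqP; rewrite (inj_eq invr_inj) eq_le !ler_eXn2l//.
  by rewrite !ltnS -eqn_leq => /eqP.
- by apply/measurable_EFinP; exact: mg.
- by move=> x; rewrite lee_fin g_ge0.
move=> x; rewrite /g; case: ifPn; rewrite ?eqxx// => /andP[x0 xu] _.
have x0' : x != 0 by apply: contraTneq x0 => ->; rewrite padic_abs0 ltxx.
have [|n] := padic_abs_lt1 p_prime (x := x / u) (mulf_neq0 x0' (invr_neq0 u0)).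
  by rewrite padic_absM padic_absV ltr_pdivrMr// mul1r.
by rewrite padic_absM padic_absV => e; exists n; rewrite -e mulrC divfK// gt_eqF.
Qed.

Let sq_split (x t s : K) : x != t -> x != s -> t != s ->
  (phi (padic_abs (t - x)) - phi (padic_abs (s - x))) ^+ 2 =
  g (padic_abs (t - s)) (x - s) + g (padic_abs (t - s)) (x - t).
Proof.
rewrite -(subr_eq0 x t) -(subr_eq0 x s) -(subr_eq0 t s) => xt xs ts.
rewrite (padic_abs_distC t x) (padic_abs_distC s x).
have e : x - t = (x - s) - (t - s) by rewrite opprB addrA subrK.
rewrite e in xt *; move: (x - s) (t - s) xs ts xt => y u y0 u0 z0.
rewrite /g !padic_abs_gt0//=.
have [yu|uy|yu] := ltgtP (padic_abs y) (padic_abs u).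
- have -> : padic_abs (y - u) = padic_abs u.
    by rewrite padic_abs_distC padic_absD_eq// padic_absN.
  by rewrite ltxx addr0 -sqrrN opprB.
- have -> : padic_abs (y - u) = padic_abs y by rewrite padic_absD_eq// padic_absN.
  by rewrite ltNge (ltW uy) /= subrr expr0n add0r.
have : padic_abs (y - u) <= padic_abs u by rewrite padic_absB_le// yu.
rewrite le_eqVlt yu => /orP[/eqP ->|->]; first by rewrite ltxx subrr expr0n add0r.
by rewrite add0r.
Qed.

Let phi_bound : exists c d : R, 0 < d /\ forall x, 0 < x -> x <= 1 ->
  (phi x - phi 1) ^+ 2 * x <= c * x `^ d.
Proof.
rewrite /phi; case: ifPn => [_|Hn].
  (* - ln x is at most 4 / x^(1/4) *)
  exists 16, 2^-1; split => // x x0 x1; rewrite ln1 subr0.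
  set w := x `^ 4^-1; have w0 : 0 < w by exact: powR_gt0.
  have w2 : x `^ 2^-1 = w ^+ 2.
    by rewrite /w -powR_mulrn ?powR_ge0// -powRrM; congr (_ `^ _); field.
  have w4 : x = w ^+ 4.
    by rewrite /w -powR_mulrn ?powR_ge0// -powRrM mulVf// powRr1// ltW.
  have := ln_sublinear (powR_gt0 (- 4^-1) x0); rewrite ln_powR powRN -/w => h.
  have h' : - ln x * w < 4.
    by rewrite -ltr_pdivlMr// -ltr_pdivrMl// mulrN mulrC -mulrN mulrC.
  have l0 : 0 <= - ln x * w by rewrite mulr_ge0 ?oppr_ge0 ?ln_le0// ltW.
  rewrite [X in _ * X <= _]w4 w2 (_ : _ * _ = (- ln x * w) ^+ 2 * w ^+ 2); last by ring.
  by rewrite ler_wpM2r ?sqr_ge0//; nra.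
exists 4, (Num.min (2 * H) 1); split; first by rewrite lt_min ltr01 mulr_gt0.
move=> x x0 x1; rewrite powR1.
have h1 : x `^ (2 * H) <= x `^ Num.min (2 * H) 1.
  by apply: ger_powR; rewrite ?x0// ge_min lexx.
have h2 : x <= x `^ Num.min (2 * H) 1.
  apply: (@le_trans _ _ (x `^ 1)); first by rewrite powRr1// ltW.
  by apply: ger_powR; rewrite ?x0// ge_min lexx orbT.
have := powR_2H x0; set y := x `^ a; move: h1 h2; set z := x `^ _; set z' := x `^ _ => h1 h2 e.
have : (y - 1) ^+ 2 <= 2 * y ^+ 2 + 2 by have := sqr_ge0 (y + 1); nra.
move=> /(ler_wpM2r (ltW x0)); move: e h1 h2; nra.
Qed.

Let Q_series : exists2 C : R, 0 < C & (\sum_(0 <= n <oo) (Q n)%:E = C%:E)%E.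
Proof.
have [c [d [d0 hcd]]] := phi_bound.
have pV0 : 0 < p%:R^-1 :> R by rewrite invr_gt0.
have pV1 : p%:R^-1 < 1 :> R by rewrite invf_lt1.
have pX0 n : 0 < p%:R ^- n :> R by rewrite invr_gt0 exprn_gt0.
have pX1 n : p%:R ^- n <= 1 :> R by rewrite invf_le1 ?exprn_gt0// exprn_ege1// ltW.
have p1 : 0 < 1 - p%:R^-1 :> R by rewrite subr_gt0.
apply: (@nneseries_geometric_bound _ _ (c * p%:R^-1 `^ d) (p%:R^-1 `^ d)).
- exact: powR_ge0.
- have := gt0_ltr_powR d0 (x := p%:R^-1) (y := 1); rewrite powR1; apply => //; rewrite nnegrE ?ltW//.
- rewrite /Q; apply: mulr_gt0; last exact: mulr_gt0.
  rewrite exprn_even_gt0//= subr_eq0 expr1 /phi.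
  case: ifPn => h; first by rewrite ln1 ln_eq0// lt_eqF.
  apply/negP => /eqP/(congr1 (@ln R)) /eqP; rewrite powR1 ln1 ln_powR mulf_eq0 ln_eq0//.
  by rewrite (lt_eqF pV1) orbF subr_eq0 (negPf h).
move=> n; apply/andP; split.
  by rewrite /Q mulr_ge0 ?sqr_ge0// mulr_ge0// ltW.
have h := hcd _ (pX0 n.+1) (pX1 n.+1).
have -> : c * p%:R^-1 `^ d * (p%:R^-1 `^ d) ^+ n = c * (p%:R ^- n.+1) `^ d.
  rewrite -mulrA -exprS -powR_mulrn ?powR_ge0// powRAC powR_mulrn ?ltW//.
  by rewrite exprVn.
apply: le_trans h; rewrite /Q mulrA; apply: ler_piMr; last by rewrite gerBl ltW.
by rewrite mulr_ge0 ?sqr_ge0// ltW.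
Qed.

Let f := @moving_average_kernel p R K H.

Let fE sing t x : x != 0 -> x != t ->
  f sing t x = phi (padic_abs (t - x)) - phi (padic_abs x).
Proof. by rewrite /f /moving_average_kernel /phi => /negPf -> /negPf -> /=; case: ifP. Qed.

Lemma measurable_moving_average sing t :
  measurable_fun setT (f sing t : padic_borel K -> R).
Proof.
apply: (measurable_locally_constant (F := [set 0; t])) => // x /= /not_orP[/eqP x0 /eqP xt].
have xt' : x - t != 0 by rewrite subr_eq0.
exists (Num.min (padic_abs x) (padic_abs (x - t))).
  by rewrite lt_min !padic_abs_gt0.
move=> y; rewrite lt_min => /andP[yx yt].
have e1 := padic_abs_close yx.
have e2 : padic_abs (y - t) = padic_abs (x - t).
  by apply: padic_abs_close; rewrite opprB addrA subrK.
have y0 : y != 0 by apply: contraTneq (padic_abs_gt0 x0) => h; rewrite -e1 h padic_abs0 ltxx.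
have yt' : y != t.
  by rewrite -subr_eq0; apply: contraTneq (padic_abs_gt0 xt') => h; rewrite -e2 h padic_abs0 ltxx.
by rewrite !fE// e1 (padic_abs_distC t y) e2 padic_abs_distC.
Qed.

Let integral_g_shift r t : (\int[m]_x (g r (x - t)%R)%:E = \int[m]_x (g r x)%:E)%E.
Proof.
apply: (haar_integral_translation m_haar (- t) (f := fun x => (g r x)%:E)).
  by apply/measurable_EFinP; exact: mg.
by move=> x; rewrite lee_fin g_ge0.
Qed.

(** The difference of the kernels is supported in the two balls of radius |t - s|
    around t and s, which contribute equally by translation. *)
Lemma moving_average_distance : exists2 C : R, 0 < C & forall sing t s,
  (\int[m]_x ((f sing t x - f sing s x) ^+ 2)%:E =
   (C * padic_abs (t - s) `^ (2 * H))%:E)%E.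
Proof.
have [C C0 QC] := Q_series; exists (2 * C); first by rewrite mulr_gt0.
move=> sing t s; have [->|ts] := eqVneq t s.
  under eq_integral do rewrite subrr expr0n.
  by rewrite integral0 subrr padic_abs0 powR0 ?mulr0// mulf_neq0// gt_eqF.
set r := padic_abs (t - s).
have mgE u : measurable_fun setT (fun x : padic_borel K => (g r (x - u))%:E).
  apply/measurable_EFinP; apply: (measurableT_comp (mg r)).
  exact: measurable_padic_translation.
rewrite (haar_ae_eq p_prime m_haar (F := [set 0; t; s])
  (g := fun x => ((g r (x - s))%:E + (g r (x - t))%:E)%E)).
- rewrite ge0_integralD//; first last.
  + by move=> x _; rewrite lee_fin g_ge0.
  + by move=> x _; rewrite lee_fin g_ge0.
  rewrite !integral_g_shift /r integral_g ?subr_eq0//.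
  under eq_eseriesr do rewrite EFinM.
  rewrite nneseriesZl; last first.
    move=> n _; rewrite lee_fin mulr_ge0 ?sqr_ge0// mulr_ge0//.
    by rewrite subr_ge0 invf_le1// ltW.
  by rewrite QC -EFinM -EFinD; congr EFin; ring.
- by [].
- apply/measurable_EFinP; apply: measurable_funX; apply: measurable_funB; exact: measurable_moving_average.
- exact: emeasurable_funD.
move=> x /= /not_orP[/not_orP[/eqP x0 /eqP xt] /eqP xs].
by rewrite !fE// opprB addrA subrK -EFinD sq_split.
Qed.

(** The kernel at 0 vanishes almost everywhere. *)
Lemma moving_average_norm sing t C :
  (\int[m]_x ((f sing t x - f sing 0 x) ^+ 2)%:E = C)%E ->
  (\int[m]_x (f sing t x ^+ 2)%:E = C)%E.
Proof.
move=> <-; apply: (haar_ae_eq p_prime m_haar (F := [set 0])) => //.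
- by apply/measurable_EFinP; apply: measurable_funX; exact: measurable_moving_average.
- apply/measurable_EFinP; apply: measurable_funX; apply: measurable_funB; exact: measurable_moving_average.
by move=> x /= /eqP x0; rewrite (fE _ (t := 0))// sub0r padic_absN subrr subr0.
Qed.

End moving_average.

(** * The harmonizable kernel *)

Section harmonizable.
Import ComplexField.Normc.
Context {p : nat} (p_prime : prime p) {R : realType} {K : padicFieldType p R}
  (m : {measure set (padic_borel K) -> \bar R}) (m_haar : is_haar m)
  (H : R) (H_gt0 : 0 < H).

Let p_gt0 : 0 < p%:R :> R. Proof. by rewrite ltr0n prime_gt0. Qed.
Let p_gt1 : 1 < p%:R :> R. Proof. by rewrite ltr1n prime_gt1. Qed.
Let pX_gt0 n : 0 < p%:R ^+ n :> R. Proof. exact: exprn_gt0. Qed.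

Let D (x : K) : R := normc (padic_char x - 1) ^+ 2.

Let D_ge0 x : 0 <= D x. Proof. exact: sqr_ge0. Qed.

Let D_le4 x : D x <= 4.
Proof.
have h : normc (padic_char x - 1) <= 2.
  apply: le_trans (le_normcD (padic_char x) (-1)) _.
  by rewrite normcN normc1 normc_padic_char// -[2]/(1 + 1).
rewrite /D (_ : 4 = 2 ^+ 2); last by ring.
by rewrite ler_pXn2r ?nnegrE ?normc_nonneg.
Qed.

Let D_int x : padic_abs x <= 1 -> D x = 0.
Proof. by move=> x1; rewrite /D padic_char_int// subrr normc0 expr0n. Qed.

Let D_shift x z : padic_abs z <= 1 -> D (x + z) = D x.
Proof. by move=> z1; rewrite /D padic_charD// (padic_char_int z1) mulr1. Qed.

Let f := @harmonizable_kernel p R K H.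

Let w (x : K) : R := padic_abs x `^ (- (2 * H) - 1).

Lemma normc_real (r : R) : 0 <= r -> normc r%:C%C = r.
Proof. by move=> r0; rewrite /= expr0n /= addr0 sqrtr_sqr ger0_norm. Qed.

Lemma harmonizable_sub sing t s x : x != 0 ->
  normc (f sing t x - f sing s x) ^+ 2 = D ((t - s) * x) * w x.
Proof.
move=> x0; rewrite /f /harmonizable_kernel (negPf x0).
rewrite -mulrBl opprB addrA subrK normcM exprMn normc_padic_charB// -mulrBl -/(D _).
rewrite normc_real ?powR_ge0// -powR_mulrn ?powR_ge0// -powRrM /w; congr (_ * _ `^ _).
by field.
Qed.

Lemma locally_constant_harmonizable (t x : K) : x != 0 -> exists2 e : R, 0 < e &
  forall y, padic_abs (y - x) < e -> [/\ y != 0, padic_abs y = padic_abs x &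
    padic_abs (t * y - t * x) <= 1].
Proof.
move=> x0; have t1 : 0 < padic_abs t + 1 by rewrite ltr_wpDl ?padic_abs_ge0.
exists (Num.min (padic_abs x) (padic_abs t + 1)^-1).
  by rewrite lt_min padic_abs_gt0// invr_gt0.
move=> y; rewrite lt_min => /andP[yx yt]; have e := padic_abs_close yx; split => //.
  by apply: contraTneq (padic_abs_gt0 x0) => h; rewrite -e h padic_abs0 ltxx.
rewrite -mulrBr padic_absM; apply: (@le_trans _ _ ((padic_abs t + 1) * (padic_abs t + 1)^-1)).
  by apply: ler_pM; rewrite ?padic_abs_ge0 ?lerDl ?ler01// ltW.
by rewrite divff// gt_eqF.
Qed.

Lemma measurable_harmonizable sing t :
  complex_measurable (f sing t : padic_borel K -> R[i]).
Proof.
have h x : ~ [set 0 : K] x -> exists2 e : R, 0 < e &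
    forall y, padic_abs (y - x) < e -> f sing t y = f sing t x.
  move=> /= /eqP x0; have [e e0 he] := locally_constant_harmonizable t x0.
  exists e => // y /he[y0 yx ty]; rewrite /f /harmonizable_kernel (negPf x0) (negPf y0) yx.
  by rewrite -{1}(subrK (t * x) (t * y)) padic_charD// (padic_char_int ty) mul1r.
split; apply: (measurable_locally_constant (F := [set 0])) => // x /h[e e0 he];
  by exists e => // y /he ->.
Qed.

Let g (u x : K) : R := D (u * x) * w x.

Let g_ge0 u x : 0 <= g u x. Proof. by rewrite mulr_ge0// powR_ge0. Qed.

Let mg u : measurable_fun setT (g u : padic_borel K -> R).
Proof.
apply: (measurable_locally_constant (F := [set 0])) => // x /= /eqP x0.
have [e e0 he] := locally_constant_harmonizable u x0.
exists e => // y /he[y0 yx uy]; rewrite /g /w yx.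
by rewrite -(subrK (u * x) (u * y)) addrC D_shift.
Qed.

(* The units modulo p ^ (n + 1) are the residues a with |a| = 1. *)
Let S (n : nat) : R := \sum_(0 <= a < p ^ n.+1)
  if padic_abs (a%:R : K) == 1 then D (a%:R / p%:R ^+ n.+1) else 0.

Let Q (n : nat) : R := (p%:R ^+ n.+1) `^ (- (2 * H) - 1) * S n.

(* On the sphere of radius p ^ (n + 1) / |u|, the integrand only depends on
   the class of u x modulo p-adic integers. *)
Let integral_sphere (u : K) n : u != 0 ->
  (\int[m]_(x in [set x : K | padic_abs x = ((padic_abs u)^-1 * p%:R ^+ n.+1)%R]) (g u x)%:E =
   (padic_abs u `^ (2 * H) * Q n)%:E)%E.
Proof.
move=> u0; have u1 := padic_abs_gt0 u0; set r := (padic_abs u)^-1 * _.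
pose v : K := (u * p%:R ^+ n.+1)^-1.
have pK : (p%:R ^+ n.+1 : K) != 0 by rewrite expf_neq0// padic_p_neq0.
have v0 : v != 0 by rewrite invr_eq0 mulf_neq0.
have vr : padic_abs v = r.
  by rewrite /v padic_absV padic_absM padic_absX padic_abs_p// exprVn invfM invrK.
have r0 : 0 < r by rewrite mulr_gt0// invr_gt0.
have rp : r * p%:R ^- n.+1 = padic_abs u^-1.
  by rewrite /r mulfK ?padic_absV// gt_eqF.
have urlt : padic_abs u^-1 < r.
  by rewrite -rp gtr_pMr// invf_lt1// exprn_egt1.
pose F (x : padic_borel K) : \bar R := (if padic_abs (x : K) == r then D (u * x) * r `^ (- (2 * H) - 1) else 0)%:E.
have mF : measurable_fun setT F.
  apply/measurable_EFinP; apply: (measurable_locally_constant (F := [set 0])) => // x /= /eqP x0.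
  have [e e0 he] := locally_constant_harmonizable u x0.
  exists e => // y /he[y0 yx uy]; rewrite yx.
  by rewrite -(subrK (u * x) (u * y)) addrC D_shift.
have F0 x : (0 <= F x)%E.
  by rewrite lee_fin; case: ifP => // _; rewrite mulr_ge0// powR_ge0.
transitivity (\int[m]_(x in [set x : K | (padic_abs x <= padic_abs v)%R]) F x)%E.
  rewrite vr.
  rewrite [in LHS](_ : [set x : K | _] = [set x : K | padic_abs x <= r] `&` [set x : K | padic_abs x = r]).
    rewrite integral_mkcondr; apply: eq_integral => x _; rewrite patchE /F.
    case: ifPn; first by rewrite inE => /= xr; rewrite xr eqxx /g /w xr.
    by move/negP; case: eqP => // xr []; rewrite inE.
  by apply/seteqP; split => x /=; [move=> ->; split|case].
rewrite (haar_integral_coset p_prime m_haar (i := n.+1) v0 mF F0) vr rp.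
  rewrite (haar_ball p_prime m_haar) ?invr_neq0// padic_absV sumEFin -EFinM; congr EFin.
  have Fa a : (if padic_abs (a%:R * v) == r then D (u * (a%:R * v)) * r `^ (- (2 * H) - 1) else 0) =
      r `^ (- (2 * H) - 1) * (if padic_abs (a%:R : K) == 1 then D (a%:R / p%:R ^+ n.+1) else 0).
    rewrite padic_absM vr -[X in _ == X]mul1r (inj_eq (mulIf (lt0r_neq0 r0))).
    case: ifP => _; last by rewrite mulr0.
    by rewrite mulrC; congr (_ * D _); rewrite mulrCA /v invfM mulVKf.
  under eq_bigr do rewrite Fa.
  rewrite -mulr_sumr -/(S n) /Q /r powRM ?invr_ge0 ?ltW//.
  have e : (padic_abs u)^-1 `^ (- (2 * H) - 1) / padic_abs u = padic_abs u `^ (2 * H).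
    rewrite -(powR_inv1 (ltW u1)) -powRrM -powRD; first by congr (_ `^ _); ring.
    by apply/implyP => _; rewrite gt_eqF.
  by rewrite -e; ring.
move=> x z zr; rewrite /F; have zr' : padic_abs z < r by rewrite (le_lt_trans zr)// vr rp.
have -> : (padic_abs (x + z : K) == r) = (padic_abs (x : K) == r).
  apply/eqP/eqP => e; last by rewrite padic_absD_eq e.
  by rewrite -(addrK z x) padic_absD_eq ?padic_absN e.
rewrite mulrDr D_shift// padic_absM.
by rewrite (le_trans (ler_wpM2l (ltW u1) zr))// padic_absV divff// gt_eqF.
Qed.

Let Q_series : exists2 C : R, 0 < C & (\sum_(0 <= n <oo) (Q n)%:E = C%:E)%E.
Proof.
have S0 n : 0 <= S n by apply: sumr_ge0 => a _; case: ifP.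
set q := p%:R `^ (- (2 * H)).
apply: (@nneseries_geometric_bound _ _ (4 * q) q).
- exact: powR_ge0.
- rewrite /q powRN invf_lt1 ?powR_gt0//.
  have : 1 `^ (2 * H) < p%:R `^ (2 * H).
    by apply: gt0_ltr_powR; rewrite ?nnegrE ?mulr_gt0// ltW.
  by rewrite powR1.
- rewrite /Q mulr_gt0 ?powR_gt0//.
  have p1 : (1 < p ^ 1)%N by rewrite expn1 prime_gt1.
  rewrite /S (big_cat_nat (n := 1))//=; last exact: ltnW.
  rewrite (@big_ltn _ _ _ 1)//= padic_abs1 eqxx.
  apply: ltr_wpDl; first by apply: sumr_ge0 => a _; case: ifP.
  apply: ltr_wpDr; first by apply: sumr_ge0 => a _; case: ifP.
  rewrite lt0r D_ge0 andbT sqrf_eq0; apply/eqP => /eq0_normc.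
  rewrite (@padic_char_approx _ p_prime _ _ _ 1 1) ?subrr ?padic_abs0//.
  move=> /eqP; rewrite subr_eq0 => /eqP/(congr1 (@complex.Re R)) /=.
  rewrite mulr1 expr1 => e.
  have /cos_inj h : cos (2 * pi / p%:R) = cos 0 :> R by rewrite cos0.
  have p2 : 2 <= p%:R :> R by rewrite ler_nat prime_gt1.
  have pi0 : 0 < 2 * pi / p%:R :> R by rewrite divr_gt0// mulr_gt0// pi_gt0.
  have := h _ _; rewrite !in_itv /= lexx pi_ge0 (ltW pi0) ler_pdivrMr//= mulrC ler_wpM2l ?pi_ge0//.
  by move=> /(_ isT isT) e'; rewrite [2 * pi]mulrC e' ltxx in pi0.
move=> n; apply/andP; split; first by rewrite mulr_ge0// powR_ge0.
have Sle : S n <= 4 * p%:R ^+ n.+1.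
  apply: (@le_trans _ _ (\sum_(0 <= a < p ^ n.+1) 4)).
    by apply: ler_sum => a _; case: ifP.
  by rewrite big_const_nat iter_addr_0 subn0 -natrX mulr_natr.
rewrite /Q; apply: le_trans (ler_wpM2l (powR_ge0 _ _) Sle) _.
have -> : (p%:R ^+ n.+1 : R) `^ (- (2 * H) - 1) = q ^+ n.+1 / p%:R ^+ n.+1.
  rewrite powRD; last by apply/implyP => _; rewrite gt_eqF.
  rewrite powR_inv1 ?ltW//; congr (_ / _).
  by rewrite /q -(powR_mulrn n.+1 (powR_ge0 _ _)) -(powR_mulrn n.+1 (ltW p_gt0)) powRAC.
by rewrite mulrCA mulfVK ?gt_eqF// exprS mulrA.
Qed.

(** The spheres of radius p^n / |t - s| with n >= 1 carry the integrand, and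
    scaling extracts the power of |t - s|. *)
Lemma harmonizable_distance : exists2 C : R, 0 < C & forall sing t s,
  (\int[m]_x (normc (f sing t x - f sing s x) ^+ 2)%:E =
   (C * padic_abs (t - s) `^ (2 * H))%:E)%E.
Proof.
have [C C0 QC] := Q_series; exists C => //.
move=> sing t s; have [->|ts] := eqVneq t s.
  under eq_integral do rewrite subrr normc0 expr0n.
  by rewrite integral0 subrr padic_abs0 powR0 ?mulr0// mulf_neq0// gt_eqF.
have u0 : t - s != 0 by rewrite subr_eq0.
have u1 := padic_abs_gt0 u0.
rewrite (haar_ae_eq p_prime m_haar (F := [set 0]) (g := fun x => (g (t - s) x)%:E)).
- rewrite (haar_integral_spheres m (r := fun n => (padic_abs (t - s))^-1 * p%:R ^+ n.+1)).
  + under eq_eseriesr do rewrite integral_sphere// EFinM.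
    rewrite nneseriesZl; first by rewrite QC -EFinM mulrC.
    move=> n _; rewrite lee_fin mulr_ge0 ?powR_ge0//; apply: sumr_ge0 => a _.
    by case: ifP.
  + move=> i j; apply: (padic_exp_inj p_prime); rewrite invr_gt0//.
  + by apply/measurable_EFinP; exact: mg.
  + by move=> x; rewrite lee_fin.
  move=> x gx.
  have x1 : 1 < padic_abs ((t - s) * x).
    rewrite ltNge; apply/negP => h; move: gx; rewrite /g D_int// mul0r eqxx.
    done.
  have [n hn] := padic_abs_gt1 p_prime x1.
  by exists n; rewrite -hn padic_absM mulKf// gt_eqF.
- by [].
- apply/measurable_EFinP; apply: measurable_funX; apply: measurable_normc.
  by apply: complex_measurableB; exact: measurable_harmonizable.
- by apply/measurable_EFinP; exact: mg.
by move=> x /= /eqP x0; rewrite harmonizable_sub.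
Qed.

(** The kernel at 0 vanishes almost everywhere. *)
Lemma harmonizable_norm sing t C :
  (\int[m]_x (normc (f sing t x - f sing 0 x) ^+ 2)%:E = C)%E ->
  (\int[m]_x (normc (f sing t x) ^+ 2)%:E = C)%E.
Proof.
move=> <-; apply: (haar_ae_eq p_prime m_haar (F := [set 0])) => //.
- apply/measurable_EFinP; apply: measurable_funX; apply: measurable_normc.
  exact: measurable_harmonizable.
- apply/measurable_EFinP; apply: measurable_funX; apply: measurable_normc.
  by apply: complex_measurableB; exact: measurable_harmonizable.
move=> x /= /eqP x0; rewrite [X in _ - X](_ : _ = 0) ?subr0//.
by rewrite /f /harmonizable_kernel (negPf x0) mul0r padic_char_int ?padic_abs0// subrr mul0r.
Qed.

End harmonizable.

(** * The kernel on the tree of residues *)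

Section tree.
Context {p : nat} (p_prime : prime p) {R : realType} {K : padicFieldType p R}
  (H : R) (H_gt0 : 0 < H).

Let p_gt0 : 0 < p%:R :> R. Proof. by rewrite ltr0n prime_gt0. Qed.
Let p_gt1 : 1 < p%:R :> R. Proof. by rewrite ltr1n prime_gt1. Qed.

Let f := @residue_kernel p R H.

Lemma measurable_residue_levels (g : residue_levels p -> R) : measurable_fun setT g.
Proof. by move=> _ A _. Qed.

Let q := p%:R `^ (- (2 * H)) : R.

Let residue_eq k (n m : nat) :
  (n%:R == m%:R :> 'Z_(p ^ k.+1)) = (n == m %[mod p ^ k.+1]).
Proof.
have pk : (1 < p ^ k.+1)%N by rewrite -(exp1n k.+1) ltn_exp2r// prime_gt1.
by rewrite -val_eqE /= !val_Zp_nat.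
Qed.

Let counting2 (a b : residue_levels p) : a != b ->
  counting [set a; b] = (2 : R)%:E.
Proof.
move=> ab; rewrite /counting asboolT; last by [].
by rewrite fset_setU// !fset_set1 finmap.cardfs2 ab.
Qed.

Let level k : set (residue_levels p) := [set e | tag e = k].

Let leaf k (r : 'Z_(p ^ k.+1)) : residue_levels p := existT _ k r.

Let leaf_eq k (r s : 'Z_(p ^ k.+1)) : (leaf r == leaf s) = (r == s).
Proof. by rewrite -tag_eqE /tag_eq eqxx /= tagged_asE. Qed.

Let integral_level k (n m : nat) :
  (\int[counting]_(e in level k) ((f n e - f m e) ^+ 2)%:E =
   (if n == m %[mod p ^ k.+1] then 0 else 2 * q ^+ k)%:E)%E.
Proof.
pose a := leaf (n%:R : 'Z_(p ^ k.+1)); pose b := leaf (m%:R : 'Z_(p ^ k.+1)).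
have qk : (p%:R `^ (- (k%:R * H))) ^+ 2 = q ^+ k :> R.
  rewrite /q -(powR_mulrn 2 (powR_ge0 _ _)) -(powR_mulrn k (powR_ge0 _ _)) -!powRrM.
  by congr (_ `^ _); ring.
have fE (r : 'Z_(p ^ k.+1)) : (f n (leaf r) - f m (leaf r)) ^+ 2 =
    q ^+ k * ((r == n%:R)%:R - (r == m%:R)%:R) ^+ 2.
  rewrite /f /residue_kernel -mulrBr opprB addrA subrK exprMn qk.
  done.
case: ifPn => nm.
  rewrite -[RHS](integral0 counting (level k)); apply: eq_integral => -[k' r].
  rewrite inE /level /= => e; move: r; rewrite e => r; rewrite -/(leaf r) fE.
  by move: nm; rewrite -residue_eq => /eqP ->; rewrite subrr expr0n mulr0.
have ab : a != b by rewrite leaf_eq residue_eq.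
transitivity (\int[counting]_(e in level k) ((q ^+ k)%:E * (\1_[set a; b] e)%:E))%E.
  apply: eq_integral => -[k' r].
  rewrite inE /level /= => e; move: r; rewrite e => r; rewrite -/(leaf r) fE -EFinM.
  congr (_ * _)%:E; rewrite /indic.
  have -> : (leaf r \in [set a; b]) = (r == n%:R) || (r == m%:R).
    apply/idP/orP; rewrite inE /=.
      by case=> /eqP; rewrite leaf_eq; [left|right].
    by case=> /eqP ->; [left|right].
  have : ~~ ((r == n%:R) && (r == m%:R)).
    by apply: contra ab => /andP[/eqP h1 /eqP h2]; rewrite leaf_eq -h1 -h2.
  by do 2![case: eqP => _ //=] => _; rewrite ?subr0 ?sub0r ?sqrrN ?expr1n ?expr0n.
rewrite ge0_integralZl_EFin//; last by rewrite exprn_ge0// powR_ge0.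
rewrite integral_indic// setIidl; last by move=> e [] ->.
by rewrite [X in (_ * X)%E]counting2// -EFinM mulrC.
Qed.

(** Two integers are separated exactly from the level of the p-adic valuation
    of their difference on. *)
Lemma residue_kernel_distance : exists2 C : R, 0 < C & forall n m : nat,
  (\int[counting]_(e in [set: residue_levels p]) ((f n e - f m e) ^+ 2)%:E =
   (C * padic_abs (n%:R - m%:R : K) `^ (2 * H))%:E)%E.
Proof.
have q0 : 0 <= q by exact: powR_ge0.
have q1 : q < 1.
  rewrite /q powRN invf_lt1 ?powR_gt0//.
  have : 1 `^ (2 * H) < p%:R `^ (2 * H).
    by apply: gt0_ltr_powR; rewrite ?nnegrE ?mulr_gt0// ltW.
  by rewrite powR1.
have q00 : 0 < 2 * q ^+ 0 by rewrite expr0 mulr1.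
have qk k : 0 <= 2 * q ^+ k <= 2 * q ^+ k by rewrite lexx mulr_ge0 ?exprn_ge0.
have [C C0 hC] := nneseries_geometric_bound q0 q1 q00 qk.
exists C => // n m.
have -> : [set: residue_levels p] = \bigcup_k level k.
  by apply/seteqP; split => // e _; exists (tag e).
rewrite ge0_integral_bigcup//; last 2 first.
- by move=> e _; rewrite lee_fin sqr_ge0.
- by move=> i j _ _ [e [/= <- <-]].
under eq_eseriesr do rewrite integral_level.
wlog nm : n m / (m <= n)%N => [h|].
  have [/h//|/ltnW/h] := leqP m n; rewrite padic_abs_distC => <-.
  by apply: eq_eseriesr => k _; rewrite eq_sym.
have [->|nm'] := eqVneq n m.
  under eq_eseriesr do rewrite eqxx.
  rewrite eseries0// subrr padic_abs0 powR0 ?mulr0//.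
  by rewrite mulf_neq0// gt_eqF.
have d0 : (0 < n - m)%N by rewrite subn_gt0 ltn_neqAle nm eq_sym nm'.
set v := logn p (n - m).
have E k : (n == m %[mod p ^ k.+1]) = (k < v)%N.
  by rewrite eqn_mod_dvd// pfactor_dvdn.
under eq_eseriesr do rewrite E.
rewrite (nneseries_split 0 v); last by move=> k _; rewrite lee_fin; case: ifP => //; rewrite mulr_ge0 ?exprn_ge0.
rewrite add0n big1_seq ?add0e; last first.
  by move=> k; rewrite mem_index_iota => /andP[_ /andP[_ ->]].
rewrite -nneseries_addn; last by move=> k; rewrite lee_fin; case: ifP => //; rewrite mulr_ge0 ?exprn_ge0.
transitivity (\sum_(0 <= k <oo) (q ^+ v)%:E * (2 * q ^+ k)%:E)%E.
  apply: eq_eseriesr => k _; rewrite ltnNge leq_addl /= -EFinM exprD; congr EFin; ring.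
rewrite nneseriesZl; last by move=> k _; rewrite lee_fin mulr_ge0 ?exprn_ge0.
rewrite hC -EFinM -natrB// padic_abs_nat_gt0// -/v mulrC; congr (_ * _)%:E.
rewrite /q -(powR_inv1 (exprn_ge0 v (ltW p_gt0))) -(powR_mulrn v (powR_ge0 _ _)) -(powR_mulrn v (ltW p_gt0)).
by rewrite -!powRrM; congr (_ `^ _); ring.
Qed.

Lemma residue_kernel0 : f 0%N = cst 0.
Proof.
by apply/funext => -[k r]; rewrite /f /residue_kernel subrr mulr0.
Qed.

End tree.

(** * The three representations *)

Theorem corollary3p10 (R : realType) (p : nat) (p_prime : prime p)
    (H : R) (H_gt0 : 0 < H) (K : padicFieldType p R)
    (m : {measure set (padic_borel K) -> \bar R}) (m_haar : is_haar m)
    (d0 : measure_display) (T0 : measurableType d0) (P0 : probability T0 R)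
    (B : K -> T0 -> R) (B_fBm : is_padic_fBm P0 H B) :
  [/\ exists2 c : R, 0 < c &
      forall (d : measure_display) (T : measurableType d)
        (P : probability T R) (M : set (padic_borel K) -> T -> R)
        (sing : K -> K -> R),
        gaussian_random_measure P m M ->
        (forall t : K, exists Y : T -> R,
           is_integral P m M (moving_average_kernel H sing t) Y) /\
        (forall X : K -> T -> R,
           (forall t : K,
              is_integral P m M (moving_average_kernel H sing t) (X t)) ->
           fdd_eq P X P0 (fun t w => c * B t w)),
      exists2 c : R, 0 < c &
      forall (d : measure_display) (T : measurableType d)
        (P : probability T R) (M : set (padic_borel K) -> T -> R[i])
        (sing : K -> K -> R[i]),
        complex_gaussian_random_measure P m M ->
        (forall t : K, exists Y : T -> R[i],
           is_complex_integral P m M (harmonizable_kernel H sing t) Y) /\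
        (forall Z : K -> T -> R[i],
           (forall t : K,
              is_complex_integral P m M (harmonizable_kernel H sing t) (Z t)) ->
           fdd_eq P (fun t w => complex.Re (Z t w)) P0 (fun t w => c * B t w)) &
      exists2 c : R, 0 < c &
      forall (d : measure_display) (T : measurableType d)
        (P : probability T R) (M : set (residue_levels p) -> T -> R),
        gaussian_random_measure P counting M ->
        (forall n : nat, exists Y : T -> R,
           is_integral P counting M (residue_kernel H n) Y) /\
        (forall X : nat -> T -> R,
           (forall n : nat,
              is_integral P counting M (residue_kernel H n) (X n)) ->
           fdd_eq P X P0 (fun n w => c * B n%:R w))].

Proof.
split.
- have [C C0 hC] := moving_average_distance p_prime m_haar H_gt0.
  exists (Num.sqrt (2 * C)); first by rewrite sqrtr_gt0 mulr_gt0.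
  move=> d T P M sing gM.
  apply: (real_kernel_fdd_eq B_fBm (tau := id) C0 gM).
  + by move=> t; exact: measurable_moving_average.
  + move=> t; apply: (moving_average_norm p_prime m_haar).
    by rewrite hC subr0.
  + exact: hC.
- have [C C0 hC] := harmonizable_distance p_prime m_haar H_gt0.
  exists (Num.sqrt (2 * C)); first by rewrite sqrtr_gt0 mulr_gt0.
  move=> d T P M sing gM.
  apply: (complex_kernel_fdd_eq B_fBm (tau := id) C0 gM).
  + by move=> t; exact: measurable_harmonizable.
  + move=> t; apply: (harmonizable_norm p_prime m_haar).
    by rewrite hC subr0.
  + exact: hC.
have [C C0 hC] := residue_kernel_distance p_prime (K := K) H_gt0.
exists (Num.sqrt (2 * C)); first by rewrite sqrtr_gt0 mulr_gt0.
move=> d T P M gM.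
apply: (real_kernel_fdd_eq B_fBm (tau := fun n : nat => n%:R) C0 gM).
- by move=> n; exact: measurable_residue_levels.
- move=> n; have := hC n 0%N; rewrite subr0 residue_kernel0 => <-.
  by apply: eq_integral => e _; rewrite subr0.
- exact: hC.
Qed.
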